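(* Let $(X_n)_{n\ge 0}$ be the sequence of random variables determined in distribution by $X_0=0$ and, for $n\ge 1$, $$X_n \overset{d}{=} X_{I_n}+X^{*}_{n-1-I_n}+I_n,$$ where $(X_n)$, $(X^*_n)$ and $I_n$ are independent, $X_n\overset{d}{=}X^*_n$ for all $n$, and $I_n$ is uniformly distributed on $\{0,1,\dots,n-1\}$. (This is the major cost of MacLeod's in-situ permutation algorithm on random input.) Let $\sigma:=\sqrt{2-\pi^2/6}$, let $Y$ be the limit in distribution of $(X_n-\mathbf{E}X_n)/n$ as $n\to\infty$, and let $X:=Y/\sigma$. Then, as $n\to\infty$, $$\zeta_3\!\left(\frac{X_n-\mathbf{E}X_n}{\sqrt{\operatorname{Var}(X_n)}},\,X\right)=\Theta\!\left(\frac{\log n}{n}\right).$$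
   Context: The limit $Y$ exists and satisfies the distributional fixed-point equation $Y\overset{d}{=}UY+(1-U)Y^*+C(U)$, where $Y\overset{d}{=}Y^*$, $U$ is uniform on $[0,1]$, $Y,Y^*,U$ are independent, and $C(u):=(1-u)\ln(1-u)+u\ln u+u$; moreover $\mathbf{E}Y=0$, $\operatorname{Var}(Y)=\sigma^2$ and $\mathbf{E}|Y|^3<\infty$. For distributions $\mathcal L(V),\mathcal L(W)$ of real random variables, the Zolotarev metric is $\zeta_3(V,W):=\sup_{f\in\mathcal F_3}|\mathbf{E}f(V)-\mathbf{E}f(W)|$, where $\mathcal F_3$ is the set of twice differentiable $f:\mathbb R\to\mathbb R$ with $|f''(x)-f''(y)|\le|x-y|$ for all $x,y$. The notation $a_n=\Theta(b_n)$ means there are constants $0<c_1\le c_2$ with $c_1 b_n\le a_n\le c_2 b_n$ for all sufficiently large $n$. *)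

(* Defs.v *)
From HB Require Import structures.
From mathcomp Require Import all_boot all_order all_algebra.
From mathcomp Require Import all_classical all_reals all_analysis.
Set Implicit Arguments.
Unset Strict Implicit.
Unset Printing Implicit Defensive.
Import Order.TTheory GRing.Theory Num.Theory.
Import numFieldNormedType.Exports.
Local Open Scope classical_set_scope.
Local Open Scope ring_scope.

Definition eq_dist (R : realType) d1 (T1 : measurableType d1)
    (P1 : probability T1 R) d2 (T2 : measurableType d2) (P2 : probability T2 R)
    d' (T' : measurableType d') (V : T1 -> T') (W : T2 -> T') : Prop :=
  forall B : set T', measurable B -> P1 (V @^-1` B) = P2 (W @^-1` B).

Definition sigma_family d (T : measurableType d) d' (T' : measurableType d')
    (J : Type) (V : J -> T -> T') : set (set T) :=
  <<s [set A | exists j B, measurable B /\ A = V j @^-1` B] >>.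

(* Each of F, G, H is meant to contain setT, so that the product rule for
   triples entails the product rule for pairs. *)
Definition independent3 (R : realType) d (T : measurableType d)
    (P : probability T R) (F G H : set (set T)) : Prop :=
  forall A B C, F A -> G B -> H C ->
    P (A `&` B `&` C) = (P A * P B * P C)%E.

Definition uniform_below (R : realType) d (T : measurableType d)
    (P : probability T R) (n : nat) (I : T -> nat) : Prop :=
  forall k : nat, (k < n)%N -> P (I @^-1` [set k]) = (n%:R^-1 : R)%:E.

Definition cvg_in_dist (R : realType) d (T : measurableType d)
    (P : probability T R) d' (T' : measurableType d') (Q : probability T' R)
    (V : nat -> T -> R) (W : T' -> R) : Prop :=
  forall f : R -> R, continuous f -> (exists M, forall x, `|f x| <= M) ->
    'E_P[f \o V n]%E @[n --> \oo] --> 'E_Q[f \o W]%E.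

Definition F3 (R : realType) : set (R -> R) :=
  [set f : R -> R | [/\ forall x : R, derivable f x 1,
               forall x : R, derivable (f^`())%classic x 1 &
               forall x y : R, `|(f^`(2))%classic x - (f^`(2))%classic y| <= `|x - y| ]].

(* The value is +oo when no finite bound exists.  As expectations are total, the
   formula has its usual meaning when V and W are measurable with finite absolute
   third moments, since then f \o V and f \o W are integrable for f in F3. *)
Definition zeta3 (R : realType) d (T : measurableType d) (P : probability T R)
    d' (T' : measurableType d') (Q : probability T' R)
    (V : T -> R) (W : T' -> R) : \bar R :=
  ereal_sup [set `|'E_P[f \o V] - 'E_Q[f \o W]|%E | f in @F3 R].

Definition is_Theta (R : realType) (a : nat -> \bar R) (b : nat -> R) : Prop :=
  exists c1 c2 : R, [/\ 0 < c1, c1 <= c2 &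
    \forall n \near \oo, ((c1 * b n)%:E <= a n <= (c2 * b n)%:E)%E].

(* Main.v *)
(* The third central moments settle the lower bound, and a coupling settles the
   upper bound; the limit Y enters only through uniformly integrable convergence.

   The mean, and the variance v_n = sigma^2 n^2 - n ln n + O(n), are explicit in
   harmonic numbers (Basel's series gives sigma).  The third central moment is
   kappa n^3 + O(n^2) with kappa > 0: the centred toll splits into a symmetric
   part s and an antisymmetric part t, the sum of s t^2 is a polynomial, and the
   sum of s^3 is compared for consecutive n by a Polya urn step.  Since the test
   function x^3 / 6 only sees the ratio of these moments, the term - n ln n in
   v_n contributes exactly the order ln n / n.

   For the upper bound, compare W_n = X_n - E X_n with the rescaled W_m for
   m >= n, instead of with the fixed point.  A uniform k < n m gives uniform
   splits k / m of n and k / n of m; once the parts are replaced by rescaled parts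
   of the split of m, both sides have the same first two moments and differ by
   O(ln n) in the fourth mean.  Taylor's formula then gives
   d_n <= (2 / n) sum_{i < n} d_i + O(n^2 ln n) for the distance d_n, whence
   d_n = O(n^2 ln n); let m tend to infinity. *)

Require Import Defs.
From HB Require Import structures.
From mathcomp Require Import all_boot all_order all_algebra.
From mathcomp Require Import all_classical all_reals all_analysis.
From mathcomp Require Import measurable_realfun.
From mathcomp Require Import ring lra zify.
Import Order.TTheory GRing.Theory Num.Theory.
Import numFieldNormedType.Exports.
Local Open Scope classical_set_scope.
Local Open Scope ring_scope.

(** * The law of the cost as a finite expectation functional *)

(** [Y] is given by weak convergence only: neither a recursion for it nor an independent copy is at
    hand. Comparing two finite costs avoids both, since the recursion then runs on finite sums, and
    a bound uniform in m lets m tend to infinity for one test function at a time. For uniformity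
    every coupling error is measured by a harmonic number of the smaller index. Rescaling by the
    ratio of standard deviations, instead of sizes, makes second moments agree exactly. They agree
    only after averaging over the split; this is enough because Taylor's formula is used at the
    fixed point 0, so that its coefficients do not depend on the split. The cubic remainder is an
    error of order ln n times the square of a quantity of order n, and the recurrence absorbs the
    resulting n^2 ln n because the mean of (i / n)^2 is about 1/3 < 1/2. The value of kappa is never
    computed: a crude lower bound for the sum of s^3 is outweighed by the exact sum of s t^2. *)

Lemma posD_nat_neq0 (R : realType) (x : R) (n : nat) : 0 < x -> x + n%:R != 0.
Proof. by move=> x0; rewrite gt_eqF // ltr_pwDl. Qed.

Lemma nat_posD_neq0 (R : realType) (x : R) (n : nat) : 0 < x -> n%:R + x != 0.
Proof. by rewrite addrC; apply: posD_nat_neq0. Qed.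

Ltac nat_neq0 := repeat (apply/andP; split); first
  [done | by apply: posD_nat_neq0 | by apply: nat_posD_neq0].

Section Law.
Set Implicit Arguments.
Unset Strict Implicit.
Unset Printing Implicit Defensive.
Variable R : realType.
Implicit Types (f g : R -> R) (n k i : nat).

(* The first argument is fuel bounding the recursion depth. *)
Fixpoint lawrec (k n : nat) (g : R -> R) : R :=
  if k is k'.+1 then if n is n'.+1 then
    n%:R^-1 * \sum_(i < n)
      lawrec k' i (fun x => lawrec k' (n' - i) (fun y => g (x + y + i%:R)))
  else g 0 else g 0.

(* [law n g] is the expectation of [g (X_n)]; no measurability is involved, as
   X_n takes finitely many values. *)
Definition law n := lawrec n n.

Lemma lawrec_fuel k k' n g : (n <= k)%N -> (n <= k')%N ->
  lawrec k n g = lawrec k' n g.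
Proof.
elim: k k' n g => [|k IH] [|k'] [|n] g //= nk nk'.
congr (_ * _); apply: eq_bigr => i _.
have le_in : (i <= n)%N by rewrite -ltnS.
rewrite (IH k'); [|exact: leq_trans le_in _..].
congr (lawrec _ _ _); apply/funext => x; apply: IH;
  exact: leq_trans (leq_subr _ _) _.
Qed.

Lemma law0 g : law 0 g = g 0. Proof. by []. Qed.

Lemma lawS n g : law n.+1 g = n.+1%:R^-1 * \sum_(i < n.+1)
  law i (fun x => law (n - i) (fun y => g (x + y + i%:R))).
Proof.
rewrite /law /=; congr (_ * _); apply: eq_bigr => i _.
rewrite (lawrec_fuel (k' := i)) //; last by rewrite -ltnS.
congr (lawrec _ _ _); apply/funext => x; apply: lawrec_fuel => //.
exact: leq_subr.
Qed.

Lemma law_ind (Pr : nat -> Prop) :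
  Pr 0%N -> (forall n, (forall i, (i <= n)%N -> Pr i) -> Pr n.+1) -> forall n, Pr n.
Proof.
move=> P0 PS n; elim/ltn_ind: n => -[//|n] IH.
by apply: PS => i le_in; apply: IH.
Qed.

Lemma lawD n f g : law n (fun x => f x + g x) = law n f + law n g.
Proof.
elim/law_ind: n f g => [//|n IH] f g.
rewrite !lawS -mulrDr -big_split /=; congr (_ * _); apply: eq_bigr => i _.
rewrite -IH; last by rewrite -ltnS.
by congr (law _ _); apply/funext => x; rewrite IH // leq_subr.
Qed.

Lemma lawZ n a f : law n (fun x => a * f x) = a * law n f.
Proof.
elim/law_ind: n f => [//|n IH] f.
rewrite !lawS mulrCA; congr (_ * _); rewrite mulr_sumr; apply: eq_bigr => i _.
rewrite -IH; last by rewrite -ltnS.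
by congr (law _ _); apply/funext => x; rewrite IH // leq_subr.
Qed.

Lemma law_cst n a : law n (fun=> a) = a.
Proof.
elim/law_ind: n a => [//|n IH] a; rewrite lawS.
under eq_bigr => i _.
  rewrite IH; last by rewrite -ltnS.
  rewrite IH; last exact: leq_subr.
  over.
by rewrite sumr_const card_ord -[a *+ _]mulr_natl mulKf // pnatr_eq0.
Qed.

Lemma ler_law n f g : (forall x, f x <= g x) -> law n f <= law n g.
Proof.
elim/law_ind: n f g => [f g fg|n IH f g fg]; first exact: fg.
rewrite !lawS ler_wpM2l ?invr_ge0 //; apply: ler_sum => i _.
apply: (IH) => [|x]; first by rewrite -ltnS.
by apply: IH => [|y]; [exact: leq_subr | exact: fg].
Qed.

Lemma lawN n f : law n (fun x => - f x) = - law n f.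
Proof. by under eq_fun do rewrite -mulN1r; rewrite lawZ mulN1r. Qed.

Lemma lawB n f g : law n (fun x => f x - g x) = law n f - law n g.
Proof. by rewrite lawD lawN. Qed.

Lemma law_sum n (J : Type) (r : seq J) (F : J -> R -> R) :
  law n (fun x => \sum_(j <- r) F j x) = \sum_(j <- r) law n (F j).
Proof.
elim: r => [|j r IH].
  by under eq_fun do rewrite big_nil; rewrite law_cst big_nil.
by under eq_fun do rewrite big_cons; rewrite lawD IH big_cons.
Qed.

(** Fubini for two independent costs; it allows either part of a split to be frozen while the other
    varies. *)
Lemma law_swap n m (F : R -> R -> R) :
  law n (fun x => law m (F x)) = law m (fun y => law n (fun x => F x y)).
Proof.
elim/law_ind: n F => [//|n IH] F.
rewrite lawS; under [X in _ = law m X]eq_fun do rewrite lawS.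
rewrite lawZ law_sum; congr (_ * _); apply: eq_bigr => i _.
rewrite -IH; last by rewrite -ltnS.
congr (law _ _); apply/funext => x.
by rewrite IH // leq_subr.
Qed.

Lemma ler_norm_law n f : `|law n f| <= law n (fun x => `|f x|).
Proof.
rewrite ler_norml -lawN; apply/andP; split; apply: ler_law => x.
  by rewrite lerNl ler_normr lexx orbT.
exact: ler_norm.
Qed.

Lemma law_ge0 n f : (forall x, 0 <= f x) -> 0 <= law n f.
Proof. by move=> f0; rewrite -(law_cst n 0); apply: ler_law. Qed.

(** Splitting n + 1 into parts i and j = n - i costs at most i^2 + j^2 + i <= (n + 1)^2. This crude
    range serves to reduce a law to finitely many atoms. *)
Lemma law_supp n f g :
  (forall k, (k <= n ^ 2)%N -> f k%:R = g k%:R) -> law n f = law n g.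
Proof.
elim/law_ind: n f g => [f g fg|n IH f g fg]; first exact: (fg 0%N).
rewrite !lawS; congr (_ * _); apply: eq_bigr => i _.
apply: (IH) => [|k kle]; first by rewrite -ltnS.
apply: IH => [|l lle]; first exact: leq_subr.
rewrite -!natrD; apply: fg.
have := ltn_ord i; rewrite ltnS => le_in.
have /subnKC Hn := le_in; rewrite -[in X in (_ <= X)%N]Hn.
move: (n - i)%N lle => j lle.
rewrite (leq_trans (leq_add (leq_add kle lle) (leqnn i))) //.
rewrite -addnS -!mulnn; nia.
Qed.

End Law.


(** * Harmonic sums *)

Section Harmonic.
Set Implicit Arguments.
Unset Strict Implicit.
Unset Printing Implicit Defensive.
Variable R : realType.
Implicit Types n k i j : nat.

Definition harm n : R := \sum_(i < n) i.+1%:R^-1.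
Definition harm2 n : R := \sum_(i < n) i.+1%:R^-1 ^+ 2.
Definition mcost n : R := n.+1%:R * harm n - 2 * n%:R.
Definition vcost n : R :=
  2 * n%:R ^+ 2 + 4 * n%:R - n.+1%:R ^+ 2 * harm2 n - n.+1%:R * harm n.

(* [sdev] and [tdev] are the parts of the centred toll that are symmetric and
   antisymmetric under [i |-> n - 1 - i]. *)
Definition sdev n i : R :=
  i.+1%:R * harm i.+1 + (n - i)%:R * harm (n - i) - n.+1%:R * harm n.+1
  + n.+1%:R / 2.
Definition tdev n i : R := i.+1%:R - n.+1%:R / 2.
Definition toll n i : R := mcost i + mcost (n.-1 - i) + i%:R - mcost n.

Lemma natrS_neq0 n : n%:R + 1 != 0 :> R.
Proof. by rewrite natr1 pnatr_eq0. Qed.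
Lemma natrSS_neq0 n : n%:R + 2 != 0 :> R.
Proof. by rewrite -natrD addn2 pnatr_eq0. Qed.
Hint Resolve natrS_neq0 natrSS_neq0 : core.

Lemma harm0 : harm 0 = 0. Proof. by rewrite /harm big_ord0. Qed.
Lemma harm20 : harm2 0 = 0. Proof. by rewrite /harm2 big_ord0. Qed.
Lemma harmS n : harm n.+1 = harm n + n.+1%:R^-1.
Proof. by rewrite /harm big_ord_recr. Qed.
Lemma harm2S n : harm2 n.+1 = harm2 n + n.+1%:R^-1 ^+ 2.
Proof. by rewrite /harm2 big_ord_recr. Qed.
Lemma mul_harmS n : n.+1%:R * harm n.+1 = n.+1%:R * harm n + 1.
Proof. by rewrite harmS mulrDr divff // pnatr_eq0. Qed.

Lemma sum_nat1 n : \sum_(j < n) j%:R = n%:R * (n%:R - 1) / 2 :> R.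
Proof.
elim: n => [|n IH]; first by rewrite big_ord0 mul0r mul0r.
by rewrite big_ord_recr /= IH; field.
Qed.

Lemma sum_nat2 n :
  \sum_(j < n) j%:R ^+ 2 = n%:R * (n%:R - 1) * (2 * n%:R - 1) / 6 :> R.
Proof.
elim: n => [|n IH]; first by rewrite big_ord0 !mul0r.
by rewrite big_ord_recr /= IH; field.
Qed.

Lemma sum_nat3 n :
  \sum_(j < n) j%:R ^+ 3 = (n%:R * (n%:R - 1)) ^+ 2 / 4 :> R.
Proof.
elim: n => [|n IH]; first by rewrite big_ord0 mul0r expr0n mul0r.
by rewrite big_ord_recr /= IH; field.
Qed.

(** Harmonic numbers enter through differences only, so a step in n adds a power sum over n + 1.
    Hence the sums for a = 1, 2, 3 below are polynomials. *)
Lemma sum_tail_recr n a :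
  \sum_(j < n.+1) j%:R ^+ a * (harm n.+1 - harm j) =
  \sum_(j < n) j%:R ^+ a * (harm n - harm j) +
  n.+1%:R^-1 * \sum_(j < n.+1) j%:R ^+ a.
Proof.
transitivity (\sum_(j < n.+1) (j%:R ^+ a * (harm n - harm j) +
                               n.+1%:R^-1 * j%:R ^+ a)).
  by apply: eq_bigr => j _; rewrite harmS; ring.
by rewrite big_split /= big_ord_recr /= subrr mulr0 addr0 mulr_sumr.
Qed.

Lemma sum_tail1 n :
  \sum_(j < n) j%:R * (harm n - harm j) = n%:R * (n%:R - 1) / 4.
Proof.
elim: n => [|n IH]; first by rewrite big_ord0 !mul0r.
have -> : \sum_(j < n.+1) j%:R * (harm n.+1 - harm j) =
  \sum_(j < n) j%:R * (harm n - harm j) + n.+1%:R^-1 * \sum_(j < n.+1) j%:R.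
  exact: (sum_tail_recr n 1).
by rewrite IH sum_nat1; field.
Qed.

Lemma sum_tail2 n : \sum_(j < n) j%:R ^+ 2 * (harm n - harm j) =
  n%:R * (n%:R - 1) * (4 * n%:R + 1) / 36.
Proof.
elim: n => [|n IH]; first by rewrite big_ord0 !mul0r.
by rewrite sum_tail_recr IH sum_nat2; field.
Qed.

Lemma sum_tail3 n : \sum_(j < n) j%:R ^+ 3 * (harm n - harm j) =
  n%:R * (n%:R - 1) * (3 * n%:R ^+ 2 + n%:R - 2) / 48.
Proof.
elim: n => [|n IH]; first by rewrite big_ord0 !mul0r.
by rewrite sum_tail_recr IH sum_nat3; field.
Qed.

Lemma sum_sqr_tail n : \sum_(j < n) j%:R * (harm n - harm j) ^+ 2 =
  n%:R * (n%:R - 3) / 4 + harm n / 2.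
Proof.
elim: n => [|n IH]; first by rewrite big_ord0 harm0 !mul0r addr0.
transitivity (\sum_(j < n.+1) (j%:R * (harm n - harm j) ^+ 2 +
   2 / n.+1%:R * (j%:R * (harm n - harm j)) + n.+1%:R^-1 ^+ 2 * j%:R)).
  by apply: eq_bigr => j _; rewrite harmS; ring.
rewrite !big_split /= -!mulr_sumr sum_nat1 !big_ord_recr /= subrr.
by rewrite expr0n !mulr0 !addr0 IH sum_tail1 harmS; field.
Qed.

Lemma sum_center_tail2 n :
  \sum_(j < n) j%:R * (harm j - harm n + 2^-1) ^+ 2 =
  n%:R * (n%:R - 5) / 8 + harm n / 2.
Proof.
transitivity (\sum_(j < n) (j%:R * (harm n - harm j) ^+ 2
    - (j%:R * (harm n - harm j)) + 4^-1 * j%:R)).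
  by apply: eq_bigr => j _; field.
rewrite !big_split /= sumrN sum_sqr_tail sum_tail1 -mulr_sumr sum_nat1.
by field.
Qed.

(** The parts of the split have sizes i + 1 and n - i. Here the second part grows by one, in
    [sdev_stepr] the first; the increment involves only the part that grows. *)
Lemma sdev_stepl n i : (i <= n)%N ->
  sdev n.+1 i = sdev n i + (harm (n - i) - harm n.+1 + 2^-1).
Proof.
move=> le_in; rewrite /sdev subSn // (mul_harmS (n - i)) (mul_harmS n.+1).
by rewrite -[(n - i).+1%:R]natr1 -[n.+2%:R]natr1; field.
Qed.

Lemma sdev_stepr n i :
  sdev n.+1 i.+1 = sdev n i + (harm i.+1 - harm n.+1 + 2^-1).
Proof.
rewrite /sdev subSS (mul_harmS i.+1) (mul_harmS n.+1).
by rewrite -[i.+2%:R]natr1 -[n.+2%:R]natr1; field.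
Qed.

(** As the weights add up to n + 1, this makes [sdev n i / (n + 1)] a martingale along the urn. In a
    power of [sdev] it turns the terms linear in the increments into a multiple of that same
    power. *)
Lemma sdev_step_mean n i : (i <= n)%N ->
  (n - i)%:R * (harm (n - i) - harm n.+1 + 2^-1) +
  i.+1%:R * (harm i.+1 - harm n.+1 + 2^-1) = sdev n i.
Proof. by move=> le_in; rewrite /sdev natrB // -[n.+1%:R]natr1; field. Qed.

Lemma sdev_sym n i : (i < n)%N -> sdev n (n - i.+1) = sdev n i.
Proof.
move=> lt_in; rewrite /sdev subnSK // subKn //; ring.
Qed.

(* Growing a uniform split of n into one of n + 1 by enlarging either part
   with probability proportional to its size. *)
Lemma polya_sum n (a : nat -> R) :
  \sum_(i < n) ((n - i)%:R * a i + i.+1%:R * a i.+1) =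
  n%:R * \sum_(i < n.+1) a i.
Proof.
elim: n => [|n IH]; first by rewrite big_ord0 mul0r.
rewrite big_ord_recr /= subSnn.
transitivity (\sum_(i < n) ((n - i)%:R * a i + i.+1%:R * a i.+1) +
   \sum_(i < n) a i + (1 * a n + n.+1%:R * a n.+1)).
  congr (_ + _); rewrite -big_split; apply: eq_bigr => i _ /=.
  by rewrite subSn; [rewrite -[(n - i).+1%:R]natr1; ring | exact: ltnW].
by rewrite IH !big_ord_recr /= -[n.+1%:R]natr1; ring.
Qed.

(** The total weight n + 1 and the cross term 2 make up n + 3; the squared increments of the two
    parts have equal sums by reflection. *)
Lemma sum_sdev2_rec n :
  n%:R * \sum_(i < n.+1) sdev n.+1 i ^+ 2 =
  (n%:R + 3) * \sum_(i < n) sdev n i ^+ 2 +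
  (n.+1%:R * (n.+1%:R - 5) / 4 + harm n.+1).
Proof.
rewrite -(polya_sum n (fun i => sdev n.+1 i ^+ 2)).
transitivity (\sum_(i < n) ((n%:R + 3) * sdev n i ^+ 2 +
   (n - i)%:R * (harm (n - i) - harm n.+1 + 2^-1) ^+ 2 +
   i.+1%:R * (harm i.+1 - harm n.+1 + 2^-1) ^+ 2)).
  apply: eq_bigr => i _; have le_in : (i <= n)%N by exact: ltnW.
  rewrite sdev_stepl // sdev_stepr.
  set x := _ - _ + _; set y := harm i.+1 - _ + _.
  have Hs := sdev_step_mean le_in; rewrite -/x -/y in Hs.
  transitivity (((n - i)%:R + i.+1%:R) * sdev n i ^+ 2 + 2 * sdev n i *
    ((n - i)%:R * x + i.+1%:R * y) + (n - i)%:R * x ^+ 2 + i.+1%:R * y ^+ 2).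
    by ring.
  by rewrite Hs natrB // -[i.+1%:R]natr1; ring.
rewrite !big_split /= -mulr_sumr -!addrA; congr (_ + _).
have E : \sum_(i < n) i.+1%:R * (harm i.+1 - harm n.+1 + 2^-1) ^+ 2 =
         n.+1%:R * (n.+1%:R - 5) / 8 + harm n.+1 / 2.
  by rewrite -sum_center_tail2 big_ord_recl /= mul0r add0r.
rewrite (reindex_inj rev_ord_inj) /=.
under eq_bigr => i _ do rewrite subKn //.
by rewrite E; field.
Qed.

Lemma sum_sdev2 n : \sum_(i < n) sdev n i ^+ 2 =
  let N := n.+1%:R in
  N / 3 - 7 / 12 * N ^+ 2 + 7 / 12 * N ^+ 3 - harm n.+1 / 3 +
  (N - N ^+ 3) / 3 * harm2 n.+1.
Proof.
(* The recurrence has a factor [n] on the left, so it says nothing about the step from 0 to 1; the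
   induction starts at 1. *)
case: n => [|n] /=.
  by rewrite big_ord0 harmS harm2S harm0 harm20; field.
elim: n => [|n IH].
  by rewrite big_ord1 /sdev /= !harmS !harm2S harm0 harm20 subn0; field.
have n0 : n.+1%:R != 0 :> R by rewrite pnatr_eq0.
apply: (mulfI n0); rewrite sum_sdev2_rec IH (harmS n.+2) (harm2S n.+2).
have n3 : n%:R + 3 != 0 :> R by rewrite -natrD addn3 pnatr_eq0.
by field.
Qed.

Lemma sum_tdev2 n : \sum_(i < n) tdev n i ^+ 2 =
  n.+1%:R * (n.+1%:R - 1) * (n.+1%:R - 2) / 12.
Proof.
transitivity (\sum_(i < n.+1) (i%:R ^+ 2 - n.+1%:R * i%:R) +
   n%:R * (n.+1%:R / 2) ^+ 2 : R).
  rewrite big_ord_recl /= mulr0 expr0n subrr add0r.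
  have -> : n%:R * (n.+1%:R / 2) ^+ 2 =
      \sum_(i < n) (n.+1%:R / 2) ^+ 2 :> R by rewrite sumr_const card_ord mulr_natl.
  by rewrite -big_split; apply: eq_bigr => i _ /=; rewrite /tdev /bump /= add1n; field.
by rewrite big_split /= sum_nat2 sumrN -mulr_sumr sum_nat1; field.
Qed.

End Harmonic.


(** * Recurrences for the central moments *)

Section Moments.
Set Implicit Arguments.
Unset Strict Implicit.
Unset Printing Implicit Defensive.
Variable R : realType.
Implicit Types (n k i j : nat) (f g : R -> R).
Local Notation harm := (@harm R).
Local Notation harm2 := (@harm2 R).
Local Notation mcost := (@mcost R).
Local Notation vcost := (@vcost R).
Local Notation sdev := (@sdev R).
Local Notation tdev := (@tdev R).
Local Notation toll := (@toll R).
Hint Resolve natrS_neq0 natrSS_neq0 : core.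

Lemma sum_rev n (f : nat -> R) : \sum_(i < n.+1) f (n - i)%N = \sum_(i < n.+1) f i.
Proof.
rewrite (reindex_inj rev_ord_inj) /=; apply: eq_bigr => i _.
by rewrite subSS subKn // -ltnS.
Qed.

Lemma sum_recl0 n (f : nat -> R) : f 0%N = 0 ->
  \sum_(i < n.+1) f i = \sum_(i < n) f i.+1.
Proof. by move=> f0; rewrite big_ord_recl /= f0 add0r. Qed.

Lemma mcost_rec n : n.+1%:R * mcost n.+1 =
  \sum_(i < n.+1) (mcost i + mcost (n - i) + i%:R).
Proof.
rewrite 2!big_split /= (sum_rev n mcost) sum_nat1.
elim: n => [|n IH].
  by rewrite big_ord1 /= /mcost harmS harm0; field.
rewrite big_ord_recr /=; set S := \sum_(i < _) _ in IH *.
(* The identity at n is solved for the sum over earlier means, which leaves a rational identity in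
   one harmonic number. *)
have -> : S = (n.+1%:R * mcost n.+1 - n.+1%:R * (n.+1%:R - 1) / 2) / 2.
  by rewrite IH; field.
by rewrite /mcost (harmS _ n.+1); field.
Qed.

Lemma sum_toll n : \sum_(i < n.+1) toll n.+1 i = 0.
Proof.
rewrite /toll /= big_split /= -mcost_rec sumr_const card_ord.
by rewrite -[(- _) *+ _]mulr_natl mulrN subrr.
Qed.

Lemma tollE n i : (i <= n)%N -> toll n.+1 i = sdev n.+1 i + tdev n.+1 i.
Proof.
move=> le_in; rewrite /toll /mcost /sdev /tdev /= subSn // (mul_harmS _ i).
rewrite (mul_harmS _ (n - i)) (mul_harmS _ n.+1).
have E : n%:R = i%:R + (n - i)%:R :> R by rewrite -natrD subnKC.
by rewrite -!natr1 E; field.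
Qed.

Lemma tdev_sym n i : (i < n)%N -> tdev n (n - i.+1) = - tdev n i.
Proof.
move=> lt_in; rewrite /tdev subnSK // natrB ?(ltnW lt_in) //.
by rewrite -!natr1; field.
Qed.

Lemma sum_odd n (f : nat -> R) :
  (forall i, (i < n)%N -> f (n - i.+1)%N = - f i) -> \sum_(i < n) f i = 0.
Proof.
move=> odd_f; have E : \sum_(i < n) f i = - \sum_(i < n) f i.
  rewrite {1}(reindex_inj rev_ord_inj) /= -sumrN; apply: eq_bigr => i _.
  exact: odd_f.
by apply/eqP; rewrite -[_ == 0](mulrn_eq0 _ 2) /= mulr2n {1}E addNr eqxx.
Qed.

Lemma sum_sdev_tdev2 n : \sum_(i < n) sdev n i * tdev n i ^+ 2 =
  let N := n.+1%:R in N * (N - 1) * (N - 2) * (N - 3) / 72.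
Proof.
pose N : R := n.+1%:R; rewrite /= -/N.
(* Both parts contribute the same sum of [a] by reflection; expanding the square in [a] leaves the
   three sums [sum_tail1], [sum_tail2] and [sum_tail3]. *)
pose a j : R := j%:R * (harm n.+1 - harm j) * (j%:R - N / 2) ^+ 2.
have Es (i : 'I_n) : sdev n i * tdev n i ^+ 2 =
    N / 2 * tdev n i ^+ 2 - a i.+1 - a (n - i)%N.
  rewrite /sdev /tdev /a -/N.
  have -> : (n - i)%:R = N - i.+1%:R by rewrite -natrB ?subSS // ltnS ltnW.
  by field.
under eq_bigr do rewrite Es.
rewrite !big_split /= -mulr_sumr sum_tdev2 !sumrN -/N.
have -> : \sum_(i < n) a (n - i)%N = \sum_(i < n) a i.+1.
  rewrite (reindex_inj rev_ord_inj) /=; apply: eq_bigr => i _.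
  by rewrite subKn.
rewrite -sum_recl0; last by rewrite /a !mul0r.
rewrite /a; transitivity (N / 2 * (N * (N - 1) * (N - 2) / 12) - 2 *
   \sum_(i < n.+1) (i%:R ^+ 3 * (harm n.+1 - harm i)
     - N * (i%:R ^+ 2 * (harm n.+1 - harm i)) +
     N ^+ 2 / 4 * (i%:R * (harm n.+1 - harm i)))).
  set A := \sum_(i < n.+1) _; set A' := \sum_(i < n.+1) _.
  have -> : A = A' by apply: eq_bigr => i _; field.
  by field.
rewrite !big_split /= sumrN -!mulr_sumr sum_tail1 sum_tail2 sum_tail3 /N.
by field.
Qed.

(** In terms of the part size x = i + 1 the variance contains x [harm x], the very term that occurs
    in [sdev]. *)
Lemma vcostE i : vcost i =
  i.+1%:R ^+ 2 * (2 - harm2 i.+1) - i.+1%:R * harm i.+1.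
Proof. by rewrite /vcost harm2S harmS; field. Qed.

Lemma sum_toll2 n : \sum_(i < n.+1) toll n.+1 i ^+ 2 =
  \sum_(i < n.+1) sdev n.+1 i ^+ 2 + \sum_(i < n.+1) tdev n.+1 i ^+ 2.
Proof.
transitivity (\sum_(i < n.+1) (sdev n.+1 i ^+ 2 + tdev n.+1 i ^+ 2 +
   2 * (sdev n.+1 i * tdev n.+1 i))).
  by apply: eq_bigr => i _; rewrite tollE; [ring | rewrite -ltnS].
rewrite !big_split /= -mulr_sumr.
rewrite (sum_odd (f := fun i => sdev n.+1 i * tdev n.+1 i)) ?mulr0 ?addr0 //.
by move=> i lt_in; rewrite sdev_sym // tdev_sym // mulrN.
Qed.

Lemma vcost_rec n : n.+1%:R * vcost n.+1 =
  \sum_(i < n.+1) (vcost i + vcost (n - i) + toll n.+1 i ^+ 2).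
Proof.
rewrite 2!big_split /= (sum_rev n vcost) sum_toll2 sum_sdev2 sum_tdev2.
elim: n => [|n IH].
  by rewrite big_ord1 /= /vcost !harmS !harm2S harm0 harm20; field.
rewrite big_ord_recr /=; set S := \sum_(i < _) _ in IH *.
move: IH; set B := (X in _ = S + S + X) => IH.
have -> : S = (n.+1%:R * vcost n.+1 - B) / 2 by rewrite IH; field.
rewrite /vcost /B (harmS _ n.+2) (harm2S _ n.+2) (harmS _ n.+1) (harm2S _ n.+1).
have n3 : n%:R + 3 != 0 :> R by rewrite -natrD addn3 pnatr_eq0.
by field; rewrite ![_ + n%:R]addrC n3 natrSS_neq0.
Qed.

Lemma law_id n : law n id = mcost n.
Proof.
elim/law_ind: n => [|n IH]; first by rewrite law0 /mcost harm0; ring.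
rewrite lawS; apply: (mulfI (natrS_neq0 R n)); rewrite natr1 mcost_rec.
rewrite mulVKf ?pnatr_eq0 //; apply: eq_bigr => i _ /=.
have le_in : (i <= n)%N by rewrite -ltnS.
under eq_fun => x.
  rewrite (_ : (fun y => _) = (fun y => (x + i%:R) + id y)); last first.
    by apply/funext => y; rewrite /=; ring.
  rewrite lawD law_cst IH ?leq_subr //.
  over.
under eq_fun do rewrite -addrA.
by rewrite (lawD i id) law_cst IH //; ring.
Qed.

Definition claw n g := law n (fun x => g (x - mcost n)).

Lemma clawD n f g : claw n (fun x => f x + g x) = claw n f + claw n g.
Proof. exact: lawD. Qed.
Lemma clawB n f g : claw n (fun x => f x - g x) = claw n f - claw n g.
Proof. exact: lawB. Qed.
Lemma clawZ n a f : claw n (fun x => a * f x) = a * claw n f.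
Proof. exact: lawZ. Qed.
Lemma claw_cst n a : claw n (fun=> a) = a.
Proof. exact: law_cst. Qed.
Lemma ler_claw n f g : (forall x, f x <= g x) -> claw n f <= claw n g.
Proof. by move=> fg; apply: ler_law => x. Qed.
Lemma claw_ge0 n f : (forall x, 0 <= f x) -> 0 <= claw n f.
Proof. by move=> f0; apply: law_ge0 => x. Qed.
Lemma ler_norm_claw n f : `|claw n f| <= claw n (fun x => `|f x|).
Proof. exact: ler_norm_law. Qed.
Lemma claw_swap n m (F : R -> R -> R) :
  claw n (fun x => claw m (F x)) = claw m (fun y => claw n (fun x => F x y)).
Proof. exact: law_swap. Qed.

Lemma clawS n g : claw n.+1 g = n.+1%:R^-1 * \sum_(i < n.+1)
  claw i (fun x => claw (n - i) (fun y => g (x + y + toll n.+1 i))).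
Proof.
rewrite /claw lawS; congr (_ * _); apply: eq_bigr => i _.
congr (law _ _); apply/funext => x; congr (law _ _); apply/funext => y.
by congr g; rewrite /toll /=; ring.
Qed.

Lemma claw0 g : claw 0 g = g 0.
Proof. by rewrite /claw law0 /mcost harm0 !mulr0 subr0 subr0. Qed.

Lemma claw_id n : claw n id = 0.
Proof. by rewrite /claw lawB law_id law_cst subrr. Qed.

Definition kcost n := claw n (fun x => x ^+ 3).
Definition qcost n := claw n (fun x => x ^+ 4).

(** A quartic template: the linear term dies by centring, so the moments of a sum of two parts
    follow by expanding and applying it once per part. *)
Lemma claw_poly n a0 a1 a2 a3 a4 :
  claw n (fun x => a0 + a1 * x + a2 * x ^+ 2 + a3 * x ^+ 3 + a4 * x ^+ 4) =
  a0 + a2 * claw n (fun x => x ^+ 2) + a3 * kcost n + a4 * qcost n.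
Proof.
by rewrite !clawD !clawZ claw_cst (claw_id n) mulr0 addr0.
Qed.

Lemma claw_sqr n : claw n (fun x => x ^+ 2) = vcost n.
Proof.
elim/law_ind: n => [|n IH].
  by rewrite claw0 /vcost harm0 harm20; ring.
rewrite clawS; apply: (mulfI (natrS_neq0 R n)); rewrite natr1 vcost_rec.
rewrite mulVKf ?pnatr_eq0 //; apply: eq_bigr => i _ /=.
have le_in : (i <= n)%N by rewrite -ltnS.
set c := toll _ _.
under eq_fun => x.
  rewrite (_ : (fun y => _) = (fun y => (x + c) ^+ 2 + (2 * (x + c)) * y +
     1 * y ^+ 2 + 0 * y ^+ 3 + 0 * y ^+ 4)); last by apply/funext => y; ring.
  rewrite claw_poly IH ?leq_subr // !mul0r !addr0 mul1r.
  rewrite (_ : _ + _ = (c ^+ 2 + vcost (n - i)) + (2 * c) * x +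
     1 * x ^+ 2 + 0 * x ^+ 3 + 0 * x ^+ 4); last by ring.
  over.
by rewrite claw_poly IH //; ring.
Qed.

Lemma kcost_rec n : n.+1%:R * kcost n.+1 =
  \sum_(i < n.+1) (kcost i + kcost (n - i) +
    3 * toll n.+1 i * (vcost i + vcost (n - i)) + toll n.+1 i ^+ 3).
Proof.
rewrite {1}/kcost clawS mulVKf ?pnatr_eq0 //; apply: eq_bigr => i _ /=.
set c := toll _ _.
under eq_fun => x.
  rewrite (_ : (fun y => _) = (fun y => (x + c) ^+ 3 + (3 * (x + c) ^+ 2) * y +
    (3 * (x + c)) * y ^+ 2 + 1 * y ^+ 3 + 0 * y ^+ 4)); last first.
    by apply/funext => y; ring.
  rewrite claw_poly claw_sqr mul0r addr0 mul1r.
  rewrite (_ : _ + _ = (c ^+ 3 + 3 * c * vcost (n - i) + kcost (n - i)) +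
     (3 * c ^+ 2 + 3 * vcost (n - i)) * x +
     (3 * c) * x ^+ 2 + 1 * x ^+ 3 + 0 * x ^+ 4); last by ring.
  over.
by rewrite claw_poly claw_sqr; ring.
Qed.

Lemma qcost_rec n : n.+1%:R * qcost n.+1 =
  \sum_(i < n.+1) (qcost i + qcost (n - i) +
    4 * toll n.+1 i * (kcost i + kcost (n - i)) +
    6 * vcost i * vcost (n - i) +
    6 * toll n.+1 i ^+ 2 * (vcost i + vcost (n - i)) + toll n.+1 i ^+ 4).
Proof.
rewrite {1}/qcost clawS mulVKf ?pnatr_eq0 //; apply: eq_bigr => i _ /=.
set c := toll _ _.
under eq_fun => x.
  rewrite (_ : (fun y => _) = (fun y => (x + c) ^+ 4 + (4 * (x + c) ^+ 3) * y +
    (6 * (x + c) ^+ 2) * y ^+ 2 + (4 * (x + c)) * y ^+ 3 + 1 * y ^+ 4));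
    last by apply/funext => y; ring.
  rewrite claw_poly claw_sqr mul1r.
  rewrite (_ : _ + _ = (c ^+ 4 + 6 * c ^+ 2 * vcost (n - i) +
       4 * c * kcost (n - i) + qcost (n - i)) +
     (4 * c ^+ 3 + 12 * c * vcost (n - i) + 4 * kcost (n - i)) * x +
     (6 * c ^+ 2 + 6 * vcost (n - i)) * x ^+ 2 + (4 * c) * x ^+ 3 +
     1 * x ^+ 4); last by ring.
  over.
by rewrite claw_poly claw_sqr; ring.
Qed.

End Moments.


(** * Logarithmic bounds *)

Section Bounds.
Set Implicit Arguments.
Unset Strict Implicit.
Unset Printing Implicit Defensive.
Variable R : realType.
Implicit Types (n k i j m : nat) (x y : R).
Local Notation harm := (@harm R).
Local Notation harm2 := (@harm2 R).
Local Notation sdev := (@sdev R).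
Local Notation tdev := (@tdev R).
Local Notation toll := (@toll R).

Lemma ln_leB1 x : 0 < x -> ln x <= x - 1.
Proof.
by move=> x0; rewrite -[x in ln x](addrNK 1) addrC le_ln1Dx //; lra.
Qed.

Lemma ln_natS_le n : ln n.+2%:R - ln n.+1%:R <= n.+1%:R^-1 :> R.
Proof.
have n0 : 0 < n.+1%:R :> R by rewrite ltr0n.
rewrite -ln_div ?posrE ?ltr0n //; apply: (le_trans (ln_leB1 _)).
  by rewrite divr_gt0 ?ltr0n.
by rewrite -[n.+2%:R]natr1 mulrDl divff ?gt_eqF // mul1r addrAC subrr add0r.
Qed.

Lemma ln_natS_ge n : n.+2%:R^-1 <= ln n.+2%:R - ln n.+1%:R :> R.
Proof.
have n0 : 0 < n.+2%:R :> R by rewrite ltr0n.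
rewrite -lerN2 opprB -ln_div ?posrE ?ltr0n //; apply: (le_trans (ln_leB1 _)).
  by rewrite divr_gt0 ?ltr0n.
have -> : n.+1%:R = n.+2%:R - 1 :> R by rewrite -[n.+2%:R]natr1 addrK.
by rewrite mulrBl divff ?gt_eqF // mul1r addrAC subrr add0r.
Qed.

Lemma harm_tail_ge j m : (j <= m)%N ->
  ln m.+1%:R - ln j.+1%:R <= harm m - harm j.
Proof.
move=> /subnKC <-; elim: (m - j)%N => [|k IH]; first by rewrite addn0 !subrr.
by rewrite addnS harmS; have := ln_natS_le (j + k); move: (_^-1) => z; lra.
Qed.

Lemma harm_tail_le j m : (0 < j <= m)%N -> harm m - harm j <= ln m%:R - ln j%:R.
Proof.
case: j => // j /= /subnKC <-.
elim: (m - j.+1)%N => [|k IH]; first by rewrite addn0 !subrr.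
by rewrite addnS harmS; have := ln_natS_ge (j + k); rewrite addSn in IH *; move: (_^-1) => z; lra.
Qed.

Lemma harm_le j m : (j <= m)%N -> harm j <= harm m.
Proof.
move=> /subnKC <-; elim: (m - j)%N => [|k IH]; first by rewrite addn0.
by rewrite addnS harmS (le_trans IH) // lerDl invr_ge0.
Qed.

Lemma harm1 : harm 1 = 1. Proof. by rewrite harmS harm0 add0r invr1. Qed.
Lemma harm21 : harm2 1 = 1.
Proof. by rewrite harm2S harm20 add0r invr1 expr1n. Qed.

Lemma harm_ge0 n : 0 <= harm n.
Proof. by rewrite -(harm0 R) harm_le. Qed.

Lemma harm_ge1 n : (0 < n)%N -> 1 <= harm n.
Proof. by move=> n0; rewrite -harm1 harm_le. Qed.

Lemma harm_le_n n : harm n <= n%:R.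
Proof.
elim: n => [|n IH]; first by rewrite harm0.
by rewrite harmS -[leRHS]natr1 lerD // invf_le1 ?ltr0n // ler1n.
Qed.

Lemma ln_le_harm n : ln n.+1%:R <= harm n.
Proof. by have := harm_tail_ge (leq0n n); rewrite ln1 (harm0 R) !subr0. Qed.

Lemma harm_le_ln n : (0 < n)%N -> harm n <= 1 + ln n%:R.
Proof.
move=> n0; have := @harm_tail_le 1 n; rewrite n0 => /(_ isT).
by rewrite harm1 ln1; lra.
Qed.

Lemma harm2_ge1 n : (0 < n)%N -> 1 <= harm2 n.
Proof.
case: n => // n _; elim: n => [|n IH]; first by rewrite harm21.
by rewrite harm2S (le_trans IH) // lerDl sqr_ge0.
Qed.

(** A step in m adds at most 1 on the left and [harm n >= 1] on the right. It converts errors at the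
    larger index into errors at the smaller one. *)
Lemma harm_sublinear n m : (0 < n <= m)%N -> n%:R * harm m <= m%:R * harm n.
Proof.
move=> /andP[n0 /subnKC <-]; elim: (m - n)%N => [|k IH]; first by rewrite addn0.
rewrite addnS harmS -[X in _ <= X * _]natr1 mulrDr mulrDl mul1r; apply: lerD => //.
rewrite (le_trans _ (harm_ge1 n0)) // ler_pdivrMr ?ltr0n // mul1r ler_nat.
by rewrite ltnW // ltnS leq_addr.
Qed.

(* With [y = m / j], so that [j * p (ln y) <= C * m] follows from
   [p (ln y) <= C * y]. *)
Lemma mul_harm_tail2 j m : (j <= m)%N -> j%:R * (harm m - harm j) ^+ 2 <= 2 * m%:R.
Proof.
case: j => [|j] jm; first by rewrite mul0r mulr_ge0.
have j0 : 0 < j.+1%:R :> R by rewrite ltr0n.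
have m0 : 0 < m%:R :> R by rewrite ltr0n (leq_trans _ jm).
have := @harm_tail_le j.+1 m; rewrite jm => /(_ isT).
have := harm_le jm; rewrite -subr_ge0 -ln_div ?posrE // => h0 h1.
have l0 : 0 <= ln (m%:R / j.+1%:R) :> R by exact: le_trans h1.
have := expR_ge1Dxn 1 l0; rewrite lnK ?posrE ?divr_gt0 //= => h2.
have h3 : (harm m - harm j.+1) ^+ 2 <= 2 * (m%:R / j.+1%:R).
  apply: (@le_trans _ _ (ln (m%:R / j.+1%:R) ^+ 2)).
    by rewrite ler_pXn2r // nnegrE.
  by move: h2; rewrite (_ : 2`! = 2)%N //; move: (_ / _) => y h2; lra.
apply: (le_trans (ler_wpM2l (ltW j0) h3)).
by rewrite mulrCA [_%:R * (_ / _)]mulrC divfK ?gt_eqF.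
Qed.

Lemma mul_harm_tail3 j m : (j <= m)%N -> j%:R * (harm m - harm j) ^+ 3 <= 6 * m%:R.
Proof.
case: j => [|j] jm; first by rewrite mul0r mulr_ge0.
have j0 : 0 < j.+1%:R :> R by rewrite ltr0n.
have m0 : 0 < m%:R :> R by rewrite ltr0n (leq_trans _ jm).
have := @harm_tail_le j.+1 m; rewrite jm => /(_ isT).
have := harm_le jm; rewrite -subr_ge0 -ln_div ?posrE // => h0 h1.
have l0 : 0 <= ln (m%:R / j.+1%:R) :> R by exact: le_trans h1.
have := expR_ge1Dxn 2 l0; rewrite lnK ?posrE ?divr_gt0 //= => h2.
have h3 : (harm m - harm j.+1) ^+ 3 <= 6 * (m%:R / j.+1%:R).
  apply: (@le_trans _ _ (ln (m%:R / j.+1%:R) ^+ 3)).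
    by rewrite ler_pXn2r // nnegrE.
  by move: h2; rewrite (_ : 3`! = 6)%N //; move: (_ / _) => y h2; lra.
apply: (le_trans (ler_wpM2l (ltW j0) h3)).
by rewrite mulrCA [_%:R * (_ / _)]mulrC divfK ?gt_eqF.
Qed.

(** From (6 / 5)^4 > 2 and e^(1/5) >= 6 / 5. *)
Lemma ln2_le : ln 2 <= 4 / 5 :> R.
Proof.
rewrite -ler_expR lnK ?posrE //.
rewrite (expRM_natl 4 5^-1); apply: (@le_trans _ _ ((6 / 5) ^+ 4)); first by lra.
rewrite ler_pXn2r ?nnegrE ?expR_ge0 //.
by apply: le_trans (expR_ge1Dx _); lra.
Qed.

(* Tangent of the logarithm at 2. *)
Lemma mul_harm_tail1 j m : (j <= m)%N ->
  j%:R * (harm m - harm j) <= m%:R / 2 - j%:R / 5.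
Proof.
case: j => [|j] jm; first by rewrite !mul0r subr0 divr_ge0.
have j0 : 0 < j.+1%:R :> R by rewrite ltr0n.
have m0 : 0 < m%:R :> R by rewrite ltr0n (leq_trans _ jm).
have := @harm_tail_le j.+1 m; rewrite jm => /(_ isT) h.
have : ln (m%:R / j.+1%:R / 2) <= m%:R / j.+1%:R / 2 - 1 :> R.
  by apply: ln_leB1; rewrite !divr_gt0.
rewrite ln_div ?posrE ?divr_gt0 // ln_div ?posrE // => h2.
have h3 : harm m - harm j.+1 <= m%:R / j.+1%:R / 2 - 5^-1.
  by move: h2; have := ln2_le; move: (m%:R / _) => y; lra.
apply: (le_trans (ler_wpM2l (ltW j0) h3)).
by rewrite le_eqVlt; apply/orP; left; apply/eqP; field; nat_neq0.
Qed.

Lemma sdevE n i : (i <= n)%N -> sdev n i = n.+1%:R / 2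
  - i.+1%:R * (harm n.+1 - harm i.+1)
  - (n - i)%:R * (harm n.+1 - harm (n - i)).
Proof. by move=> le_in; rewrite /sdev natrB // -!natr1; field. Qed.

Lemma sdev_le n i : (i <= n)%N -> sdev n i <= n.+1%:R / 2.
Proof.
move=> le_in; rewrite sdevE // -addrA gerDl -opprD oppr_le0.
by apply: addr_ge0; rewrite mulr_ge0 // subr_ge0 harm_le // ltnW // ltnS leq_subr.
Qed.

(** Each tail costs N / 2 less a fifth of its part, with N = n + 1, and the parts add up to N: N / 2
    - 2 N / 2 + N / 5 = -3 N / 10. The cube of this is the 27 / 1000 used later. *)
Lemma sdev_ge n i : (i <= n)%N -> - (3 / 10) * n.+1%:R <= sdev n i.
Proof.
move=> le_in; rewrite sdevE //.
have h1 := @mul_harm_tail1 i.+1 n.+1 le_in.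
have := @mul_harm_tail1 (n - i) n.+1.
rewrite leqW ?leq_subr // => /(_ isT); rewrite natrB // => h2.
by lra.
Qed.

Lemma norm_sdev_le n i : (i <= n)%N -> `|sdev n i| <= n.+1%:R / 2.
Proof.
move=> le_in; rewrite ler_norml sdev_le // andbT.
by apply: le_trans (sdev_ge le_in); have := ler0n R n.+1; lra.
Qed.

Lemma norm_tdev_le n i : (i <= n)%N -> `|tdev n i| <= n.+1%:R / 2.
Proof.
move=> le_in; have : i%:R <= n%:R :> R by rewrite ler_nat.
have := ler0n R i; rewrite ler_norml /tdev => h1 h2.
by apply/andP; split; lra.
Qed.

Lemma norm_toll_le n i : (i <= n)%N -> `|toll n.+1 i| <= n.+2%:R.
Proof.
move=> le_in; rewrite tollE //; apply: (le_trans (ler_normD _ _)).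
have := norm_sdev_le (leqW le_in); have := norm_tdev_le (leqW le_in); lra.
Qed.

(** The increment of an urn step is unbounded, but its weight j is small where the logarithm is
    large, so the weighted moments stay linear in m. *)
Lemma step2_le j m : (j <= m)%N ->
  j%:R * (harm j - harm m + 2^-1) ^+ 2 <= 5 * m%:R.
Proof.
move=> jm; have h := mul_harm_tail2 jm; have j0 := ler0n R j.
have h1 : j%:R <= m%:R :> R by rewrite ler_nat.
set x := harm m - harm j in h.
have -> : harm j - harm m + 2^-1 = 2^-1 - x by rewrite /x; ring.
apply: (@le_trans _ _ (2 * (j%:R * x ^+ 2) + j%:R / 2)); last by lra.
by have := mulr_ge0 j0 (sqr_ge0 (x + 2^-1)); lra.
Qed.

Lemma step3_le j m : (j <= m)%N ->
  `|j%:R * (harm j - harm m + 2^-1) ^+ 3| <= 7 * m%:R.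
Proof.
move=> jm; have h := mul_harm_tail3 jm; have j0 := ler0n R j.
have h1 : j%:R <= m%:R :> R by rewrite ler_nat.
have x0 : 0 <= harm m - harm j by rewrite subr_ge0 harm_le.
set x := harm m - harm j in h x0.
have -> : harm j - harm m + 2^-1 = 2^-1 - x by rewrite /x; ring.
have h2 : `|(2^-1 - x) ^+ 3| <= x ^+ 3 + 1 / 8.
  rewrite ler_norml; apply/andP; split.
    by have := sqr_ge0 (x - 1 / 4); lra.
  by have := mulr_ge0 x0 (sqr_ge0 (x - 3 / 8)); lra.
rewrite normrM ger0_norm //.
by apply: (le_trans (ler_wpM2l j0 h2)); lra.
Qed.

(** [u n - C / (n + 1)] increases and [u n + C / (n + 1)] decreases, so these nested intervals yield
    a limit together with its rate. *)
Lemma tele_cvg (u : nat -> R) C :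
  (forall n, `|u n.+1 - u n| <= C * (n.+1%:R^-1 - n.+2%:R^-1)) ->
  exists l, forall n, `|u n - l| <= C / n.+1%:R.
Proof.
move=> hu.
pose a n := u n - C / n.+1%:R; pose b n := u n + C / n.+1%:R.
have C0 : 0 <= C.
  have := le_trans (normr_ge0 _) (hu 0%N).
  by rewrite pmulr_lge0 // subr_gt0 ltf_pV2 ?posrE // ltr_nat.
have ha n k : a n <= a (n + k)%N.
  elim: k => [|k IH]; first by rewrite addn0.
  rewrite (le_trans IH) // addnS /a; have := hu (n + k)%N.
  by rewrite ler_norml; move: ((n + k).+1%:R^-1) ((n + k).+2%:R^-1) => p q /andP[]; lra.
have hb n k : b (n + k)%N <= b n.
  elim: k => [|k IH]; first by rewrite addn0.
  rewrite (le_trans _ IH) // addnS /b; have := hu (n + k)%N.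
  by rewrite ler_norml; move: ((n + k).+1%:R^-1) ((n + k).+2%:R^-1) => p q /andP[]; lra.
have hab n : a n <= b n.
  have : 0 <= C / n.+1%:R by rewrite divr_ge0.
  by rewrite /a /b; move: (C / _) => z; lra.
have hA n m : a n <= b m.
  apply: (le_trans (ha n m)); apply: (le_trans (hab _)).
  by rewrite addnC hb.
have sA : has_sup (range a).
  by split; [exists (a 0%N), 0%N | exists (b 0%N) => _ [n _ <-]].
exists (sup (range a)) => n; rewrite ler_distlC.
have h1 : a n <= sup (range a) by apply: ub_le_sup; [case: sA | exists n].
have h2 : sup (range a) <= b n.
  by apply: ge_sup; [case: sA | move=> _ [m _ <-]].
by move: h1 h2; rewrite /a /b => -> ->.
Qed.

(** * Third moment of the symmetric part of the toll *)

Definition sum_sdev3 n : R := \sum_(i < n) sdev n i ^+ 3.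

(** Cubing adds 3 to the total weight n + 1, whence n + 4. Squares and cubes of the increments are
    only bounded, by 15 N^2 + 14 N per term with N = n + 1. *)
Lemma sum_sdev3_rec n :
  `|n%:R * sum_sdev3 n.+1 - (n%:R + 4) * sum_sdev3 n| <=
  30 * n%:R * n.+1%:R ^+ 2.
Proof.
rewrite /sum_sdev3 -(polya_sum n (fun i => sdev n.+1 i ^+ 3)) mulr_sumr -sumrB.
apply: (le_trans (ler_norm_sum _ _ _)).
have -> : 30 * n%:R * n.+1%:R ^+ 2 = \sum_(i < n) 30 * n.+1%:R ^+ 2 :> R.
  by rewrite sumr_const card_ord -[_ *+ _]mulr_natl; ring.
apply: ler_sum => i _; have le_in : (i <= n)%N by exact: ltnW.
have h1 : (n - i <= n.+1)%N by rewrite leqW // leq_subr.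
have h2 : (i.+1 <= n.+1)%N by rewrite ltnS.
rewrite sdev_stepl // sdev_stepr.
have Hs := sdev_step_mean R le_in.
have := step2_le h1; have := step3_le h1.
have := step2_le h2; have := step3_le h2; move: Hs.
set x := _ - _ + _; set y := harm i.+1 - _ + _ => Hs y3 y2 x3 x2.
have s0 := norm_sdev_le le_in; set s := sdev n i in Hs s0 *.
have N1 : 1 <= n.+1%:R :> R by rewrite ler1n.
set N := n.+1%:R in N1 y3 y2 x3 x2 s0 *.
have -> : (n - i)%:R * (s + x) ^+ 3 + i.+1%:R * (s + y) ^+ 3 - (n%:R + 4) * s ^+ 3
  = 3 * s * ((n - i)%:R * x ^+ 2 + i.+1%:R * y ^+ 2) +
    ((n - i)%:R * x ^+ 3 + i.+1%:R * y ^+ 3).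
  transitivity (3 * s ^+ 2 * ((n - i)%:R * x + i.+1%:R * y) - 3 * s ^+ 3 +
    3 * s * ((n - i)%:R * x ^+ 2 + i.+1%:R * y ^+ 2) +
    ((n - i)%:R * x ^+ 3 + i.+1%:R * y ^+ 3)).
    by rewrite natrB // -[i.+1%:R]natr1; ring.
  by rewrite Hs; ring.
apply: (le_trans (ler_normD _ _)).
have q0 : 0 <= (n - i)%:R * x ^+ 2 + i.+1%:R * y ^+ 2.
  by rewrite addr_ge0 // mulr_ge0 // sqr_ge0.
have b1 : `|3 * s * ((n - i)%:R * x ^+ 2 + i.+1%:R * y ^+ 2)| <=
    (3 * (N / 2)) * (10 * N).
  rewrite normrM (ger0_norm q0) ler_pM //; last by lra.
  by rewrite normrM ger0_norm //; lra.
have b2 := le_trans (ler_normD _ _) (lerD x3 y3).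
apply: (le_trans (lerD b1 b2)); nra.
Qed.

Lemma sum_sdev3_asymp : exists a C : R, [/\ - (27 / 1000) <= a, 0 <= C &
  forall n, `|sum_sdev3 n - a * n.+1%:R ^+ 4| <= C * n.+1%:R ^+ 3].
Proof.
(* Up to a shift by one, [p] solves the homogeneous recurrence n S(n + 1) = (n + 4) S(n), so the
   quotient [u] has summable increments. *)
pose p n : R := (n%:R + 1) * (n%:R + 2) * (n%:R + 3) * (n%:R + 4).
have p0 n : 0 < p n by rewrite /p !mulr_gt0 // ltr_wpDl.
pose u n := sum_sdev3 n.+1 / p n.
have [n|a ha] := @tele_cvg u 30.
  have h := sum_sdev3_rec n.+1.
  have -> : u n.+1 - u n = (n.+1%:R * sum_sdev3 n.+2 - (n.+1%:R + 4) *
     sum_sdev3 n.+1) / ((n%:R + 1) * (n%:R + 2) * (n%:R + 3) * (n%:R + 4) * (n%:R + 5)).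
    rewrite /u /p -natr1; field.
    nat_neq0.
  rewrite normrM normfV [X in _ / X]ger0_norm; last by rewrite !mulr_ge0 ?addr_ge0.
  rewrite ler_pdivrMr; last by rewrite !mulr_gt0 // ltr_wpDl.
  apply: (le_trans h).
  have -> : 30 * (n.+1%:R^-1 - n.+2%:R^-1) * ((n%:R + 1) * (n%:R + 2) * (n%:R + 3) * (n%:R + 4) * (n%:R + 5)) = 30 * ((n%:R + 3) * (n%:R + 4) * (n%:R + 5)) :> R.
    by field; nat_neq0.
  by have := ler0n R n; rewrite -[n.+2%:R]natr1 -[n.+1%:R]natr1; move: n%:R => x; nra.
(* The sum for n = 1 vanishes, so the rate at index 0 bounds the limit itself. *)
have ab : `|a| <= 30.
  have := ha 0%N; rewrite /u.
  have -> : sum_sdev3 1 = 0.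
    rewrite /sum_sdev3 big_ord1 /sdev /= subn0 (harmS _ 1) harm1.
    by field.
  by rewrite mul0r sub0r normrN divr1.
exists a, 120; split.
(* By [sdev_ge] every term is at least -27 / 1000 times the cube of the size; this lower bound on
   [u] passes to the limit. *)
- apply/ler_addgt0Pl => e e0.
  pose n := (Num.truncn (30 / e)).
  have hn : 30 / e < n.+1%:R by rewrite /n truncnS_gt.
  have h1 : 30 / n.+1%:R <= e.
    by rewrite ler_pdivrMr ?ltr0n // mulrC -ler_pdivrMr // ltW.
  have := ha n; rewrite ler_distlC => /andP[h2 _].
  have h3 : - (27 / 1000) <= u n.
    rewrite /u ler_pdivlMr // /sum_sdev3.
    have N0 := ler0n R n; set N := n.+2%:R : R.
    apply: (@le_trans _ _ (\sum_(i < n.+1) (- (27 / 1000) * N ^+ 3))).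
      rewrite sumr_const card_ord -[_ *+ _]mulr_natl /N /p -natr1 -natr1.
      move: N0; set x := n%:R => x0; rewrite -subr_ge0.
      nra.
    apply: ler_sum => i _.
    have le_in : (i <= n.+1)%N by rewrite ltnW.
    have := sdev_ge le_in; rewrite -/N; set s := sdev _ _ => hs.
    have N1 : 0 <= N by [].
    have -> : - (27 / 1000) * N ^+ 3 = (- (3 / 10) * N) ^+ 3 by field.
    move: hs; set z := _ * N => hs; rewrite -subr_ge0.
    have z1 : 0 <= s - z by rewrite subr_ge0.
    have z2 : 0 <= s ^+ 2 + s * z + z ^+ 2.
      by have := sqr_ge0 (s + z / 2); have := sqr_ge0 z; lra.
    by have := mulr_ge0 z1 z2; lra.
  by move: h1 h2 h3; move: (30 / _) => q; lra.
- exact: ler0n.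
- case=> [|n].
    rewrite /sum_sdev3 big_ord0 !expr1n !mulr1 sub0r normrN.
    by apply: (le_trans ab); lra.
  have := ha n; rewrite /u => h.
  have -> : sum_sdev3 n.+1 - a * n.+2%:R ^+ 4 =
     (sum_sdev3 n.+1 / p n - a) * p n + a * (p n - n.+2%:R ^+ 4).
    by rewrite mulrBl divfK ?gt_eqF //; ring.
  apply: (le_trans (ler_normD _ _)); rewrite (normrM _ (p n)) (normrM a) [`|p n|](ger0_norm (ltW (p0 n))).
  have N0 := ler0n R n.
  apply: (@le_trans _ _ (30 / n.+1%:R * p n + 30 * `|p n - n.+2%:R ^+ 4|)).
    apply: lerD; first by rewrite ler_wpM2r // ltW.
    by rewrite ler_wpM2r.
  have -> : 30 / n.+1%:R * p n = 30 * ((n%:R + 2) * (n%:R + 3) * (n%:R + 4)).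
    by rewrite /p; field; nat_neq0.
  rewrite /p -[n.+2%:R]natr1 -[n.+1%:R]natr1; move: n%:R N0 => x x0.
  have x2 := exprn_ge0 2 x0; have x3 := exprn_ge0 3 x0; have x4 := exprn_ge0 4 x0.
  by rewrite ger0_norm; lra.
Qed.

End Bounds.


(** * The Basel series *)

Section Basel.
Set Implicit Arguments.
Unset Strict Implicit.
Unset Printing Implicit Defensive.
Variable R : realType.
Implicit Types (n k : nat) (x a b : R) (f df : R -> R).
Local Notation harm2 := (@harm2 R).

Lemma mvt_le f df a b : a <= b -> (forall x, is_derive x 1 f (df x)) ->
  exists c, a <= c <= b /\ f b - f a = df c * (b - a).
Proof.
move=> ab fdf; have [|c] := MVT_segment ab (fun x _ => fdf x).
  by apply: derivable_within_continuous => x _; apply: ex_derive.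
by rewrite in_itv /= => acb fE; exists c.
Qed.

Lemma sin_le_id x : 0 <= x -> sin x <= x.
Proof.
move=> x0; have [c [_]] := mvt_le x0 (@is_derive_sin R).
rewrite sin0 !subr0 => ->; rewrite ler_piMl // cos_le1.
Qed.

Lemma mul_cos_le_sin x : 0 <= x <= pi / 2 -> x * cos x <= sin x.
Proof.
move=> /andP[x0 xpi]; pose f := @sin R - id * @cos R.
have [y|c [/andP[c0 cx] ]] := @mvt_le f (fun y => y * sin y) 0 x x0.
  rewrite /f; apply: is_derive_eq.
  by rewrite /GRing.scale /= mulr1; ring.
have -> : f 0 = 0 by rewrite /f /= !fctE sin0 mul0r subr0.
have -> : f x = sin x - x * cos x by [].
rewrite !subr0 => fE; rewrite -subr_ge0 fE !mulr_ge0 //.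
apply: sin_ge0_pi; rewrite c0 (le_trans cx) // (le_trans xpi) //.
by have := pi_ge0 R; lra.
Qed.

(** From x cos x <= sin x <= x, as 1 / sin^2 - 1 = cot^2. Summed over 2^n angles the error 1 is
    negligible against 4^n. *)
Lemma inv_sqr_bounds x : 0 < x < pi / 2 ->
  (sin x)^-1 ^+ 2 - 1 <= x^-1 ^+ 2 <= (sin x)^-1 ^+ 2.
Proof.
move=> /andP[x0 xpi].
have s0 : 0 < sin x by rewrite sin_gt0_pihalf // x0.
have c0 : 0 < cos x.
  by rewrite cos_gt0_pihalf // xpi andbT (lt_trans _ x0) // oppr_lt0 divr_gt0 // pi_gt0.
have h1 : sin x <= x by rewrite sin_le_id // ltW.
have h2 : x * cos x <= sin x by rewrite mul_cos_le_sin // !ltW.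
apply/andP; split; last by rewrite ler_pXn2r ?nnegrE ?invr_ge0 ?(ltW x0) ?(ltW s0) // lef_pV2 ?posrE.
have -> : (sin x)^-1 ^+ 2 - 1 = (cos x / sin x) ^+ 2.
  by rewrite exprMn cos2sin2 mulrBl mul1r -exprMn divff ?gt_eqF // expr1n.
rewrite ler_pXn2r ?nnegrE ?invr_ge0 ?divr_ge0 ?(ltW c0) ?(ltW s0) ?(ltW x0) //.
by rewrite ler_pdivrMr // mulrC ler_pdivlMr // mulrC.
Qed.

(** For k < 2^n these are the odd multiples of pi / 2^(n + 2) below pi / 2; their inverse squares
    are proportional to the inverse odd squares. *)
Let angle n k : R := k.*2.+1%:R * pi / 2 ^+ n.+2.

Lemma angle_itv n k : (k < 2 ^ n)%N -> 0 < angle n k < pi / 2.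
Proof.
move=> kn; have p0 : 0 < 2 ^+ n.+2 :> R by rewrite exprn_gt0.
rewrite /angle !mulr_gt0 ?pi_gt0 ?invr_gt0 ?ltr0n //=.
rewrite ltr_pdivrMr // (_ : pi / 2 * 2 ^+ n.+2 = 2 ^+ n.+1 * pi); last first.
  by rewrite [2 ^+ n.+2]exprS; field.
by rewrite ltr_pM2r ?pi_gt0 // -natrX ltr_nat expnS; lia.
Qed.

(* Halving: 1 / sin^2 x = (1 / sin^2 (x / 2) + 1 / sin^2 ((pi - x) / 2)) / 4. *)
Lemma sum_inv_sin2 n :
  \sum_(0 <= k < 2 ^ n) (sin (angle n k))^-1 ^+ 2 = 2 * 4 ^+ n.
Proof.
elim: n => [|n IH].
  rewrite expn0 big_nat1 /angle mul1r expr0 mulr1.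
  have h : sin (pi / 2 ^+ 2) ^+ 2 = 2^-1 :> R.
    have := cos_mulr2n (pi / 4 : R).
    rewrite -[_ *+ 2]mulr_natl (_ : 2 * (pi / 4) = pi / 2); last by field.
    rewrite cos_pihalf cos2sin2 -natrX => h; lra.
  by rewrite exprVn h invrK.
rewrite exprS mulrCA -IH.
rewrite expnS mul2n -addnn (big_cat_nat (n := 2 ^ n)) ?leq_addr //=.
have -> : \sum_(2 ^ n <= k < 2 ^ n + 2 ^ n) (sin (angle n.+1 k))^-1 ^+ 2 =
   \sum_(0 <= k < 2 ^ n) (cos (angle n.+1 k))^-1 ^+ 2.
  rewrite -{1}[(2 ^ n)%N]add0n big_addn addnK big_nat_rev /= add0n.
  apply: eq_big_nat => k /andP[_ kn].
  rewrite (_ : angle n.+1 (_ - _ + _) = - (angle n.+1 k - pi / 2)).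
    by rewrite sinN sinBpihalf opprK.
  rewrite /angle opprB.
  have -> : (2 ^ n - k.+1 + 2 ^ n).*2.+1%:R = 2 ^+ n.+2 - k.*2.+1%:R :> R.
    rewrite -natrX -natrB; last by rewrite !expnS; lia.
    by congr _%:R; rewrite !expnS; lia.
  have p0 : 2 ^+ n != 0 :> R by rewrite expf_neq0.
  by rewrite !exprS; field.
rewrite -big_split mulr_sumr /=; apply: eq_big_nat => k /andP[_ kn].
have -> : angle n k = angle n.+1 k *+ 2.
  rewrite /angle [2 ^+ n.+3]exprS -mulr_natl; field.
  by rewrite expf_neq0.
have kn' : (k < 2 ^ n.+1)%N by rewrite expnS; lia.
have /andP[a0 api] := angle_itv kn'.
rewrite sin_mulr2n -mulr_natl.
have s0 : 0 < sin (angle n.+1 k) by rewrite sin_gt0_pihalf // a0.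
have c0 : 0 < cos (angle n.+1 k).
  by rewrite cos_gt0_pihalf // api andbT (lt_trans _ a0) // oppr_lt0 divr_gt0 // pi_gt0.
have := cos2Dsin2 (angle n.+1 k).
move: (sin _) (cos _) s0 c0 => s c s0 c0 h.
rewrite (_ : s^-1 ^+ 2 + c^-1 ^+ 2 = (c ^+ 2 + s ^+ 2) * (s^-1 ^+ 2 * c^-1 ^+ 2)).
  by rewrite h; field; rewrite !gt_eqF.
by field; rewrite !gt_eqF.
Qed.

Lemma harm2_double n :
  harm2 n.*2 - harm2 n / 4 = \sum_(0 <= k < n) k.*2.+1%:R^-1 ^+ 2.
Proof.
elim: n => [|n IH]; first by rewrite big_nil harm20 mul0r subr0.
rewrite big_nat_recr //= -IH doubleS !harm2S -doubleS -[n.+1.*2]muln2 natrM.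
move: (n.*2.+1%:R^-1) => z; field.
by rewrite addrC natr1 pnatr_eq0.
Qed.

Lemma odd_basel n :
  pi ^+ 2 / 8 - pi ^+ 2 / 16 / 2 ^+ n <=
  harm2 (2 ^ n).*2 - harm2 (2 ^ n) / 4 <= pi ^+ 2 / 8.
Proof.
rewrite harm2_double; set S := \sum_(_ <= _ < _) _.
have p0 := pi_gt0 R; have t0 : 2 ^+ n != 0 :> R by rewrite expf_neq0.
have SE : S = pi ^+ 2 / (16 * 4 ^+ n) * \sum_(0 <= k < 2 ^ n) (angle n k)^-1 ^+ 2.
  rewrite mulr_sumr; apply: eq_big_nat => k _; rewrite /angle.
  have -> : 4 ^+ n = 2 ^+ n * 2 ^+ n :> R by rewrite -exprMn; congr (_ ^+ n); ring.
  rewrite !exprS invf_div.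
  have p1 : pi != 0 :> R by rewrite gt_eqF.
  move: (2 ^+ n) t0 (@pi R) p1 => t t0 q q0.
  by field; rewrite t0 q0 posD_nat_neq0.
have q0 : 0 < pi ^+ 2 / (16 * 4 ^+ n) :> R.
  by rewrite divr_gt0 ?exprn_gt0 ?mulr_gt0 ?exprn_gt0.
have -> : pi ^+ 2 / 8 = pi ^+ 2 / (16 * 4 ^+ n) * (2 * 4 ^+ n) :> R.
  by field; rewrite expf_neq0.
have -> : pi ^+ 2 / 16 / 2 ^+ n = pi ^+ 2 / (16 * 4 ^+ n) * 2 ^+ n :> R.
  have -> : 4 ^+ n = 2 ^+ n * 2 ^+ n :> R by rewrite -exprMn; congr (_ ^+ n); ring.
  by field.
rewrite SE -mulrBr !ler_pM2l // -sum_inv_sin2.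
have -> : 2 ^+ n = \sum_(0 <= k < 2 ^ n) 1 :> R.
  by rewrite sumr_const_nat subn0 natrX.
rewrite -sumrB; apply/andP; split; apply: ler_sum_nat => k /andP[_ kn];
  by have /andP[] := inv_sqr_bounds (angle_itv kn).
Qed.

(** The limit is identified along powers of two, the odd terms carrying three quarters of the sum.
    The rate matters as much as the value: multiplied by n^2 in the variance it has to leave an
    error O(n). *)
Lemma basel_tail n : (0 < n)%N ->
  n.+1%:R^-1 <= pi ^+ 2 / 6 - harm2 n <= n%:R^-1.
Proof.
have [m|l hl] := @tele_cvg R harm2 2.
  rewrite harm2S addrC addKr ger0_norm ?sqr_ge0 //.
  have m0 : 0 < m.+1%:R :> R by rewrite ltr0n.
  rewrite -subr_ge0 (_ : _ - _ = m%:R / (m.+1%:R ^+ 2 * m.+2%:R)).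
    by rewrite divr_ge0 // mulr_ge0 // exprn_ge0.
  by field; nat_neq0.
have small (x C : R) : (forall m, x <= C / m.+1%:R) -> x <= 0.
  move=> hx; apply/ler_addgt0Pl => e e0; rewrite addr0.
  apply: (le_trans (hx (Num.truncn (C / e)))).
  by rewrite ler_pdivrMr ?ltr0n // mulrC -ler_pdivrMr // ltW // truncnS_gt.
have lE : l = pi ^+ 2 / 6.
  have hd m : `|3 / 4 * l - pi ^+ 2 / 8| <= (pi ^+ 2 / 16 + 3) / m.+1%:R.
    have hm : m.+1%:R <= 2 ^+ m :> R by rewrite -natrX ler_nat ltn_expl.
    have m0 : 0 < m.+1%:R :> R by rewrite ltr0n.
    have t0 : 0 < 2 ^+ m :> R by rewrite exprn_gt0.
    have := odd_basel m; have := hl (2 ^ m)%N; have := hl (2 ^ m).*2.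
    have d1 : 2 / (2 ^ m).*2.+1%:R <= 2 / m.+1%:R :> R.
      rewrite ler_pM2l // lef_pV2 ?posrE ?ltr0n // ler_nat ltnS.
      by have := ltn_expl m (ltnSn 1); lia.
    have d2 : 2 / (2 ^ m).+1%:R <= 2 / m.+1%:R :> R.
      rewrite ler_pM2l // lef_pV2 ?posrE ?ltr0n // ler_nat ltnS.
      by have := ltn_expl m (ltnSn 1); lia.
    have d3 : pi ^+ 2 / 16 / 2 ^+ m <= pi ^+ 2 / 16 / m.+1%:R :> R.
      by rewrite ler_pM2l ?divr_gt0 ?exprn_gt0 ?pi_gt0 // lef_pV2.
    move=> /le_trans/(_ d1); rewrite ler_norml => /andP[e1 e2].
    move=> /le_trans/(_ d2); rewrite ler_norml => /andP[e3 e4].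
    move=> /andP[e5 e6].
    have p0 : 0 <= pi ^+ 2 / 16 / m.+1%:R :> R by rewrite !divr_ge0 ?sqr_ge0.
    rewrite [in leRHS]mulrDl ler_norml.
    have i0 : 0 <= m.+1%:R^-1 :> R by rewrite invr_ge0.
    move: d3 p0 e5 e6 e1 e2 e3 e4 i0; rewrite -[2 / _]/(2 * m.+1%:R^-1).
    move: (pi ^+ 2 / 16 / 2 ^+ m) (pi ^+ 2 / 16 / m.+1%:R) => A B.
    move: (pi ^+ 2) => P.
    move: (m.+1%:R^-1) (harm2 _) (harm2 _) => i Y X *.
    by apply/andP; split; lra.
  have := small _ _ hd; rewrite normr_le0 subr_eq0 => /eqP; lra.
rewrite -lE => n0.
(* [harm2 n + 1 / (n + 1)] increases and [harm2 n + 1 / n] decreases, so the limit lies between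
   them. *)
have hinc k : n.+1%:R^-1 + harm2 n <= (n + k).+1%:R^-1 + harm2 (n + k).
  elim: k => [|k IH]; first by rewrite addn0.
  apply: (le_trans IH); rewrite addnS harm2S -subr_ge0.
  move: (n + k)%N => m; rewrite (_ : _ - _ = (m.+1%:R ^+ 2 * m.+2%:R)^-1).
    by rewrite invr_ge0 mulr_ge0 // exprn_ge0.
  by field; nat_neq0.
have hdec k : (n + k)%:R^-1 + harm2 (n + k) <= n%:R^-1 + harm2 n.
  elim: k => [|k IH]; first by rewrite addn0.
  apply: (le_trans _ IH); rewrite addnS harm2S -subr_ge0.
  have : (0 < n + k)%N by rewrite addn_gt0 n0.
  case: (n + k)%N => // m _; rewrite (_ : _ - _ = (m.+1%:R * m.+2%:R ^+ 2)^-1).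
    by rewrite invr_ge0 mulr_ge0 // exprn_ge0.
  by field; nat_neq0.
rewrite lerBrDr lerBlDr; apply/andP; split.
- rewrite -subr_le0; apply: (small _ 3) => k.
  have := hl (n + k)%N; have := hinc k; rewrite ler_norml => h1 /andP[_ h2].
  have h3 : (n + k).+1%:R^-1 <= k.+1%:R^-1 :> R.
    by rewrite lef_pV2 ?posrE ?ltr0n // ler_nat ltnS leq_addl.
  move: h1 h2 h3; move: ((n + k).+1%:R^-1) (k.+1%:R^-1) (n.+1%:R^-1) => p q r.
  lra.
- rewrite -subr_le0; apply: (small _ 2) => k.
  have := hl (n + k)%N; have := hdec k; rewrite ler_norml => h1 /andP[h2 _].
  have h3 : (n + k).+1%:R^-1 <= k.+1%:R^-1 :> R.
    by rewrite lef_pV2 ?posrE ?ltr0n // ler_nat ltnS leq_addl.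
  have h4 : 0 <= (n + k)%:R^-1 :> R by rewrite invr_ge0.
  move: h1 h2 h3 h4.
  move: ((n + k).+1%:R^-1) (k.+1%:R^-1) (n%:R^-1) ((n + k)%:R^-1) => p q r s.
  lra.
Qed.

End Basel.


(** * Growth of the central moments *)

Section Growth.
Set Implicit Arguments.
Unset Strict Implicit.
Unset Printing Implicit Defensive.
Variable R : realType.
Implicit Types (n k i j m : nat) (x y C : R).
Local Notation harm := (@harm R).
Local Notation harm2 := (@harm2 R).
Local Notation vcost := (@vcost R).
Local Notation kcost := (@kcost R).
Local Notation qcost := (@qcost R).
Local Notation sdev := (@sdev R).
Local Notation tdev := (@tdev R).
Local Notation toll := (@toll R).

Definition sigma2 : R := 2 - pi ^+ 2 / 6.

(** One and two terms of the series place pi^2 / 6 between 1 + 1/2 and 5/4 + 1/2. The lower bound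
    1/4 later secures kappa > 0. *)
Lemma sigma2_itv : 1 / 4 <= sigma2 <= 1.
Proof.
have /andP[_ h1] := @basel_tail R 2 isT; have /andP[h2 _] := @basel_tail R 1 isT.
move: h1 h2; rewrite !harm2S (harm20 R) /sigma2; move: (pi ^+ 2) => p h1 h2.
by apply/andP; split; lra.
Qed.

Lemma vcost_ge0 n : 0 <= vcost n.
Proof. by rewrite -claw_sqr claw_ge0 // => x; exact: sqr_ge0. Qed.

(** The antisymmetric part of the toll alone gives this much. For n = 0 and n = 1 the cost is
    deterministic. *)
Lemma vcost_ge n : (1 < n)%N -> n%:R ^+ 2 / 16 <= vcost n.
Proof.
case: n => // n; rewrite ltnS => n0.
have N0 : 0 < n.+1%:R :> R by rewrite ltr0n.
rewrite -(ler_pM2l N0) vcost_rec.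
apply: (@le_trans _ _ (\sum_(i < n.+1) tdev n.+1 i ^+ 2)).
  rewrite sum_tdev2; have : 1 <= n%:R :> R by rewrite ler1n.
  rewrite -[n.+2%:R]natr1 -[n.+1%:R]natr1; move: n%:R => x x1.
  rewrite -subr_ge0 (_ : _ - _ = (x + 1) * (x + 3) * (x - 1) / 48).
    by rewrite divr_ge0 // !mulr_ge0 //; lra.
  by field.
rewrite big_split /= sum_toll2 addrA lerDr.
apply: addr_ge0; apply: sumr_ge0 => i _; last exact: sqr_ge0.
by rewrite addr_ge0 // vcost_ge0.
Qed.

Lemma vcost_le n : vcost n <= 2 * n%:R ^+ 2.
Proof.
case: n => [|n]; first by rewrite /vcost harm0 (harm20 R); lra.
have h1 := @harm_ge1 R n.+1 isT; have h2 := @harm2_ge1 R n.+1 isT.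
have x0 : 0 <= n%:R :> R by [].
rewrite /vcost -[n.+2%:R]natr1 -[n.+1%:R]natr1.
move: (harm n.+1) (harm2 n.+1) n%:R h1 h2 x0 => h g x h1 h2 x0.
have := ler_wpM2l (sqr_ge0 (x + 2)) h2.
have x2 : 0 <= x + 2 by lra.
by have := ler_wpM2l x2 h1; have := sqr_ge0 x; lra.
Qed.

Lemma basel_tailM n (z := harm2 n) : (0 < n)%N ->
  1 <= (pi ^+ 2 / 6 - z) * (n%:R + 1) /\ (pi ^+ 2 / 6 - z) * n%:R <= 1.
Proof.
move=> n0; have /andP[h1 h2] := basel_tail R n0; rewrite /z.
split; first by rewrite natr1 -ler_pdivrMr ?ltr0n // mul1r.
by rewrite -ler_pdivlMr ?ltr0n // mul1r.
Qed.

Lemma vcost_asymp n :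
  `|vcost n - (sigma2 * n%:R ^+ 2 - n%:R * harm n)| <= 4 * n%:R.
Proof.
case: n => [|n].
  by rewrite /vcost harm0 (harm20 R) ler_norml; apply/andP; split; lra.
have h1 := @harm_ge1 R n.+1 isT; have h2 := harm_le_n R n.+1.
have [h3 h4] := basel_tailM (ltn0Sn n).
have := sigma2_itv; rewrite /vcost /sigma2 -[n.+2%:R]natr1.
have x1 : 1 <= n.+1%:R :> R by rewrite ler1n.
move: (harm n.+1) (harm2 n.+1) n.+1%:R (pi ^+ 2 / 6) h1 h2 h3 h4 x1.
move=> h g x z h1 h2 h3 h4 x1 /andP[s1 s2].
set w := z - g in h3 h4; have -> : g = z - w by rewrite /w; ring.
have w0 : 0 <= w by rewrite -(pmulr_lge0 _ (_ : 0 < x + 1)); lra.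
have w1 : w <= 1.
  by apply: le_trans h4; rewrite ler_peMr.
have x0 : 0 <= x by lra.
have x10 : 0 <= x + 1 by lra.
have k1 := ler_wpM2l x10 h3.
have k2 := ler_wpM2l x0 h4.
have k3 : 0 <= (2 - z) * x by rewrite mulr_ge0 //; lra.
have k4 : 0 <= (z - 1) * x by rewrite mulr_ge0 //; lra.
by rewrite ler_norml; apply/andP; split; lra.
Qed.

Lemma sum_sqr_le n : \sum_(i < n) i%:R ^+ 2 <= n%:R ^+ 3 / 3 :> R.
Proof.
rewrite sum_nat2; case: n => [|n]; first by rewrite mul0r mul0r; lra.
have : 0 <= n%:R :> R by [].
by rewrite -[n.+1%:R]natr1; move: n%:R => x x0; have := sqr_ge0 x; lra.
Qed.

Lemma sum_pow4_le n : \sum_(i < n) i%:R ^+ 4 <= n%:R ^+ 5 / 5 :> R.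
Proof.
elim: n => [|n IH]; first by rewrite big_ord0; lra.
rewrite big_ord_recr /=; have : 0 <= n%:R :> R by [].
rewrite -[n.+1%:R]natr1; move: n%:R IH => x IH x0.
have := exprn_ge0 2 x0; have := exprn_ge0 3 x0; lra.
Qed.

(** The guess 3 C n^2 reproduces itself since the squares below n sum to at most n^3 / 3, and 2 C +
    C = 3 C. *)
Lemma rec_bound2 (a : nat -> R) C : 0 <= C -> a 0%N <= 0 ->
  (forall n, n.+1%:R * a n.+1 <= 2 * \sum_(i < n.+1) a i + C * n.+1%:R ^+ 3) ->
  forall n, a n <= 3 * C * n%:R ^+ 2.
Proof.
move=> C0 a0 aS; elim/law_ind => [|n IH]; first by rewrite expr0n mulr0.
have N0 : 0 < n.+1%:R :> R by rewrite ltr0n.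
rewrite -(ler_pM2l N0); apply: (le_trans (aS n)).
have : \sum_(i < n.+1) a i <= \sum_(i < n.+1) 3 * C * i%:R ^+ 2.
  by apply: ler_sum => i _; apply: IH; rewrite -ltnS.
rewrite -mulr_sumr => h1.
have h2 := ler_wpM2l C0 (sum_sqr_le n.+1).
by move: h1 h2; move: (\sum_(i < n.+1) i%:R ^+ 2) => S; lra.
Qed.

(** The factor 4 is twice that of the cost recursion, which leaves room to absorb third moments; 4 /
    5 < 1 still closes the induction. *)
Lemma rec_bound4 (a : nat -> R) C : 0 <= C -> a 0%N <= 0 ->
  (forall n, n.+1%:R * a n.+1 <= 4 * \sum_(i < n.+1) a i + C * n.+1%:R ^+ 5) ->
  forall n, a n <= 5 * C * n%:R ^+ 4.
Proof.
move=> C0 a0 aS; elim/law_ind => [|n IH]; first by rewrite expr0n mulr0.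
have N0 : 0 < n.+1%:R :> R by rewrite ltr0n.
rewrite -(ler_pM2l N0); apply: (le_trans (aS n)).
have : \sum_(i < n.+1) a i <= \sum_(i < n.+1) 5 * C * i%:R ^+ 4.
  by apply: ler_sum => i _; apply: IH; rewrite -ltnS.
rewrite -mulr_sumr => h1.
have h2 := ler_wpM2l C0 (sum_pow4_le n.+1).
by move: h1 h2; move: (\sum_(i < n.+1) i%:R ^+ 4) => S; lra.
Qed.

(** x^4 - 4 c x^3 + 27 c^4 = (x - 3 c)^2 ((x + c)^2 + 2 c^2). It charges third moments to fourth
    moments, so the recurrence for [qcost] closes on itself. *)
Lemma amgm4 x c : 4 * c * x ^+ 3 <= x ^+ 4 + 27 * c ^+ 4.
Proof.
have := mulr_ge0 (sqr_ge0 (x - 3 * c))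
  (addr_ge0 (sqr_ge0 (x + c)) (mulr_ge0 (ler0n R 2) (sqr_ge0 c))).
lra.
Qed.

Lemma qcost_le : exists2 K : R, 0 <= K & forall n, qcost n <= K * n%:R ^+ 4.
Proof.
exists (5 * 2000%:R); first by rewrite mulr_ge0 ?ler0n.
apply: rec_bound4 => [||n]; first exact: ler0n.
  by rewrite /qcost claw0 expr0n.
rewrite qcost_rec; set D := 2000%:R.
have kq c i : 4 * c * kcost i <= qcost i + 27 * c ^+ 4.
  rewrite /kcost /qcost -clawZ -[27 * _](claw_cst i) -clawD.
  by apply: ler_claw => x; exact: amgm4.
(* With tolls at most 2 N and variances at most 2 N^2, the terms other than [qcost] add up to 54 *
   16 + 24 + 96 + 16 = 1000 times N^4. *)
apply: (@le_trans _ _ (\sum_(i < n.+1) (2 * qcost i + 2 * qcost (n - i) + D * n.+1%:R ^+ 4))).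
  apply: ler_sum => i _; have le_in : (i <= n)%N by rewrite -ltnS.
  have := norm_toll_le R le_in; set c := toll _ _ => hc.
  have N1 : 1 <= n.+1%:R :> R by rewrite ler1n.
  set N := n.+1%:R in N1 *.
  have hc2 : `|c| <= 2 * N by apply: (le_trans hc); rewrite -natr1 -/N; lra.
  have c2 : c ^+ 2 <= 4 * N ^+ 2.
    have := ler_pM (normr_ge0 c) (normr_ge0 c) hc2 hc2.
    by rewrite -[_ * `|c|]expr2 (real_normK (num_real c)); lra.
  have c4 : c ^+ 4 <= 16 * N ^+ 4.
    have := ler_pM (sqr_ge0 c) (sqr_ge0 c) c2 c2; lra.
  have vb k : (k <= n)%N -> vcost k <= 2 * N ^+ 2.
    move=> kn; apply: (le_trans (vcost_le k)); rewrite ler_wpM2l //.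
    by rewrite ler_pXn2r ?nnegrE // ler_nat ltnW.
  have v1 := vb _ le_in; have v2 := vb _ (leq_subr i n).
  have := kq c i; have := kq c (n - i)%N.
  have := ler_pM (vcost_ge0 i) (vcost_ge0 (n - i)) v1 v2.
  have := ler_pM (sqr_ge0 c) (vcost_ge0 i) c2 v1.
  have := ler_pM (sqr_ge0 c) (vcost_ge0 (n - i)) c2 v2.
  have D2 : D = 2000 by [].
  have := exprn_ge0 4 (ler0n R n.+1); rewrite -/N.
  have : 1048 * N ^+ 4 <= D * N ^+ 4.
    by rewrite ler_wpM2r ?exprn_ge0 // ler_nat.
  move: (D * N ^+ 4) => Z.
  lra.
rewrite !big_split /= -!mulr_sumr (sum_rev n qcost) sumr_const card_ord.
by rewrite -[_ *+ n.+1]mulr_natl; lra.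
Qed.

(** * Asymptotics of the third central moment *)

Definition kinhom n : R := \sum_(i < n.+1)
  (3 * toll n.+1 i * (vcost i + vcost (n - i)) + toll n.+1 i ^+ 3).

(** Remainder of the variance against sigma2 x^2 + x - x [harm x] with x = i + 1; the two-sided rate
    of Basel's series keeps it bounded. *)
Definition vrem i : R := i.+1%:R ^+ 2 * (pi ^+ 2 / 6 - harm2 i.+1) - i.+1%:R.

Lemma vrem_itv i : -1 <= vrem i <= 0.
Proof.
have [h1 h2] := basel_tailM (ltn0Sn i); rewrite /vrem.
have : 1 <= i.+1%:R :> R by rewrite ler1n.
move: (_ - harm2 _) i.+1%:R h1 h2 => w x h1 h2 x1.
have x0 : 0 <= x by lra.
have w0 : 0 <= w by rewrite -(pmulr_lge0 _ (_ : 0 < x + 1)); lra.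
have k1 := ler_wpM2l x0 h1; have k2 := ler_wpM2l x0 h2.
by apply/andP; split; lra.
Qed.

(** The squares of the part sizes give a constant plus 2 t^2, and the terms x [harm x] recombine
    into -s. In the third moment the constant multiplies the tolls, which sum to zero. *)
Lemma vcost_pairE n i : (i <= n)%N -> vcost i + vcost (n - i) =
  (sigma2 * n.+2%:R ^+ 2 / 2 + 3 * n.+2%:R / 2 - n.+2%:R * harm n.+2) +
  2 * sigma2 * tdev n.+1 i ^+ 2 + (vrem i + vrem (n - i) - sdev n.+1 i).
Proof.
move=> le_in; rewrite !vcostE /sdev /tdev /vrem /sigma2 subSn //.
have -> : n.+2%:R = i.+1%:R + (n - i).+1%:R :> R.
  by rewrite -natrD; congr _%:R; lia.
by move: (i.+1%:R) ((n - i).+1%:R) (pi ^+ 2) => x y p; field.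
Qed.

(** Odd powers of t cancel by reflection; s t^2 survives with 3 from the cube of the toll and 6
    [sigma2] from the variances. *)
Lemma kinhomE n : kinhom n =
  sum_sdev3 R n.+1 + (3 + 6 * sigma2) * \sum_(i < n.+1) sdev n.+1 i * tdev n.+1 i ^+ 2
  + \sum_(i < n.+1) 3 * toll n.+1 i * (vrem i + vrem (n - i) - sdev n.+1 i).
Proof.
pose odd_part i : R := 3 * sdev n.+1 i ^+ 2 * tdev n.+1 i +
  (1 + 6 * sigma2) * tdev n.+1 i ^+ 3.
pose K : R := sigma2 * n.+2%:R ^+ 2 / 2 + 3 * n.+2%:R / 2 - n.+2%:R * harm n.+2.
have odd0 : \sum_(i < n.+1) odd_part i = 0.
  apply: sum_odd => i lt_in.
  by rewrite /odd_part sdev_sym // tdev_sym //; ring.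
transitivity (\sum_(i < n.+1) (sdev n.+1 i ^+ 3 +
    (3 + 6 * sigma2) * (sdev n.+1 i * tdev n.+1 i ^+ 2) +
    3 * toll n.+1 i * (vrem i + vrem (n - i) - sdev n.+1 i) +
    odd_part i + 3 * K * toll n.+1 i)).
  apply: eq_bigr => i _; have le_in : (i <= n)%N by rewrite -ltnS.
  by rewrite vcost_pairE // -/K /odd_part tollE //; ring.
by rewrite 4!big_split /= odd0 -!mulr_sumr sum_toll mulr0 !addr0.
Qed.

Lemma kinhom_asymp : exists b C : R, [/\ 0 < b, 0 <= C &
  forall n, `|kinhom n - b * n.+1%:R ^+ 4| <= C * n.+1%:R ^+ 3].
Proof.
have [a [C [ha C0 hC]]] := sum_sdev3_asymp R.
have /andP[s1 s2] := sigma2_itv.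
(* The sum of s t^2 is n^4 / 72 to leading order. As [sigma2 >= 1/4], the second summand is at least
   1/16, which exceeds 27 / 1000. *)
exists (a + (3 + 6 * sigma2) / 72), (8 * C + 200 + 15 * `|a|); split.
- by lra.
- by rewrite !addr_ge0 ?mulr_ge0.
move=> n; rewrite kinhomE sum_sdev_tdev2.
have h1 := hC n.+1; have x1 : 1 <= n.+1%:R :> R by rewrite ler1n.
have h2 : `|\sum_(i < n.+1) 3 * toll n.+1 i *
    (vrem i + vrem (n - i) - sdev n.+1 i)| <=
    n.+1%:R * (3 * n.+2%:R * (2 + n.+2%:R / 2)).
  apply: (le_trans (ler_norm_sum _ _ _)).
  have -> : n.+1%:R * (3 * n.+2%:R * (2 + n.+2%:R / 2)) =
     \sum_(i < n.+1) 3 * n.+2%:R * (2 + n.+2%:R / 2) :> R.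
    by rewrite sumr_const card_ord mulr_natl.
  apply: ler_sum => i _; have le_in : (i <= n)%N by rewrite -ltnS.
  rewrite !normrM [`|3|]ger0_norm // ler_pM ?mulr_ge0 //.
    by rewrite ler_wpM2l // norm_toll_le.
  have := norm_sdev_le R (leqW le_in); rewrite !ler_norml => /andP[k1 k2].
  have /andP[k3 k4] := vrem_itv i; have /andP[k5 k6] := vrem_itv (n - i).
  by apply/andP; split; lra.
move: h1 h2; set A := sum_sdev3 _ _; set B := \sum_(i < n.+1) _.
rewrite /= -[n.+2%:R]natr1; move: (n.+1%:R) x1 => x x1 h1 h2.
have -> : A + (3 + 6 * sigma2) * ((x + 1) * (x + 1 - 1) * (x + 1 - 2) * (x + 1 - 3) / 72)
   + B - (a + (3 + 6 * sigma2) / 72) * x ^+ 4 =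
   (A - a * (x + 1) ^+ 4) + B + (a * ((x + 1) ^+ 4 - x ^+ 4) -
   (3 + 6 * sigma2) / 72 * (2 * x ^+ 3 + x ^+ 2 - 2 * x)) by field.
have x0 : 0 <= x by lra.
have xx : x <= x ^+ 2 by rewrite expr2 ler_peMr.
have xxx : x ^+ 2 <= x ^+ 3 by rewrite [x ^+ 3]exprS ler_peMl ?exprn_ge0.
apply: (le_trans (ler_normD _ _)).
apply: (le_trans (lerD (ler_normD _ _) (ler_normB _ _))).
rewrite (normrM a) [`|(x + 1) ^+ 4 - _|]ger0_norm; last by lra.
rewrite [`|_ / 72 * _|]ger0_norm; last by rewrite mulr_ge0 //; lra.
have e1 : C * (x + 1) ^+ 3 <= C * (8 * x ^+ 3) by rewrite ler_wpM2l //; lra.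
have e2 : `|a| * ((x + 1) ^+ 4 - x ^+ 4) <= `|a| * (15 * x ^+ 3).
  by rewrite ler_wpM2l //; lra.
have e3 : (3 + 6 * sigma2) / 72 * (2 * x ^+ 3 + x ^+ 2 - 2 * x) <=
   9 / 72 * (3 * x ^+ 3) by apply: ler_pM; lra.
by lra.
Qed.

Lemma kcost_asymp : exists kappa C : R, [/\ 0 < kappa, 0 <= C &
  forall n, `|kcost n - kappa * n%:R ^+ 3| <= C * n%:R ^+ 2].
Proof.
have [b [C [b0 C0 hC]]] := kinhom_asymp.
have D0 : 0 <= C + 2 * b by lra.
have kS n : n.+1%:R * kcost n.+1 = 2 * \sum_(i < n.+1) kcost i + kinhom n.
  rewrite kcost_rec /kinhom; under eq_bigr do rewrite -addrA.
  by rewrite big_split /= big_split /= (sum_rev n kcost); ring.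
have cube n : \sum_(i < n.+1) 2 * b * i%:R ^+ 3 = b * (n.+1%:R * (n.+1%:R - 1)) ^+ 2 / 2.
  by rewrite -mulr_sumr sum_nat3; field.
(* Twice the sum of kappa i^3 is kappa n^4 / 2 to leading order, so kappa = kappa / 2 + b. The
   deviation from 2 b n^3 obeys [rec_bound2], applied with both signs [e]. *)
exists (2 * b), (3 * (C + 2 * b)); split; [by lra | by rewrite mulr_ge0 |].
have bound (e : R) : `|e| <= 1 -> forall n, n.+1%:R * (e * (kcost n.+1 - 2 * b * n.+1%:R ^+ 3)) <=
    2 * \sum_(i < n.+1) (e * (kcost i - 2 * b * i%:R ^+ 3)) + (C + 2 * b) * n.+1%:R ^+ 3.
  move=> e1 n; rewrite -mulr_sumr sumrB cube.
  have : e * (kinhom n - b * n.+1%:R ^+ 4) <= C * n.+1%:R ^+ 3.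
    apply: (le_trans (ler_norm _)); rewrite normrM (le_trans _ (hC n)) //.
    by rewrite ler_piMl.
  have : e * (b * (2 * n.+1%:R ^+ 3 - n.+1%:R ^+ 2)) >= - (2 * b * n.+1%:R ^+ 3).
    have q0 : 0 <= b * (2 * n.+1%:R ^+ 3 - n.+1%:R ^+ 2).
      rewrite mulr_ge0 // ?(ltW b0) // subr_ge0.
      have N1 : 1 <= n.+1%:R :> R by rewrite ler1n.
      have := ler_wpM2r (sqr_ge0 (n.+1%:R : R)) N1.
      by have := exprn_ge0 3 (ler0n R n.+1); lra.
    rewrite lerNl -mulNr; apply: (le_trans (ler_norm _)).
    rewrite normrM normrN (ger0_norm q0) (le_trans (ler_piMl _ e1)) //.
    rewrite [2 * b]mulrC -mulrA ler_wpM2l ?(ltW b0) //.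
    by have := sqr_ge0 (n.+1%:R : R); lra.
  have := kS n.
  move: (kinhom n) (\sum_(i < n.+1) kcost i) (kcost n.+1) => K S k.
  move: (n.+1%:R) => x E; have -> : K = x * k - 2 * S by rewrite E; ring.
  lra.
have b1 := @rec_bound2 (fun n => 1 * (kcost n - 2 * b * n%:R ^+ 3)) _ D0.
have b2 := @rec_bound2 (fun n => -1 * (kcost n - 2 * b * n%:R ^+ 3)) _ D0.
have k0 : kcost 0 = 0 by rewrite /kcost claw0 expr0n.
have z0 e : e * (kcost 0 - 2 * b * 0 ^+ 3) <= 0.
  by rewrite k0 expr0n !mulr0 subr0 mulr0.
have n1 : `|-1| <= 1 :> R by rewrite normrN normr1.
have p1 : `|1| <= 1 :> R by rewrite normr1.
move=> n; rewrite ler_norml; apply/andP; split.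
  by have := b2 (z0 _) (bound _ n1) n; lra.
by have := b1 (z0 _) (bound _ p1) n; lra.
Qed.

End Growth.


(** * Coupling of two uniform splits *)

Section Coupling.
Set Implicit Arguments.
Unset Strict Implicit.
Unset Printing Implicit Defensive.
Variable R : realType.
Implicit Types (n k i j m p q : nat) (x y C : R) (f g : R -> R).
Local Notation harm := (@harm R).
Local Notation vcost := (@vcost R).
Local Notation toll := (@toll R).

Definition sd n : R := Num.sqrt (vcost n).
Definition sigma : R := Num.sqrt (sigma2 R).

Lemma sd_ge0 n : 0 <= sd n. Proof. exact: sqrtr_ge0. Qed.
Lemma sqr_sd n : sd n ^+ 2 = vcost n.
Proof. by rewrite sqr_sqrtr // vcost_ge0. Qed.

Lemma vcost_small n : (n <= 1)%N -> vcost n = 0.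
Proof.
by case: n => [|[|]] // _; rewrite /vcost ?harmS ?harm2S (harm0 R) (harm20 R); field.
Qed.

Lemma sd_small n : (n <= 1)%N -> sd n = 0.
Proof. by move=> n1; rewrite /sd vcost_small // sqrtr0. Qed.

Lemma sd_ge n : (1 < n)%N -> n%:R / 4 <= sd n.
Proof.
move=> n1; rewrite -(ler_pXn2r (ltn0Sn 1)) ?nnegrE ?divr_ge0 ?sd_ge0 //.
rewrite sqr_sd; apply: le_trans (vcost_ge R n1); rewrite expr_div_n.
by rewrite ler_wpM2l ?sqr_ge0 // lef_pV2 ?posrE //; lra.
Qed.

Lemma sd_le n : sd n <= 2 * n%:R.
Proof.
rewrite -(ler_pXn2r (ltn0Sn 1)) ?nnegrE ?sd_ge0 ?mulr_ge0 // sqr_sd.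
by apply: (le_trans (vcost_le R n)); have := sqr_ge0 (n%:R : R); lra.
Qed.

Lemma sigma_itv : 1 / 2 <= sigma <= 1.
Proof.
have /andP[s1 s2] := sigma2_itv R.
have sE : sigma ^+ 2 = sigma2 R by rewrite sqr_sqrtr //; lra.
have s0 : 0 <= sigma := sqrtr_ge0 _.
by apply/andP; split; rewrite -(ler_pXn2r (ltn0Sn 1)) ?nnegrE // sE; lra.
Qed.

(** Divide sd^2 - sigma^2 n^2 by sd + sigma n, which is at least n / 2. *)
Lemma sd_asymp n : `|sd n - sigma * n%:R| <= 10 * harm n.
Proof.
case: n => [|n].
  by rewrite sd_small // (harm0 R) mulr0 subr0 normr0 mulr0.
have /andP[s1 s2] := sigma_itv.
have h1 := @harm_ge1 R n.+1 isT; have x1 : 1 <= n.+1%:R :> R by rewrite ler1n.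
have := vcost_asymp R n.+1.
have : sigma2 R = sigma ^+ 2 by rewrite sqr_sqrtr //; have /andP[] := sigma2_itv R; lra.
move=> ->; rewrite -sqr_sd; have := sd_ge0 n.+1.
move: (sd _) sigma (harm _) n.+1%:R s1 s2 h1 x1 => s t h x t1 t2 h1 x1 s0 hv.
have x0 : 0 < x by lra.
have tx : x / 2 <= t * x by rewrite mulrC ler_wpM2r //; lra.
have xh : x <= x * h by rewrite ler_peMr // ltW.
rewrite -(ler_pM2r (_ : 0 < x / 2)); last by lra.
apply: (@le_trans _ _ (`|s - t * x| * (s + t * x))).
  by rewrite ler_wpM2l //; lra.
rewrite -[s + t * x]ger0_norm; last by lra.
rewrite -normrM (_ : (s - t * x) * (s + t * x) = (s ^+ 2 - (t ^+ 2 * x ^+ 2 - x * h)) - x * h); last by ring.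
apply: (le_trans (ler_normB _ _)); rewrite [`|x * h|]ger0_norm; last by lra.
by lra.
Qed.

(** With standard deviations in place of sizes, a rescaled cost has exactly the variance of the cost
    that it replaces. *)
Definition ratio i m : R := sd i / sd m.

(* Here [0 / 0 = 0] is the right value: a vanishing variance means a
   degenerate law. *)
Lemma ratioM i m : (i <= m)%N -> ratio i m * sd m = sd i.
Proof.
move=> im; have [m1|m1] := leqP m 1.
  by rewrite (sd_small m1) (sd_small (leq_trans im m1)) mulr0.
rewrite /ratio divfK // gt_eqF // (lt_le_trans _ (sd_ge m1)) //.
by rewrite divr_gt0 // ltr0n ltnW.
Qed.

Lemma ratio_sqrM i m : (i <= m)%N -> ratio i m ^+ 2 * vcost m = vcost i.
Proof. by move=> im; rewrite -!sqr_sd -exprMn ratioM. Qed.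

(** The error carries [harm p] and not [harm q], because [harm_sublinear] trades p [harm q] for q
    [harm p]. All uniformity in q rests on this. *)
Lemma ratio_asymp p q : (0 < p <= q)%N ->
  `|ratio p q - p%:R / q%:R| <= 80 * harm p / q%:R.
Proof.
move=> /andP[p0 pq]; have h1 := @harm_ge1 R p p0.
have q0 : 0 < q%:R :> R by rewrite ltr0n (leq_trans p0).
have [q1|q1] := leqP q 1.
  have -> : q = 1%N by apply/eqP; rewrite eqn_leq q1 (leq_trans p0).
  have -> : p = 1%N by apply/eqP; rewrite eqn_leq p0 (leq_trans pq).
  rewrite /ratio (@sd_small 1) // mul0r sub0r normrN !divr1 normr1.
  by rewrite (harm1 R); lra.
have hs := @harm_sublinear R p q; rewrite p0 pq in hs; have {}hs := hs isT.
have sq := sd_ge q1; have sq0 : 0 < sd q by apply: lt_le_trans sq; lra.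
rewrite ler_pdivlMr // -[X in _ * X <= _]gtr0_norm // -normrM.
rewrite -(ler_pM2r sq0) -[X in _ * X <= _]gtr0_norm // -normrM.
have -> : (ratio p q - p%:R / q%:R) * q%:R * sd q =
   q%:R * (sd p - sigma * p%:R) - p%:R * (sd q - sigma * q%:R).
  by rewrite /ratio; field; rewrite !gt_eqF.
apply: (le_trans (ler_normB _ _)); rewrite !normrM !(ger0_norm (ler0n _ _)).
have k1 := ler_wpM2l (ltW q0) (sd_asymp p).
have k2 := ler_wpM2l (ler0n R p) (sd_asymp q).
have k3 : 80 * harm p * (q%:R / 4) <= 80 * harm p * sd q.
  by rewrite ler_wpM2l //; lra.
by lra.
Qed.

(* A uniform [k < p * q] yields the uniform splits [k %/ q] of p and [k %/ p] of q. *)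
Section Floor.
Variables (p q k : nat).
Hypotheses (p0 : (0 < p)%N) (pq : (p <= q)%N) (kpq : (k < p * q)%N).
Let i := (k %/ q)%N.
Let m := (k %/ p)%N.

Lemma floor_itv (x := p%:R * m%:R : R) : i%:R * q%:R - p%:R <= x <= i.+1%:R * q%:R.
Proof.
have q0 : (0 < q)%N by exact: leq_trans pq.
have h1 := leq_trunc_div k q; have h2 := ltn_ceil k q0.
have h3 := leq_trunc_div k p; have h4 := ltn_ceil k p0.
rewrite /x lerBlDr -!natrM -natrD !ler_nat -/i -/m in h1 h2 h3 h4 *.
by apply/andP; split; nia.
Qed.

Lemma floor_lt : (i < p)%N /\ (m < q)%N.
Proof.
have q0 : (0 < q)%N by exact: leq_trans pq.
by rewrite !ltn_divLR // kpq mulnC kpq.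
Qed.

Lemma floor_le : (i <= m)%N.
Proof. exact: leq_div2l. Qed.

(** Reflecting k reflects both splits at once, so estimates for the first parts carry over to the
    second parts. *)
Lemma floor_rev : (p.-1 - i = (p * q - k.+1) %/ q /\ q.-1 - m = (p * q - k.+1) %/ p)%N.
Proof.
have q0 : (0 < q)%N by exact: leq_trans pq.
have [ip mq] := floor_lt.
have h1 := leq_trunc_div k q; have h2 := ltn_ceil k q0.
have h3 := leq_trunc_div k p; have h4 := ltn_ceil k p0.
rewrite -/i -/m in h1 h2 h3 h4.
split; apply/esym.
  rewrite (_ : p * q - k.+1 = (p.-1 - i) * q + (i.+1 * q - k.+1))%N; last first.
    by rewrite -subn1 -subnDA add1n mulnBl; nia.
  by rewrite divnMDl // divn_small ?addn0 //; nia.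
rewrite (_ : p * q - k.+1 = (q.-1 - m) * p + (m.+1 * p - k.+1))%N; last first.
  by rewrite -subn1 -subnDA add1n mulnBl; nia.
by rewrite divnMDl // divn_small ?addn0 //; nia.
Qed.

Lemma frac_floor : `|i%:R - p%:R * m%:R / q%:R| <= 1 :> R.
Proof.
have q0 : 0 < q%:R :> R by rewrite ltr0n (leq_trans p0).
have pq' : p%:R <= q%:R :> R by rewrite ler_nat.
have /andP[h1 h2] := floor_itv.
have w1 : p%:R * m%:R / q%:R <= i%:R + 1 :> R by rewrite ler_pdivrMr // natr1.
have w2 : i%:R - 1 <= p%:R * m%:R / q%:R :> R by rewrite ler_pdivlMr //; lra.
by move: w1 w2; move: (_ / q%:R) => w w1 w2; rewrite ler_norml; apply/andP; split; lra.
Qed.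

Lemma sd_coupling : `|sd i - ratio p q * sd m| <= 200 * harm p.
Proof.
have q0 : 0 < q%:R :> R by rewrite ltr0n (leq_trans p0).
have [ip mq] := floor_lt.
have h1 := @harm_ge1 R p p0.
have hi := harm_le R (ltnW ip); have hm := harm_le R (ltnW mq).
have hs := @harm_sublinear R p q; rewrite p0 pq in hs; have {}hs := hs isT.
have a1 := @ratio_asymp p q; rewrite p0 pq in a1; have {}a1 := a1 isT.
have /andP[s1 s2] := sigma_itv.
(* Passing through sigma i and sigma p m / q, the four errors are 10, 1, 160 and 10 times [harm p],
   at most. *)
have -> : sd i - ratio p q * sd m = (sd i - sigma * i%:R)
  + sigma * (i%:R - p%:R * m%:R / q%:R) - (ratio p q - p%:R / q%:R) * sd m
  - p%:R / q%:R * (sd m - sigma * m%:R) by ring.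
have b1 := sd_asymp i.
have b2 : `|sigma * (i%:R - p%:R * m%:R / q%:R)| <= 1 * 1.
  by rewrite normrM ler_pM // ?frac_floor // ger0_norm //; lra.
have b3 : `|(ratio p q - p%:R / q%:R) * sd m| <= 80 * harm p / q%:R * (2 * q%:R).
  rewrite normrM ler_pM // ger0_norm ?sd_ge0 // (le_trans (sd_le m)) //.
  by rewrite ler_wpM2l // ler_nat ltnW.
have b4 : `|p%:R / q%:R * (sd m - sigma * m%:R)| <= p%:R / q%:R * (10 * harm q).
  rewrite normrM [`|p%:R / _|]ger0_norm ?divr_ge0 // ler_wpM2l ?divr_ge0 //.
  by apply: (le_trans (sd_asymp m)); rewrite ler_wpM2l.
have b5 : p%:R / q%:R * (10 * harm q) <= 10 * harm p.
  by rewrite mulrAC ler_pdivrMr //; lra.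
have b6 : 80 * harm p / q%:R * (2 * q%:R) = 160 * harm p.
  by field; rewrite gt_eqF.
rewrite b6 in b3.
apply: (le_trans (ler_normB _ _)).
apply: (le_trans (lerD (ler_normB _ _) (lexx _))).
apply: (le_trans (lerD (lerD (ler_normD _ _) (lexx _)) (lexx _))).
by lra.
Qed.

(** The tails resemble j ln (p / j) and b ln (q / J) at nearly equal sizes j and b = p J / q. The
    sizes differ by at most 1, against a logarithm below 2 [harm p]; the logarithms differ by O(1 /
    b), which the factor b undoes. *)
Lemma tail_coupling :
  `|i.+1%:R * (harm p.+1 - harm i.+1) -
    p%:R / q%:R * (m.+1%:R * (harm q.+1 - harm m.+1))| <= 8 * harm p.
Proof.
have q0 : 0 < q%:R :> R by rewrite ltr0n (leq_trans p0).
have p0' : 0 < p%:R :> R by rewrite ltr0n.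
have pq' : p%:R <= q%:R :> R by rewrite ler_nat.
have [ip mq] := floor_lt.
have h1 := @harm_ge1 R p p0.
have /andP[f1 f2] := floor_itv.
set j : R := i.+1%:R; set J : R := m.+1%:R.
have j1 : 1 <= j by rewrite ler1n.
have J1 : 1 <= J by rewrite ler1n.
have Jq : J <= q%:R by rewrite ler_nat.
set b := p%:R * J / q%:R.
have bE : b * q%:R = p%:R * J by rewrite /b divfK // gt_eqF.
have b0 : 0 < b by rewrite /b divr_gt0 // mulr_gt0 //; lra.
have b1 : j - 1 <= b.
  rewrite /b ler_pdivlMr // /j /J -[i.+1%:R]natr1 -[m.+1%:R]natr1; lra.
have b2 : b <= j + 1.
  rewrite /b ler_pdivrMr // /j /J -[m.+1%:R]natr1; lra.
set x := harm p.+1 - harm i.+1; set y := harm q.+1 - harm m.+1.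
have x0 : 0 <= x by rewrite subr_ge0 harm_le // ltnS ltnW.
have x1 : x <= 2 * harm p.
  rewrite /x harmS; have := harm_ge0 R i.+1.
  have : p.+1%:R^-1 <= 1 :> R by rewrite invf_le1 ?ltr0n // ler1n.
  by move: (p.+1%:R^-1) => z; lra.
have xl : ln p.+2%:R - ln i.+2%:R <= x by apply: harm_tail_ge; rewrite ltnS ltnW.
have xu : x <= ln p.+1%:R - ln j by apply: harm_tail_le; rewrite /= ltnS ltnW.
have yl : ln q.+2%:R - ln m.+2%:R <= y by apply: harm_tail_ge; rewrite ltnS ltnW.
have yu : y <= ln q.+1%:R - ln J by apply: harm_tail_le; rewrite /= ltnS ltnW.
have pos (n : nat) : (n.+1%:R : R) \is Num.pos by rewrite posrE ltr0n.
have xy : b * (x - y) <= 6.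
  (* Upper and lower bounds by logarithms are combined so that ln z <= z - 1 applies to a single
     quotient near 1. *)
  have l1 : x - y <= p.+1%:R * m.+2%:R / (j * q.+2%:R) - 1.
    apply: (@le_trans _ _ (ln (p.+1%:R * m.+2%:R / (j * q.+2%:R)))).
      by rewrite ln_div ?posrE ?mulr_gt0 ?ltr0n // !lnM ?pos //; lra.
    by apply: ln_leB1; rewrite divr_gt0 ?mulr_gt0 ?ltr0n.
  have l2 : p.+1%:R * m.+2%:R / (j * q.+2%:R) <= (b + 2) / j.
    rewrite invfM mulrCA [(b + 2) / j]mulrC ler_wpM2l ?invr_ge0 //.
    rewrite ler_pdivrMr ?ltr0n // -[p.+1%:R]natr1 -[m.+2%:R]natr1 -/J.
    rewrite (_ : q.+2%:R = q%:R + 2); last by rewrite -addn2 natrD.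
    by lra.
  have l3 : x - y <= 3 / j.
    apply: (le_trans l1); apply: (le_trans (lerB l2 (lexx 1))).
    have j0 : 0 < j by lra.
    rewrite lerBlDr (_ : 3 / j + 1 = (3 + j) / j); last by field; rewrite gt_eqF.
    by rewrite ler_wpM2r ?invr_ge0 ?(ltW j0) //; lra.
  apply: (le_trans (ler_wpM2l (ltW b0) l3)).
  by rewrite mulrA ler_pdivrMr; lra.
have yx : b * (y - x) <= 6.
  have l1 : y - x <= q.+1%:R * i.+2%:R / (J * p.+2%:R) - 1.
    apply: (@le_trans _ _ (ln (q.+1%:R * i.+2%:R / (J * p.+2%:R)))).
      by rewrite ln_div ?posrE ?mulr_gt0 ?ltr0n // !lnM ?pos //; lra.
    by apply: ln_leB1; rewrite divr_gt0 ?mulr_gt0 ?ltr0n.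
  apply: (le_trans (ler_wpM2l (ltW b0) l1)).
  have l2 : b * (q.+1%:R * i.+2%:R / (J * p.+2%:R)) <= j + 1.
    rewrite mulrA ler_pdivrMr ?mulr_gt0 ?ltr0n // -(ler_pM2r q0).
    rewrite mulrAC bE -[q.+1%:R]natr1 -[i.+2%:R]natr1 -/j.
    rewrite (_ : p.+2%:R = p%:R + 2); last by rewrite -addn2 natrD.
    rewrite -subr_ge0 (_ : _ - _ = J * (j + 1) * (2 * q%:R - p%:R)); last by ring.
    by rewrite !mulr_ge0 //; lra.
  by rewrite mulrBr mulr1; move: l2; move: (b * (_ / _)) => w l2; lra.
have -> : j * x - p%:R / q%:R * (J * y) = (j - b) * x + b * (x - y).
  by rewrite /b; ring.
apply: (le_trans (ler_normD _ _)).
have e1 : `|(j - b) * x| <= 1 * (2 * harm p).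
  by rewrite normrM ler_pM // ?(ger0_norm x0) // ler_norml; apply/andP; split; lra.
have e2 : `|b * (x - y)| <= 6 by rewrite ler_norml; apply/andP; split; lra.
lra.
Qed.

End Floor.

Lemma tollE2 n i : (i <= n)%N -> toll n.+1 i = i.+1%:R
  - i.+1%:R * (harm n.+2 - harm i.+1) - (n - i).+1%:R * (harm n.+2 - harm (n - i).+1).
Proof.
by move=> le_in; rewrite tollE // sdevE ?leqW // /tdev subSn //; lra.
Qed.

(** By [tollE2] a toll is a part size minus two tails. The floors, the tails and the error of
    [ratio] contribute 2, 16 and 160. *)
Lemma toll_coupling n m k (p := n.+1) (q := m.+1) :
  (n <= m)%N -> (k < p * q)%N ->
  `|toll p (k %/ q) - ratio p q * toll q (k %/ p)| <= 200 * harm p.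
Proof.
move=> nm kpq; have p0 : (0 < p)%N by []. 
have pq : (p <= q)%N by [].
have [ip mq] := floor_lt p0 pq kpq.
have k'pq : (p * q - k.+1 < p * q)%N by rewrite ltn_subrL muln_gt0.
have [r1 r2] := floor_rev p0 pq kpq.
have t1 := tail_coupling p0 pq kpq; have t2 := tail_coupling p0 pq k'pq.
rewrite -r1 -r2 in t2.
have f1 := frac_floor p0 pq kpq.
have a1 := @ratio_asymp p q; rewrite p0 pq in a1; have {}a1 := a1 isT.
have h1 := @harm_ge1 R p p0.
have q0 : 0 < q%:R :> R by rewrite ltr0n.
have pq' : p%:R / q%:R <= 1 :> R by rewrite ler_pdivrMr // mul1r ler_nat.
have pq0 : 0 <= p%:R / q%:R :> R by rewrite divr_ge0.
have tq := norm_toll_le R (i := (k %/ p)) (n := m) mq; rewrite -/q in tq.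
have b3 : `|(ratio p q - p%:R / q%:R) * toll q (k %/ p)| <=
    80 * harm p / q%:R * (2 * q%:R).
  rewrite normrM ler_pM // (le_trans tq) // -natr1.
  by have : 1 <= q%:R :> R; [rewrite ler1n | lra].
have b6 : 80 * harm p / q%:R * (2 * q%:R) = 160 * harm p.
  by field; rewrite gt_eqF.
rewrite b6 in b3.
set t' := toll q _ in b3 *.
have -> : toll p (k %/ q) - ratio p q * t' = (toll p (k %/ q) - p%:R / q%:R * t')
  - (ratio p q - p%:R / q%:R) * t' by ring.
apply: (le_trans (ler_normB _ _)).
suff : `|toll p (k %/ q) - p%:R / q%:R * t'| <= 18 * harm p by lra.
pose T1 : R := (k %/ q).+1%:R * (harm p.+1 - harm (k %/ q).+1).
pose T1' : R := (k %/ p).+1%:R * (harm q.+1 - harm (k %/ p).+1).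
pose T2 : R := (n - k %/ q).+1%:R * (harm p.+1 - harm (n - k %/ q).+1).
pose T2' : R := (m - k %/ p).+1%:R * (harm q.+1 - harm (m - k %/ p).+1).
have {}t1 : `|T1 - p%:R / q%:R * T1'| <= 8 * harm p by exact: t1.
have {}t2 : `|T2 - p%:R / q%:R * T2'| <= 8 * harm p by exact: t2.
rewrite /t' [toll p _]tollE2 // [toll q _]tollE2 // -/p -/q -/T1 -/T2 -/T1' -/T2'.
rewrite [X in `|X|](_ : _ =
  (((k %/ q)%:R - p%:R * (k %/ p)%:R / q%:R) + (1 - p%:R / q%:R)) -
  (T1 - p%:R / q%:R * T1') - (T2 - p%:R / q%:R * T2')); last first.
  by rewrite -[(k %/ q).+1%:R]natr1 -[(k %/ p).+1%:R]natr1; ring.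
apply: (le_trans (ler_normB _ _)).
apply: (le_trans (lerD (ler_normB _ _) (lexx _))).
apply: (le_trans (lerD (lerD (ler_normD _ _) (lexx _)) (lexx _))).
have : `|1 - p%:R / q%:R| <= 1 :> R by rewrite ger0_norm; lra.
lra.
Qed.

End Coupling.


(** * Contraction *)

Section Contraction.
Set Implicit Arguments.
Unset Strict Implicit.
Unset Printing Implicit Defensive.
Variable R : realType.
Implicit Types (n k i j m p q : nat) (x y C : R) (f g : R -> R).
Local Notation harm := (@harm R).
Local Notation vcost := (@vcost R).
Local Notation qcost := (@qcost R).
Local Notation toll := (@toll R).
Local Notation claw := (@claw R).
Local Notation sd := (@sd R).
Local Notation ratio := (@ratio R).

(* The only property of the test functions that is used: at every point, a
   second-order Taylor expansion with cubic remainder, in difference form. *)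
Definition quad_lip f := forall z, exists b c, forall x y,
  `|f (z + x) - f (z + y) - b * (x - y) - c * (x ^+ 2 - y ^+ 2)| <=
  `|x - y| * (x ^+ 2 + y ^+ 2).

Lemma quad_lip_shift f z : quad_lip f -> quad_lip (fun x => f (x + z)).
Proof.
move=> qf t; have [b [c h]] := qf (t + z); exists b, c => x y.
by rewrite ![t + _ + z]addrAC.
Qed.

Lemma pow4_sum3 x y (z : R) : (x + y + z) ^+ 4 <= 27 * (x ^+ 4 + y ^+ 4 + z ^+ 4).
Proof.
have h (u v w : R) : (u + v + w) ^+ 2 <= 3 * (u ^+ 2 + v ^+ 2 + w ^+ 2).
  by have := sqr_ge0 (u - v); have := sqr_ge0 (v - w); have := sqr_ge0 (u - w); lra.
have h1 := ler_pM (sqr_ge0 _) (sqr_ge0 _) (h x y z) (h x y z).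
by have h2 := h (x ^+ 2) (y ^+ 2) (z ^+ 2); lra.
Qed.

(** In the fourth mean d has order l and u has order p. Only fourth powers remain on the right, as
    these are what [qcost] controls; l <= p takes care of the term |d|^3. *)
Lemma remainder_bound (l p d u : R) : 1 <= l -> l <= p ->
  `|d| * (u ^+ 2 + (u - d) ^+ 2) <=
  l * p ^+ 2 * (5 + 5 * (d / l) ^+ 4 + 3 * (u / p) ^+ 4).
Proof.
move=> l1 lp; have l0 : 0 < l by lra. have p0 : 0 < p by lra.
set a := d / l; set w := u / p.
have -> : d = l * a by rewrite /a mulrC divfK // gt_eqF.
have -> : u = p * w by rewrite /w mulrC divfK // gt_eqF.
rewrite normrM (gtr0_norm l0).
have a4 : `|a| ^+ 4 = a ^+ 4 by rewrite -normrX ger0_norm // exprn_even_ge0.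
have a2 : `|a| ^+ 2 = a ^+ 2 by rewrite -normrX ger0_norm // sqr_ge0.
move: (normr_ge0 a) a4 a2; move: `|a| => e e0 <- e2.
have b1 : e * w ^+ 2 <= e ^+ 4 + w ^+ 4 + 1.
  have := sqr_ge0 (e - w ^+ 2); have := sqr_ge0 (e ^+ 2 - 1); have := sqr_ge0 (w ^+ 2).
  have := sqr_ge0 (e ^+ 2); lra.
have b2 : e ^+ 3 <= e ^+ 4 + 1.
  have := mulr_ge0 (sqr_ge0 e) (sqr_ge0 (e - 1)); have := sqr_ge0 (e ^+ 2 - 1); have := sqr_ge0 (e ^+ 2); lra.
have b3 : l ^+ 2 <= p ^+ 2 by rewrite ler_pXn2r ?nnegrE ?(ltW l0) ?(ltW p0).
have p2 := sqr_ge0 p; have k1 := ler_wpM2l p2 b1; have k2 := ler_wpM2l p2 b2.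
have k3 := ler_wpM2r (exprn_ge0 3 e0) b3.
rewrite -!mulrA ler_pM2l //.
apply: (@le_trans _ _ (e * (3 * (p * w) ^+ 2 + 2 * (l ^+ 2 * e ^+ 2)))).
  rewrite ler_wpM2l // e2; have := sqr_ge0 (p * w + l * a); lra.
by lra.
Qed.

Definition claw2 i j (F : R -> R -> R) := claw i (fun x => claw j (F x)).

Lemma claw2D i j (F G : R -> R -> R) :
  claw2 i j (fun x y => F x y + G x y) = claw2 i j F + claw2 i j G.
Proof. by rewrite /claw2 -clawD; congr (claw _ _); apply/funext => x; rewrite clawD. Qed.

Lemma claw2Z i j a (F : R -> R -> R) :
  claw2 i j (fun x y => a * F x y) = a * claw2 i j F.
Proof. by rewrite /claw2 -clawZ; congr (claw _ _); apply/funext => x; rewrite clawZ. Qed.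

Lemma claw2B i j (F G : R -> R -> R) :
  claw2 i j (fun x y => F x y - G x y) = claw2 i j F - claw2 i j G.
Proof. by rewrite /claw2 -clawB; congr (claw _ _); apply/funext => x; rewrite clawB. Qed.

Lemma claw2_cst i j a : claw2 i j (fun _ _ => a) = a.
Proof. by rewrite /claw2 !claw_cst. Qed.

Lemma ler_claw2 i j (F G : R -> R -> R) : (forall x y, F x y <= G x y) ->
  claw2 i j F <= claw2 i j G.
Proof. by move=> FG; apply: ler_claw => x; apply: ler_claw. Qed.

Lemma ler_norm_claw2 i j (F : R -> R -> R) :
  `|claw2 i j F| <= claw2 i j (fun x y => `|F x y|).
Proof.
by apply: (le_trans (ler_norm_claw _ _)); apply: ler_claw => x; exact: ler_norm_claw.
Qed.

Lemma claw2_affine i j a b c : claw2 i j (fun x y => a * x + b * y + c) = c.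
Proof.
rewrite /claw2; under eq_fun => x.
  rewrite clawD clawD claw_cst clawZ (claw_id R j) claw_cst mulr0 addr0.
  over.
by rewrite clawD clawZ (claw_id R i) claw_cst mulr0 add0r.
Qed.

Lemma claw2_sqr i j a b c : claw2 i j (fun x y => (a * x + b * y + c) ^+ 2) =
  a ^+ 2 * vcost i + b ^+ 2 * vcost j + c ^+ 2.
Proof.
rewrite /claw2; under eq_fun => x.
  rewrite (_ : (fun y => _) = (fun y => (a * x + c) ^+ 2 + (2 * (a * x + c) * b) * y +
     b ^+ 2 * y ^+ 2 + 0 * y ^+ 3 + 0 * y ^+ 4)); last by apply/funext => y; ring.
  rewrite claw_poly claw_sqr !mul0r !addr0.
  rewrite (_ : _ + _ = (c ^+ 2 + b ^+ 2 * vcost j) + (2 * a * c) * x +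
     a ^+ 2 * x ^+ 2 + 0 * x ^+ 3 + 0 * x ^+ 4); last by ring.
  over.
by rewrite claw_poly claw_sqr; ring.
Qed.

Lemma claw2_pow4 i j a b c : claw2 i j (fun x y => (a * x + b * y + c) ^+ 4) <=
  27 * (a ^+ 4 * qcost i + b ^+ 4 * qcost j + c ^+ 4).
Proof.
apply: (@le_trans _ _ (claw2 i j (fun x y =>
   27 * (a ^+ 4 * x ^+ 4 + b ^+ 4 * y ^+ 4 + c ^+ 4)))).
  by apply: ler_claw2 => x y; rewrite -!exprMn; exact: pow4_sum3.
rewrite claw2Z !claw2D !claw2Z claw2_cst /claw2 claw_cst.
by under eq_fun do rewrite claw_cst.
Qed.

(** A kurtosis bound, stated with [sd] because a coefficient [ratio i m] turns [sd m] into
    [sd i]. *)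
Lemma qcost_le_vcost : exists2 K : R, 0 <= K & forall n, qcost n <= K * sd n ^+ 4.
Proof.
have [K K0 hK] := qcost_le R; exists (256 * K); first by rewrite mulr_ge0 ?ler0n.
move=> n; have [n1|n1] := leqP n 1.
  rewrite sd_small // expr0n mulr0.
  case: n n1 => [|[|]] // _; first by rewrite /qcost claw0 expr0n.
  have := sum_toll R 0; rewrite /qcost clawS !big_ord1 !claw0 => ->.
  by rewrite !addr0 expr0n mulr0.
apply: (le_trans (hK n)); rewrite -mulrA [256 * _]mulrC -mulrA ler_wpM2l //.
have -> : n%:R ^+ 4 = (n%:R / 4) ^+ 4 * 256 :> R by field.
by rewrite ler_wpM2r ?ler0n // ler_pXn2r ?nnegrE ?divr_ge0 ?sd_ge0 // sd_ge.
Qed.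

Lemma sum_divn p q (a : nat -> R) : (0 < q)%N ->
  \sum_(k < p * q) a (k %/ q)%N = q%:R * \sum_(i < p) a i.
Proof.
move=> q0; rewrite -(big_mkord xpredT (fun k => a (k %/ q)%N)).
elim: p => [|p IH]; first by rewrite mul0n big_nil big_ord0 mulr0.
rewrite mulSnr (big_cat_nat (n := (p * q)%N)) ?leq_addr //= IH.
rewrite big_ord_recr /= mulrDr; congr (_ + _).
rewrite -{1}[(p * q)%N]add0n big_addn addnC addnK big_mkord.
under eq_bigr => k _ do rewrite addnC divnMDl // divn_small // addn0.
by rewrite sumr_const card_ord mulr_natl.
Qed.

Lemma avg_divn p q (a : nat -> R) : (0 < q)%N -> (0 < p)%N ->
  p%:R^-1 * \sum_(i < p) a i = (p * q)%:R^-1 * \sum_(k < p * q) a (k %/ q)%N.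
Proof.
move=> q0 p0; rewrite sum_divn // natrM; field.
by rewrite !pnatr_eq0 -!lt0n q0 p0.
Qed.

Section Step.
Variables (n m : nat) (f : R -> R).
Hypotheses (nm : (n <= m)%N) (qf : quad_lip f).
Let p := n.+1.
Let q := m.+1.
Let r := ratio p q.
Let I k := (k %/ q)%N.
Let J k := (k %/ p)%N.
Let al k := ratio (I k) (J k).
Let be k := ratio (n - I k) (m - J k).
(** An intermediate cost: it keeps the toll of the split of p but takes the parts of the split of q,
    each rescaled on its own; [fin] rescales everything by the same factor. *)
Let mid k x y := al k * x + be k * y + toll p (I k).
Let fin k x y := r * x + r * y + r * toll q (J k).

Let index_facts k : (k < p * q)%N ->
  [/\ (I k <= n)%N, (J k <= m)%N, (I k <= J k)%N & (n - I k <= m - J k)%N].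
Proof.
move=> kpq; have [h1 h2] := @floor_lt p q k isT nm kpq.
have [r1 r2] := @floor_rev p q k isT nm kpq.
have h3 := @floor_le p q k isT nm.
by rewrite /I /J -[n]/(p.-1) -[m]/(q.-1) r1 r2; split => //; apply: leq_div2l.
Qed.

Lemma mid_le (D : nat -> R) k : (k < p * q)%N ->
  (forall i j g, (i <= n)%N -> (i <= j)%N -> quad_lip g ->
     `|claw i g - claw j (fun x => g (ratio i j * x))| <= D i) ->
  `|claw2 (I k) (n - I k) (fun x y => f (x + y + toll p (I k))) -
    claw2 (J k) (m - J k) (fun x y => f (mid k x y))| <= D (I k) + D (n - I k)%N.
Proof.
move=> kpq hD; have [h1 h2 h3 h4] := index_facts kpq.
set c := toll p (I k).
pose X := claw2 (J k) (n - I k) (fun x y => f (al k * x + y + c)).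
rewrite -(subrKA X); apply: (le_trans (ler_normD _ _)); apply: lerD.
  rewrite /X /claw2 claw_swap [X in _ - X]claw_swap -clawB.
  apply: (le_trans (ler_norm_claw _ _)); rewrite -[leRHS](claw_cst (n - I k)).
  apply: ler_claw => y.
  have := hD (I k) (J k) (fun x => f (x + (y + c))) h1 h3 (quad_lip_shift _ qf).
  by under eq_fun do rewrite addrA; under [X in _ - claw _ X]eq_fun do rewrite addrA.
rewrite /X /claw2 -clawB.
apply: (le_trans (ler_norm_claw _ _)); rewrite -[leRHS](claw_cst (J k)).
apply: ler_claw => x.
have := hD (n - I k)%N (m - J k)%N (fun y => f (y + (al k * x + c))) (leq_subr _ _) h4
  (quad_lip_shift _ qf).
under eq_fun do rewrite addrCA addrA.
by under [X in _ - claw _ X]eq_fun do rewrite addrCA addrA.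
Qed.

Variable K : R.
Hypotheses (K0 : 0 <= K) (hK : forall n, qcost n <= K * sd n ^+ 4).
Let l := harm p.
Let N : R := p%:R.
Let D4 : R := 27 * (2 * K + 1) * 200 ^+ 4.
Let V4 : R := 27 * (2 * K + 1) * 2 ^+ 4.

Let l1 : 1 <= l. Proof. exact: harm_ge1. Qed.
Let lN : l <= N. Proof. exact: harm_le_n. Qed.

Let pow4_le a c i (B : R) : 0 <= B -> `|a * sd i| <= c * B ->
  a ^+ 4 * qcost i <= K * (c * B) ^+ 4.
Proof.
move=> B0 h; apply: (@le_trans _ _ (K * (a * sd i) ^+ 4)).
  rewrite exprMn mulrCA ler_wpM2l ?hK //.
  by rewrite (_ : 4 = 2 * 2)%N // exprM sqr_ge0.
rewrite ler_wpM2l //; have c0 := le_trans (normr_ge0 _) h.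
rewrite -[_ ^+ 4]ger0_norm; last by rewrite (_ : 4 = 2 * 2)%N // exprM sqr_ge0.
by rewrite normrX ler_pXn2r ?nnegrE.
Qed.

(** The coefficients of the two parts are differences of ratios; times [sd] they become, by
    [ratioM], the errors of [sd_coupling]. *)
Lemma diff4_le k : (k < p * q)%N ->
  claw2 (J k) (m - J k) (fun x y => (mid k x y - fin k x y) ^+ 4) <= D4 * l ^+ 4.
Proof.
move=> kpq; have [h1 h2 h3 h4] := index_facts kpq.
have l0 : 0 <= l by move: l1; lra.
have E : (fun x y => (mid k x y - fin k x y) ^+ 4) = (fun x y =>
    ((al k - r) * x + (be k - r) * y + (toll p (I k) - r * toll q (J k))) ^+ 4).
  by apply/funext => x; apply/funext => y; rewrite /mid /fin; ring.
rewrite E; apply: (le_trans (claw2_pow4 _ _ _ _ _)).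
have b1 : `|(al k - r) * sd (J k)| <= 200 * l.
  rewrite mulrBl ratioM //; exact: (@sd_coupling R p q k isT nm kpq).
have b2 : `|(be k - r) * sd (m - J k)| <= 200 * l.
  rewrite mulrBl ratioM //.
  have [r1 r2] := @floor_rev p q k isT nm kpq.
  rewrite -[n]/(p.-1) -[m]/(q.-1) r1 r2.
  by apply: sd_coupling => //; rewrite ltn_subrL muln_gt0.
have b3 := @toll_coupling R n m k nm kpq.
have e1 := pow4_le l0 b1; have e2 := pow4_le l0 b2.
have e3 : (toll p (I k) - r * toll q (J k)) ^+ 4 <= (200 * l) ^+ 4.
  rewrite -[leLHS]ger0_norm; last by rewrite (_ : 4 = 2 * 2)%N // exprM sqr_ge0.
  by rewrite normrX ler_pXn2r ?nnegrE ?mulr_ge0 ?ler0n.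
rewrite /D4 -[leRHS]mulrA; move: e1 e2 e3; rewrite [(200 * l) ^+ 4]exprMn; move: (200 ^+ 4 * l ^+ 4) => Z e1 e2 e3.
by lra.
Qed.

Lemma mid4_le k : (k < p * q)%N ->
  claw2 (J k) (m - J k) (fun x y => mid k x y ^+ 4) <= V4 * N ^+ 4.
Proof.
move=> kpq; have [h1 h2 h3 h4] := index_facts kpq.
have N0 : 0 <= N by [].
apply: (le_trans (claw2_pow4 _ _ _ _ _)).
have b (i : nat) : (i <= n)%N -> `|sd i| <= 2 * N.
  move=> le_in; rewrite ger0_norm ?sd_ge0 // (le_trans (sd_le R i)) //.
  by rewrite ler_wpM2l // ler_nat ltnW.
have b1 : `|al k * sd (J k)| <= 2 * N by rewrite ratioM // b.
have b2 : `|be k * sd (m - J k)| <= 2 * N by rewrite ratioM // b // leq_subr.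
have b3 : `|toll p (I k)| <= 2 * N.
  apply: (le_trans (norm_toll_le R h1)); rewrite -[n.+2%:R]natr1 -/p -/N.
  by move: l1 lN; lra.
have e1 := pow4_le N0 b1; have e2 := pow4_le N0 b2.
have e3 : toll p (I k) ^+ 4 <= (2 * N) ^+ 4.
  rewrite -[leLHS]ger0_norm; last by rewrite (_ : 4 = 2 * 2)%N // exprM sqr_ge0.
  by rewrite normrX ler_pXn2r ?nnegrE ?mulr_ge0 ?ler0n.
rewrite /V4 -[leRHS]mulrA; move: e1 e2 e3; rewrite [(2 * N) ^+ 4]exprMn; move: (2 ^+ 4 * N ^+ 4) => Z e1 e2 e3.
by lra.
Qed.

(** For a single k the moments of [mid] and [fin] may differ; their sums over k agree by [sum_toll]
    and [vcost_rec]. Summing is legitimate because b and c come from the expansion at 0 and are the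
    same for all k. *)
Lemma sum_mid_fin_le :
  `|\sum_(k < p * q) (claw2 (J k) (m - J k) (fun x y => f (mid k x y)) -
     claw2 (J k) (m - J k) (fun x y => f (fin k x y)))| <=
  (p * q)%:R * (l * N ^+ 2 * (5 + 5 * D4 + 3 * V4)).
Proof.
have [b [c hf]] := qf 0.
pose h k x y := f (mid k x y) - f (fin k x y) - b * (mid k x y - fin k x y) -
   c * (mid k x y ^+ 2 - fin k x y ^+ 2).
have hE k : claw2 (J k) (m - J k) (h k) =
  claw2 (J k) (m - J k) (fun x y => f (mid k x y)) -
  claw2 (J k) (m - J k) (fun x y => f (fin k x y))
  - b * (toll p (I k) - r * toll q (J k))
  - c * ((al k ^+ 2 * vcost (J k) + be k ^+ 2 * vcost (m - J k) + toll p (I k) ^+ 2)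
         - (r ^+ 2 * vcost (J k) + r ^+ 2 * vcost (m - J k) + (r * toll q (J k)) ^+ 2)).
  rewrite /h !claw2B !claw2Z !claw2B; congr (_ - b * (_ - _) - c * (_ - _)).
  - exact: claw2_affine.
  - exact: claw2_affine.
  - exact: claw2_sqr.
  - exact: claw2_sqr.
have sumE : \sum_(k < p * q) claw2 (J k) (m - J k) (h k) =
   \sum_(k < p * q) (claw2 (J k) (m - J k) (fun x y => f (mid k x y)) -
     claw2 (J k) (m - J k) (fun x y => f (fin k x y))).
  pose u i : R := b * toll p i + c * (vcost i + vcost (n - i) + toll p i ^+ 2).
  pose w j : R := b * r * toll q j +
     c * r ^+ 2 * (vcost j + vcost (m - j) + toll q j ^+ 2).
  transitivity (\sum_(k < p * q) (claw2 (J k) (m - J k) (fun x y => f (mid k x y)) -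
     claw2 (J k) (m - J k) (fun x y => f (fin k x y))) -
     (\sum_(k < p * q) u (I k) - \sum_(k < p * q) w (J k))).
    rewrite -!sumrB; apply: eq_bigr => k _; rewrite hE /u /w.
    have [h1 h2 h3 h4] := index_facts (ltn_ord k).
    by rewrite !ratio_sqrM //; ring.
  have su : \sum_(k < p * q) u (I k) = q%:R * (c * (p%:R * vcost p)).
    rewrite /I sum_divn // /u big_split /= -mulr_sumr sum_toll mulr0 add0r.
    by rewrite -mulr_sumr vcost_rec.
  have sw : \sum_(k < p * q) w (J k) = p%:R * (c * r ^+ 2 * (q%:R * vcost q)).
    rewrite /J mulnC sum_divn // /w big_split /= -mulr_sumr sum_toll mulr0 add0r.
    by rewrite -mulr_sumr vcost_rec.
  (* Both sums equal c p q [vcost p], by the choice of [ratio p q]. *)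
  rewrite su sw; have pq : (p <= q)%N by [].
  rewrite -(ratio_sqrM R pq) -/r -[RHS]subr0; congr (_ - _).
  by ring.
rewrite -sumE; apply: (le_trans (ler_norm_sum _ _ _)).
have -> : (p * q)%:R * (l * N ^+ 2 * (5 + 5 * D4 + 3 * V4)) =
   \sum_(k < p * q) (l * N ^+ 2 * (5 + 5 * D4 + 3 * V4)).
  by rewrite sumr_const card_ord mulr_natl.
apply: ler_sum => k _; apply: (le_trans (ler_norm_claw2 _ _ _)).
apply: (@le_trans _ _ (claw2 (J k) (m - J k) (fun x y => l * N ^+ 2 *
   (5 + 5 * ((mid k x y - fin k x y) / l) ^+ 4 + 3 * (mid k x y / N) ^+ 4)))).
  apply: ler_claw2 => x y; rewrite /h; have := hf (mid k x y) (fin k x y).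
  rewrite !add0r => h1; apply: (le_trans h1).
  have -> : fin k x y ^+ 2 = (mid k x y - (mid k x y - fin k x y)) ^+ 2 by ring.
  exact: remainder_bound.
have l0 : 0 < l by move: l1; lra.
have N0 : 0 < N by move: l0 lN; lra.
rewrite claw2Z ler_wpM2l ?mulr_ge0 ?sqr_ge0 ?(ltW l0) //.
rewrite !claw2D !claw2Z claw2_cst.
have E4 F (s : R) : 0 < s ->
    claw2 (J k) (m - J k) (fun x y => (F x y / s) ^+ 4) =
    claw2 (J k) (m - J k) (fun x y => F x y ^+ 4) / s ^+ 4.
  move=> s0; rewrite mulrC -claw2Z; congr (claw2 _ _ _).
  by apply/funext => x; apply/funext => y; rewrite exprMn exprVn mulrC.
rewrite !E4 // !lerD // ler_wpM2l // ler_pdivrMr ?exprn_gt0 //.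
  exact: diff4_le.
exact: mid4_le.
Qed.

End Step.

(** The induction on n keeps m and f general, since the step calls it at other indices and for
    shifted functions. The factor 3 arises as in [rec_bound2], after [harm i <= harm p] is taken out
    of the sum. *)
Lemma contraction : exists2 C : R, 0 <= C & forall n m f, (n <= m)%N -> quad_lip f ->
  `|claw n f - claw m (fun x => f (ratio n m * x))| <= C * (n%:R ^+ 2 * harm n).
Proof.
have [K K0 hK] := qcost_le_vcost.
pose C0 : R := 5 + 5 * (27 * (2 * K + 1) * 200 ^+ 4) + 3 * (27 * (2 * K + 1) * 2 ^+ 4).
have e0 (a : R) : 0 <= a -> 0 <= 27 * (2 * K + 1) * a ^+ 4.
  by move=> a0; rewrite mulr_ge0 ?exprn_ge0 // mulr_ge0 ?ler0n // addr_ge0 // mulr_ge0.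
have C00 : 0 <= C0.
  have := e0 _ (ler0n R 200); have := e0 _ (ler0n R 2); rewrite /C0.
  by move: (_ * 2 ^+ 4) (_ * 200 ^+ 4) => u v; lra.
exists (3 * C0); first by rewrite mulr_ge0 ?ler0n.
elim/law_ind => [|n IH] m f nm qf.
  rewrite claw0 /ratio sd_small // mul0r.
  by under eq_fun do rewrite mul0r; rewrite claw_cst subrr normr0 (harm0 R) !mulr0.
case: m nm => // m; rewrite ltnS => nm.
pose p := n.+1; pose q := m.+1.
pose A i := claw2 i (n - i) (fun x y => f (x + y + toll p i)).
pose B j := claw2 j (m - j) (fun x y => f (ratio p q * (x + y + toll q j))).
rewrite !clawS -/p -/q.
rewrite (@avg_divn p q A) // (@avg_divn q p B) // [(q * p)%N]mulnC -mulrBr -sumrB.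
have pq0 : 0 < (p * q)%:R :> R by rewrite ltr0n.
rewrite normrM gtr0_norm ?invr_gt0 // mulrC ler_pdivrMr //.
pose mid k x y := ratio (k %/ q) (k %/ p) * x +
  ratio (n - k %/ q) (m - k %/ p) * y + toll p (k %/ q).
pose M k := claw2 (k %/ p) (m - k %/ p) (fun x y => f (mid k x y)).
pose D i : R := 3 * C0 * (i%:R ^+ 2 * harm i).
have -> : \sum_(k < p * q) (A (k %/ q)%N - B (k %/ p)%N) =
   \sum_(k < p * q) (A (k %/ q)%N - M k) + \sum_(k < p * q) (M k - B (k %/ p)%N).
  by rewrite -big_split; apply: eq_bigr => k _ /=; ring.
apply: (le_trans (ler_normD _ _)).
have s1 : `|\sum_(k < p * q) (A (k %/ q)%N - M k)| <=
    \sum_(k < p * q) (D (k %/ q)%N + D (n - k %/ q)%N).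
  apply: (le_trans (ler_norm_sum _ _ _)); apply: ler_sum => k _.
  by apply: mid_le => // i j g le_in le_ij qg; apply: IH.
have s2 : `|\sum_(k < p * q) (M k - B (k %/ p)%N)| <=
    (p * q)%:R * (harm p * p%:R ^+ 2 * C0).
  have := sum_mid_fin_le nm qf K0 hK; rewrite -/p -/q -/C0.
  congr (`|_| <= _); apply: eq_bigr => k _; congr (_ - _).
  congr (claw2 _ _ _); apply/funext => x; apply/funext => y; congr f.
  by ring.
apply: (le_trans (lerD s1 s2)).
rewrite (sum_divn p (fun i => D i + D (n - i)%N)) // big_split /= (sum_rev n D).
have s3 : \sum_(i < n.+1) D i <= C0 * harm p * p%:R ^+ 3.
  apply: (@le_trans _ _ (\sum_(i < n.+1) 3 * C0 * harm p * i%:R ^+ 2)).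
    apply: ler_sum => i _; rewrite /D [i%:R ^+ 2 * _]mulrC mulrA.
    rewrite ler_wpM2r ?sqr_ge0 // ler_wpM2l ?mulr_ge0 ?ler0n //.
    by rewrite harm_le // ltnW.
  rewrite -mulr_sumr; have := sum_sqr_le R n.+1; rewrite -/p => h.
  have c0 : 0 <= 3 * C0 * harm p by rewrite !mulr_ge0 ?harm_ge0.
  by apply: (le_trans (ler_wpM2l c0 h)); lra.
have q0 : 0 <= q%:R :> R by [].
have := ler_wpM2l q0 (lerD s3 s3); rewrite natrM; lra.
Qed.

End Contraction.


(** * Test functions and the normalised third moment *)

Section TestFunctions.
Set Implicit Arguments.
Unset Strict Implicit.
Unset Printing Implicit Defensive.
Variable R : realType.
Implicit Types (n m : nat) (x y z : R) (f g df : R -> R).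
Local Notation harm := (@harm R).
Local Notation kcost := (@kcost R).
Local Notation claw := (@claw R).
Local Notation sd := (@sd R).
Local Notation sigma := (@sigma R).

Lemma mvt_any f df x y : (forall x, is_derive x 1 f (df x)) ->
  exists c, (x <= c <= y \/ y <= c <= x) /\ f x - f y = df c * (x - y).
Proof.
move=> fdf; have [xy|/ltW yx] := leP x y.
  have [c [xcy E]] := mvt_le xy fdf; exists c; split; first by left.
  by rewrite -[f x - f y]opprB E; ring.
by have [c [ycx E]] := mvt_le yx fdf; exists c; split; first by right.
Qed.

Lemma is_derive_taylor f df (z a c x : R) : (forall x, is_derive x 1 f (df x)) ->
  is_derive x 1 (fun t => f (z + t) - a * t - c * t ^+ 2) (df (z + x) - a - 2 * c * x).
Proof.
move=> fdf; have h1 : is_derive x 1 (fun t => z + t) 1.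
  have -> : (fun t => z + t) = cst z + id by apply/funext.
  by apply: is_derive_eq; rewrite add0r.
have h2 : is_derive x 1 (f \o (fun t => z + t)) (df (z + x)).
  by have := is_derive1_comp (fdf (z + x)) h1; rewrite mulr1.
have -> : (fun t => f (z + t) - a * t - c * t ^+ 2) =
    (f \o (fun t => z + t)) - (a \*: id) - (c \*: (@id R ^+ 2)).
  by apply/funext => t; rewrite /= !fctE.
by apply: is_derive_eq; rewrite /GRing.scale /=; ring.
Qed.

(** The mean value theorem for f minus its Taylor polynomial at z leads to the derivative of this
    difference at some xi between x and y. It is at most xi^2, by the mean value theorem for f' and
    the Lipschitz bound on f'', and xi^2 <= x^2 + y^2. *)
Lemma F3_quad_lip f : F3 f -> quad_lip f.
Proof.
move=> [d1 d2 lip] z.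
have D1 x : is_derive x 1 f (f^`()%classic x) by rewrite derive1E; apply: derivableP.
have D2 x : is_derive x 1 (f^`()%classic) ((f^`(2))%classic x).
  by rewrite /= derive1E; apply: derivableP; exact: d2.
exists (f^`()%classic z), ((f^`(2))%classic z / 2) => x y.
set b := f^`()%classic z; set c := (f^`(2))%classic z.
have [xi [hxi E1]] := mvt_any x y (fun t => is_derive_taylor z b (c / 2) t D1).
have [eta [heta E2]] := mvt_any xi 0 (fun t => is_derive_taylor z c 0 t D2).
have -> : f (z + x) - f (z + y) - b * (x - y) - c / 2 * (x ^+ 2 - y ^+ 2) =
  (f (z + x) - b * x - c / 2 * x ^+ 2) - (f (z + y) - b * y - c / 2 * y ^+ 2) by ring.
rewrite E1 normrM mulrC ler_wpM2l //.
have -> : f^`()%classic (z + xi) - b - 2 * (c / 2) * xi =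
   ((f^`(2))%classic (z + eta) - c) * xi.
  have := E2; rewrite !addr0 /b => E3.
  transitivity (f^`()%classic (z + xi) - c * xi - 0 * xi ^+ 2 -
      (f^`()%classic z - c * 0 - 0 * 0 ^+ 2)); first by field.
  by rewrite E3; ring.
rewrite normrM; have h1 : `|(f^`(2))%classic (z + eta) - c| <= `|xi|.
  apply: (le_trans (lip _ _)); rewrite addrC addKr.
  case: heta => /andP[e1 e2].
    by rewrite ler0_norm // ler0_norm ?lerN2 // (le_trans e1).
  by rewrite ger0_norm // ger0_norm // (le_trans e1).
apply: (le_trans (ler_wpM2r (normr_ge0 _) h1)).
rewrite -expr2 real_normK ?num_real //.
have h2 (u v w : R) : u <= v <= w -> v ^+ 2 <= u ^+ 2 + w ^+ 2.
  move=> /andP[uv vw]; have [v0|/ltW v0] := leP 0 v.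
    have : v ^+ 2 <= w ^+ 2 by rewrite ler_pXn2r ?nnegrE // (le_trans v0).
    by have := sqr_ge0 u; lra.
  have a0 : 0 <= v - u by lra. have b0 : 0 <= - v - u by lra.
  by have := mulr_ge0 a0 b0; have := sqr_ge0 w; lra.
by case: hxi => /h2; lra.
Qed.

Lemma F3_cube : F3 (fun x : R => x ^+ 3 / 6).
Proof.
have D1 x : is_derive x 1 (fun x : R => x ^+ 3 / 6) (x ^+ 2 / 2).
  have -> : (fun x : R => x ^+ 3 / 6) = 6^-1 \*: (@id R ^+ 3).
    by apply/funext => t; rewrite /= !fctE mulrC.
  by apply: is_derive_eq; rewrite /GRing.scale /=; field.
have D2 x : is_derive x 1 (fun x : R => x ^+ 2 / 2) x.
  have -> : (fun x : R => x ^+ 2 / 2) = 2^-1 \*: (@id R ^+ 2).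
    by apply/funext => t; rewrite /= !fctE mulrC.
  by apply: is_derive_eq; rewrite /GRing.scale /=; field.
have E1 : ((fun x : R => x ^+ 3 / 6)^`())%classic = (fun x : R => x ^+ 2 / 2).
  by apply/funext => x; rewrite derive1E; exact: derive_val.
have E2 : ((fun x : R => x ^+ 2 / 2)^`())%classic = id.
  by apply/funext => x; rewrite derive1E; exact: derive_val.
split => [x|x|x y].
- exact: (@ex_derive _ _ _ _ _ _ _ (D1 x)).
- by rewrite E1; exact: (@ex_derive _ _ _ _ _ _ _ (D2 x)).
- by rewrite /= E1 E2.
Qed.

(** The class is homogeneous of degree 3, like the Zolotarev metric; this yields the division by
    [sd n ^+ 3]. *)
Lemma quad_lip_scale f (s : R) : 0 < s -> quad_lip f ->
  quad_lip (fun x => s ^+ 3 * f (x / s)).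
Proof.
move=> s0 qf z; have [b [c h]] := qf (z / s).
exists (s ^+ 2 * b), (s * c) => x y; rewrite !mulrDl.
have -> : s ^+ 3 * f (z / s + x / s) - s ^+ 3 * f (z / s + y / s) -
  s ^+ 2 * b * (x - y) - s * c * (x ^+ 2 - y ^+ 2) =
  s ^+ 3 * (f (z / s + x / s) - f (z / s + y / s) - b * (x / s - y / s) -
    c * ((x / s) ^+ 2 - (y / s) ^+ 2)) by field; rewrite gt_eqF.
rewrite normrM gtr0_norm ?exprn_gt0 //.
apply: (le_trans (ler_wpM2l (exprn_ge0 3 (ltW s0)) (h _ _))).
rewrite -mulrBl normrM [`|s^-1|]gtr0_norm ?invr_gt0 //.
rewrite le_eqVlt; apply/orP; left; apply/eqP; field; rewrite gt_eqF //.
Qed.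

Lemma pair_bound : exists2 C : R, 0 <= C & forall n m f, (1 < n <= m)%N -> quad_lip f ->
  `|claw n (fun x => f (x / sd n)) - claw m (fun x => f (x / sd m))| <=
  C * (harm n / n%:R).
Proof.
have [C C0 hC] := contraction R; exists (64 * C); first by rewrite mulr_ge0 ?ler0n.
move=> n m f /andP[n1 nm] qf.
have n0 : 0 < n%:R :> R by rewrite ltr0n ltnW.
have sn := sd_ge R n1; have s0 : 0 < sd n by apply: lt_le_trans sn; lra.
have s3 : n%:R ^+ 3 / 64 <= sd n ^+ 3.
  have -> : n%:R ^+ 3 / 64 = (n%:R / 4) ^+ 3 :> R by field.
  by rewrite ler_pXn2r ?nnegrE ?sd_ge0 // divr_ge0.
have := hC n m _ nm (quad_lip_scale s0 qf).
rewrite !clawZ -mulrBr normrM gtr0_norm ?exprn_gt0 //.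
have sm0 : 0 < sd m.
  by apply: lt_le_trans (sd_ge R (leq_trans n1 nm)); rewrite divr_gt0 // ltr0n (leq_trans _ nm) // ltnW.
have -> : (fun x => f (@ratio R n m * x / sd n)) = (fun x => f (x / sd m)).
  by apply/funext => x; congr f; rewrite /ratio; field; rewrite !gt_eqF.
set D := `|_| => h.
have D0 : 0 <= D by exact: normr_ge0.
rewrite -(ler_pM2l (_ : 0 < n%:R ^+ 3 / 64)); last by rewrite divr_gt0 ?exprn_gt0.
apply: (le_trans (ler_wpM2r D0 s3)); apply: (le_trans h).
by rewrite le_eqVlt; apply/orP; left; apply/eqP; field; rewrite gt_eqF.
Qed.

(** [harm n >= 8] lets half of n [harm n] absorb the error 4 n of [vcost_asymp]; the third factor is
    bounded by sigma n. *)
Lemma sd3_le n : 8 <= harm n -> (0 < n)%N ->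
  sd n ^+ 3 <= sigma ^+ 3 * n%:R ^+ 3 * (1 - harm n / (2 * sigma ^+ 2 * n%:R)).
Proof.
move=> h8 n0; have N0 : 0 < n%:R :> R by rewrite ltr0n.
have /andP[t1 t2] := sigma_itv R; have t0 : 0 < sigma by lra.
have s0 := sd_ge0 R n.
have v1 : sd n ^+ 2 <= sigma ^+ 2 * n%:R ^+ 2 - n%:R * harm n / 2.
  rewrite sqr_sd; have := vcost_asymp R n.
  have -> : sigma2 R = sigma ^+ 2.
    by rewrite sqr_sqrtr //; have /andP[] := sigma2_itv R; lra.
  rewrite ler_norml => /andP[_ h].
  by have := ler_wpM2l (ltW N0) h8; lra.
have v2 : sd n <= sigma * n%:R.
  rewrite -(ler_pXn2r (ltn0Sn 1)) ?nnegrE ?mulr_ge0 ?(ltW t0) //.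
  apply: (le_trans v1); rewrite exprMn gerBl.
  by rewrite divr_ge0 // mulr_ge0 // (le_trans _ h8).
have -> : sigma ^+ 3 * n%:R ^+ 3 * (1 - harm n / (2 * sigma ^+ 2 * n%:R)) =
   (sigma ^+ 2 * n%:R ^+ 2 - n%:R * harm n / 2) * (sigma * n%:R).
  by field; rewrite !gt_eqF.
by rewrite exprSr ler_pM ?sqr_ge0.
Qed.

Lemma skewness_ge (kappa C : R) : 0 < kappa -> 0 <= C ->
  (forall n, `|kcost n - kappa * n%:R ^+ 3| <= C * n%:R ^+ 2) ->
  exists B : R, forall n, B <= harm n -> (1 < n)%N ->
  kappa / sigma ^+ 3 + kappa / (4 * sigma ^+ 5) * (harm n / n%:R) <= kcost n / sd n ^+ 3.
Proof.
move=> k0 C0 hk; have /andP[t1 t2] := sigma_itv R; have t0 : 0 < sigma by lra.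
exists (8 + 8 * C * sigma ^+ 2 / kappa + 8 * C / kappa) => n hB n1.
have n0 : (0 < n)%N by exact: ltnW.
have N0 : 0 < n%:R :> R by rewrite ltr0n.
have N1 : 1 <= n%:R :> R by rewrite ler1n.
have c1 : 0 <= 8 * C * sigma ^+ 2 / kappa.
  apply: divr_ge0; last exact: ltW.
  by apply: mulr_ge0; [exact: mulr_ge0 | exact: sqr_ge0].
have c2 : 0 <= 8 * C / kappa by apply: divr_ge0; [exact: mulr_ge0 | exact: ltW].
have h8 : 8 <= harm n by lra.
have hn := harm_le_n R n.
have s0 : 0 < sd n by apply: lt_le_trans (sd_ge R n1); lra.
have d3 := sd3_le h8 n0.
set de := harm n / (2 * sigma ^+ 2 * n%:R) in d3.
have st : 0 < sigma ^+ 3 * n%:R ^+ 3 by rewrite mulr_gt0 ?exprn_gt0.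
have s3 : 0 < sd n ^+ 3 by rewrite exprn_gt0.
have de1 : de < 1.
  by have := lt_le_trans s3 d3; rewrite pmulr_rgt0 // subr_gt0.
have de0 : 0 <= de.
  apply: divr_ge0; first exact: harm_ge0.
  by apply: mulr_ge0 => //; apply: mulr_ge0 => //; exact: sqr_ge0.
have kn : kappa * n%:R ^+ 3 - C * n%:R ^+ 2 <= kcost n.
  by have := hk n; rewrite ler_norml => /andP[h _]; lra.
rewrite ler_pdivlMr //; apply: le_trans kn.
(* The second summand of A is the first times de / 2, and (1 + de / 2) (1 - de) <= 1 - de / 2. Half
   of the gain is claimed, the other half pays for C n^2. *)
set A := _ + _.
have A0 : 0 <= A.
  have e3 := exprn_gt0 3 t0; have e5 := exprn_gt0 5 t0.
  apply: addr_ge0; first by rewrite divr_ge0 ?(ltW k0) ?(ltW e3).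
  apply: mulr_ge0; last by rewrite divr_ge0 ?harm_ge0.
  by rewrite divr_ge0 ?(ltW k0) // mulr_ge0 // (ltW e5).
apply: (le_trans (ler_wpM2l A0 d3)).
have hE : harm n = 2 * sigma ^+ 2 * n%:R * de by rewrite /de; field; rewrite !gt_eqF.
have -> : A * (sigma ^+ 3 * n%:R ^+ 3 * (1 - de)) =
   kappa * n%:R ^+ 3 * ((1 + de / 2) * (1 - de)).
  by rewrite /A hE; field; rewrite !gt_eqF.
have hb : C * n%:R ^+ 2 <= kappa * n%:R ^+ 3 * (de / 2).
  have -> : kappa * n%:R ^+ 3 * (de / 2) = n%:R ^+ 2 * (kappa * harm n / (4 * sigma ^+ 2)).
    by rewrite /de; field; rewrite !gt_eqF.
  rewrite mulrC ler_wpM2l ?sqr_ge0 // ler_pdivlMr ?mulr_gt0 ?exprn_gt0 //.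
  have : 8 * C * sigma ^+ 2 / kappa <= harm n by lra.
  rewrite ler_pdivrMr // => h.
  have := mulr_ge0 C0 (sqr_ge0 sigma); lra.
have : (1 + de / 2) * (1 - de) <= 1 - de / 2 by have := sqr_ge0 de; lra.
move=> h; apply: (@le_trans _ _ (kappa * n%:R ^+ 3 * (1 - de / 2))).
  by rewrite ler_wpM2l // mulr_ge0 ?exprn_ge0 // ltW.
by lra.
Qed.

End TestFunctions.


(** * Expectations of functions of the cost *)

Section Partition.
Set Implicit Arguments.
Unset Strict Implicit.
Unset Printing Implicit Defensive.
Context (R : realType) (d : measure_display) (T : measurableType d)
  (P : probability T R).

Lemma prob_bigcup_fin (J : finType) (F : J -> set T) :
  (forall j, measurable (F j)) -> trivIset setT F ->
  P (\bigcup_j F j) = (\sum_j P (F j))%E.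
Proof.
move=> mF tF; rewrite (measure_fin_bigcup P (D := setT)) //; last exact: finite_finset.
rewrite (@fsbigE _ _ _ _ _ (index_enum J)) ?index_enum_uniq //.
  by under eq_bigl do rewrite in_setT.
by move=> i _; rewrite mem_index_enum.
Qed.

Lemma prob_partition (J : finType) (F : J -> set T) (E : set T) :
  (forall j, measurable (F j)) -> trivIset setT F ->
  (\sum_j P (F j) = 1)%E -> measurable E ->
  P E = (\sum_j P (E `&` F j))%E.
Proof.
move=> mF tF F1 mE; set U := \bigcup_j F j.
have mU : measurable U by apply: fin_bigcup_measurable => //; exact: finite_finset.
have PU : P U = 1%E by rewrite prob_bigcup_fin.
have PC : P (~` U) = 0%E by rewrite probability_setC // PU subee.
have -> : P E = (P (E `&` ~` U) + P (E `&` U))%E.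
  rewrite -measureU; first by rewrite -setIUr setvU setIT.
  - by apply: measurableI => //; exact: measurableC.
  - exact: measurableI.
  - by rewrite setIACA setICl setI0.
have -> : P (E `&` ~` U) = 0%E.
  apply/eqP; rewrite eq_le measure_ge0 andbT -PC le_measure ?inE //.
  - by apply: measurableI => //; exact: measurableC.
  - exact: measurableC.
rewrite add0e setI_bigcupr prob_bigcup_fin //.
- by move=> j; apply: measurableI.
- by apply: trivIset_setIl.
Qed.

End Partition.

(** * Identification of the law of the cost *)

Section Bridge.
Set Implicit Arguments.
Unset Strict Implicit.
Unset Printing Implicit Defensive.
Context (R : realType) (d : measure_display) (T : measurableType d)
  (P : probability T R).
Variables (X Xs : nat -> {RV P >-> R}) (I : nat -> {RV P >-> nat}).
Hypothesis X0 : eq_dist P P (X 0%N) (cst (0 : R)).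
Hypothesis XXs : forall n : nat, eq_dist P P (X n) (Xs n).
Hypothesis unifI : forall n : nat, (0 < n)%N -> uniform_below P n (I n).
Hypothesis indep : forall n : nat, (0 < n)%N ->
     independent3 P (sigma_family (fun k w => X k w))
                    (sigma_family (fun k w => Xs k w))
                    (sigma_family (fun (_ : unit) w => I n w)).
Hypothesis Xrec : forall n : nat, (0 < n)%N ->
     eq_dist P P (X n)
       (fun w : T => X (I n w) w + Xs (n - 1 - I n w)%N w + (I n w)%:R).

Let at_ (a : nat) : R -> R := \1_[set (a%:R : R)].

Lemma law_atoms n K (g : R -> R) : (n ^ 2 < K)%N ->
  \sum_(a < K) law n (at_ a) * g a%:R = law n g.
Proof.
move=> nK; under eq_bigr do rewrite mulrC -lawZ.
rewrite -law_sum; apply: law_supp => k kn.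
have kK : (k < K)%N by exact: leq_ltn_trans nK.
rewrite (bigD1 (Ordinal kK)) //= big1 ?addr0 => [|a /eqP ak].
  by rewrite /at_ indicE mem_set // mulr1.
rewrite /at_ indicE memNset ?mulr0 //= => /eqP; rewrite eqr_nat => /eqP ka.
by apply: ak; apply/val_inj.
Qed.

(** Independence concerns fixed indices while the recursion has a random one. Fixing the index and
    the values of both parts determines everything, and by induction finitely many such events carry
    all the mass. *)
Lemma law_distr n B : measurable B -> P (X n @^-1` B) = (law n (\1_B : R -> R))%:E.
Proof.
elim/law_ind: n B => [|n IH] B mB.
  rewrite X0 // law0 preimage_cst indicE; case: ifPn => B0.
    by rewrite probability_setT.
  by rewrite measure0.
pose K := (n ^ 2).+1.
pose J : finType := ('I_n.+1 * 'I_K * 'I_K)%type.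
pose FX (i : nat) (a : nat) := X i @^-1` [set (a%:R : R)].
pose FS (i : nat) (a : nat) := Xs i @^-1` [set (a%:R : R)].
pose FI (i : nat) := I n.+1 @^-1` [set i].
pose F (j : J) := FX j.1.1 j.1.2 `&` FS (n - j.1.1)%N j.2 `&` FI j.1.1.
have mFX i a : measurable (FX i a).
  by rewrite -[FX i a]setTI; apply: measurable_funP => //; exact: measurable_set1.
have mFS i a : measurable (FS i a).
  by rewrite -[FS i a]setTI; apply: measurable_funP => //; exact: measurable_set1.
have mFI i : measurable (FI i).
  by rewrite -[FI i]setTI; apply: measurable_funP.
have mF j : measurable (F j) by apply: measurableI => //; apply: measurableI.
have PFX i a : (i <= n)%N -> P (FX i a) = (law i (at_ a))%:E.
  by move=> le_in; rewrite /FX IH //; exact: measurable_set1.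
have PFS i a : (i <= n)%N -> P (FS i a) = (law i (at_ a))%:E.
  by move=> le_in; rewrite -PFX // /FS /FX XXs //; exact: measurable_set1.
have PF j : P (F j) = (law j.1.1 (at_ j.1.2) * law (n - j.1.1) (at_ j.2) / n.+1%:R)%:E.
  case: j => [[i a] b]; rewrite /F /=.
  rewrite (indep (ltn0Sn n)).
  - have le_in : (i <= n)%N by rewrite -ltnS.
    rewrite (PFX _ _ le_in) (PFS _ _ (leq_subr i n)).
    by rewrite (unifI (ltn0Sn n) (ltn_ord i)) -!EFinM.
  - by apply: sub_gen_smallest; exists (i : nat), [set (a%:R : R)]; split => //; exact: measurable_set1.
  - by apply: sub_gen_smallest; exists (n - i)%N, [set (b%:R : R)]; split => //; exact: measurable_set1.
  - by apply: sub_gen_smallest; exists tt, [set (i : nat)].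
have tF : trivIset setT F.
  apply/trivIsetP => -[[i a] b] [[i' a'] b'] _ _ neq; apply/seteqP; split => // w [].
  rewrite /F /FX /FS /FI /= => -[[ha hb] hi] [[ha' hb'] hi'].
  have ii : i = i' by apply/val_inj; rewrite /= -hi -hi'.
  subst i'; case/eqP: neq; congr (_, _, _); apply/val_inj => /=; apply/eqP.
    by rewrite -(eqr_nat R) -ha -ha'.
  by rewrite -(eqr_nat R) -hb -hb'.
have sumJ (G : nat -> nat -> nat -> R) : \sum_(j : J) G j.1.1 j.1.2 j.2 =
   \sum_(i < n.+1) \sum_(a < K) \sum_(b < K) G i a b.
  rewrite -(pair_bigA _ (fun (ia : 'I_n.+1 * 'I_K) (b : 'I_K) => G ia.1 ia.2 b)) /=.
  by rewrite -(pair_bigA _ (fun (i : 'I_n.+1) (a : 'I_K) => \sum_(b < K) G i a b)).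
have sumG (g : nat -> R -> R -> R) :
  \sum_(j : J) law j.1.1 (at_ j.1.2) * law (n - j.1.1) (at_ j.2) / n.+1%:R *
     g j.1.1 j.1.2%:R j.2%:R =
  n.+1%:R^-1 * \sum_(i < n.+1) law i (fun x => law (n - i) (fun y => g i x y)).
  rewrite (sumJ (fun i a b => law i (at_ a) * law (n - i) (at_ b) / n.+1%:R *
     g i a%:R b%:R)) mulr_sumr; apply: eq_bigr => i _.
  have iK : (i ^ 2 < K)%N by rewrite ltnS leq_sqr -ltnS.
  have niK : ((n - i) ^ 2 < K)%N by rewrite ltnS leq_sqr leq_subr.
  rewrite -(law_atoms _ iK) mulr_sumr; apply: eq_bigr => a _.
  by rewrite -(law_atoms _ niK) !mulr_sumr; apply: eq_bigr => b _; ring.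
pose V w := X (I n.+1 w) w + Xs (n.+1 - 1 - I n.+1 w)%N w + (I n.+1 w)%:R.
(* With its random index, [V] is measurable as it is pieced together over the countably many events
   [FI i]. *)
have mV : measurable (V @^-1` B).
  have -> : V @^-1` B = \bigcup_i (FI i `&`
      (fun w => X i w + Xs (n.+1 - 1 - i)%N w + i%:R) @^-1` B).
    apply/seteqP; split => [w wB|w [i _ [Ii iB]]]; first by exists (I n.+1 w).
    by rewrite /V /=; have <- : i = I n.+1 w by rewrite -Ii.
  apply: bigcupT_measurable => i; apply: measurableI => //.
  rewrite -[X in measurable X]setTI.
  have mf : measurable_fun setT (fun w => X i w + Xs (n.+1 - 1 - i)%N w + i%:R).
    by apply: measurable_funD => //; apply: measurable_funD.
  exact: mf.
rewrite Xrec // (prob_partition (F := F)) //; last first.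
  under eq_bigr do rewrite PF.
  rewrite sumEFin; congr (_%:E).
  have := sumG (fun _ _ _ => 1); under eq_bigr do rewrite mulr1.
  move=> ->; under eq_bigr do rewrite !law_cst.
  by rewrite sumr_const card_ord -[_ *+ _]mulr_natl mulr1 mulVf // pnatr_eq0.
have PEF j : P (V @^-1` B `&` F j) = (law j.1.1 (at_ j.1.2) *
   law (n - j.1.1) (at_ j.2) / n.+1%:R * \1_B (j.1.2%:R + j.2%:R + j.1.1%:R))%:E.
  have FV w : F j w -> V w = j.1.2%:R + j.2%:R + j.1.1%:R.
    rewrite /F /FX /FS /FI /V /= => -[[hx hs] hi].
    by rewrite hi subn1 /= hx hs.
  rewrite indicE; case: (boolP (_ \in B)) => hB; last first.
    rewrite mulr0 (_ : _ `&` _ = set0) ?measure0 //; apply/seteqP; split => // w [wB Fw].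
    by move: hB; rewrite notin_setE -(FV _ Fw).
  rewrite mulr1 -PF; congr (P _); apply/seteqP; split => [w []//|w Fw]; split => //.
  by rewrite /= (FV _ Fw) -inE.
under eq_bigr do rewrite PEF.
rewrite sumEFin; congr (_%:E).
by rewrite (sumG (fun i x y => \1_B (x + y + i%:R))) -lawS.
Qed.

(** Almost surely the composite is a finite combination of indicators of atoms, which covers
    unbounded g. *)
Lemma expectation_law n (g : R -> R) : measurable_fun setT g ->
  ('E_P[g \o X n] = (law n g)%:E)%E.
Proof.
move=> mg; pose K := (n ^ 2).+1.
pose F (a : 'I_K) : set T := X n @^-1` [set (a%:R : R)].
have mF a : measurable (F a).
  by rewrite -[F a]setTI; apply: measurable_funP => //; exact: measurable_set1.
have PF (a : 'I_K) : P (F a) = (law n (at_ a))%:E.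
  by rewrite /F law_distr //; exact: measurable_set1.
have iL (a : 'I_K) : (\1_(F a) : T -> R) \in Lfun P 1.
  by apply/Lfun1_integrable; exact: integrable_indic.
pose h (a : 'I_K) : T -> R := g a%:R \o* \1_(F a).
have E : ('E_P[\sum_(a < K) h a] = (law n g)%:E)%E.
  rewrite -(law_atoms g (ltnSn (n ^ 2))) -sumEFin.
  rewrite -(big_map h xpredT id) /= expectation_sum; last first.
    move=> f /mapP[a _ ->]; apply/Lfun1_integrable.
  have -> : EFin \o h a = ((EFin \o (\1_(F a) : T -> R)) \* cst (g a%:R)%:E)%E.
    by apply/funext => w.
  by apply: integrableZr => //; exact/Lfun1_integrable.
  rewrite big_map; apply: eq_bigr => a _.
  rewrite expectationZl // expectation_indic // PF -EFinM.
  by rewrite mulrC.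
pose U := \bigcup_a F a.
have tF : trivIset setT F.
  apply/trivIsetP => a b _ _ ab; apply/seteqP; split => // w [/= ha hb].
  by case/eqP: ab; apply/val_inj/eqP; rewrite /= -(eqr_nat R) -ha -hb.
have mU : measurable U by apply: fin_bigcup_measurable => //; exact: finite_finset.
have PU : P U = 1%E.
  rewrite prob_bigcup_fin //; under eq_bigr do rewrite PF.
  rewrite sumEFin -[RHS]/(1%:E) -[in RHS](law_cst n (1 : R)) -(law_atoms _ (ltnSn (n ^ 2))).
  by under [in RHS]eq_bigr do rewrite mulr1.
have PC : P (~` U) = 0%E by rewrite probability_setC // PU subee.
rewrite -E unlock; apply: ae_eq_integral => //.
- by apply/measurable_EFinP; exact: measurableT_comp.
- apply/measurable_EFinP.
  have -> : \sum_(a < K) h a = (fun w => \sum_(a < K) (\1_(F a) w * g a%:R)).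
    by apply/funext => w; rewrite fct_sumE.
  apply: measurable_sum => a; apply: measurable_funM => //.
- exists (~` U); split; first exact: measurableC.
    exact: PC.
  move=> w /= hw [a _ Fa]; apply: hw => _ /=; congr (_%:E).
  rewrite fct_sumE (bigD1 a) //= big1 ?addr0 => [|b ba].
    by rewrite /h /= indicE mem_set //= mul1r Fa.
  rewrite /h /= indicE memNset ?mul0r // => Fb.
  by case/eqP: ba; apply/val_inj/eqP; rewrite /= -(eqr_nat R) -Fb -Fa.
Qed.

Lemma expectation_cost n : ('E_P[X n] = (mcost R n)%:E)%E.
Proof. by rewrite -law_id -expectation_law //; exact: measurable_id. Qed.

Lemma variance_cost n : ('V_P[X n] = (vcost R n)%:E)%E.
Proof.
rewrite -claw_sqr /claw -expectation_law; last first.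
  by apply: measurable_funX; apply: measurable_funB.
rewrite /variance unlock expectation_cost /=; congr expectation.
Qed.

End Bridge.


(** * The limit law *)

Section Limit.
Set Implicit Arguments.
Unset Strict Implicit.
Unset Printing Implicit Defensive.
Context (R : realType) (d : measure_display) (T : measurableType d)
  (Q : probability T R) (Y : {RV Q >-> R}).
Implicit Types (h f : R -> R) (n m : nat).
Local Notation claw := (@claw R).
Local Notation sd := (@sd R).
Local Notation sigma := (@sigma R).
Local Notation harm := (@harm R).

Hypothesis cvgY : forall h, continuous h -> (exists M, forall x, `|h x| <= M) ->
  ((claw m (fun x => h (x / m%:R)))%:E @[m --> \oo] --> 'E_Q[h \o Y])%E.

Lemma bounded_Lfun h : continuous h -> (exists M, forall x, `|h x| <= M) ->
  (h \o Y) \in Lfun Q 1.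
Proof.
move=> ch [M hM]; apply/Lfun1_integrable.
apply: (@measurable_bounded_integrable _ _ _ Q (h \o Y) setT) => //.
- by have h1 : (Q setT < +oo)%E by rewrite probability_setT ltry.
- by apply: measurableT_comp => //; exact: continuous_measurable_fun.
- exists M; split; first exact: num_real.
  by move=> N MN t _; apply: (le_trans (hM _)); exact: ltW.
Qed.

Lemma cvgY_eps h : continuous h -> (exists M, forall x, `|h x| <= M) ->
  forall e : R, 0 < e -> exists N, forall m, (N <= m)%N ->
  `|claw m (fun x => h (x / m%:R)) - fine 'E_Q[h \o Y]| <= e.
Proof.
move=> ch bh e e0; have := cvgY ch bh.
have /fineK <- := expectation_fin_num (bounded_Lfun ch bh).
move=> /fine_cvg /cvgrPdist_le/(_ e e0) [N _ hN].
by exists N => m Nm; rewrite distrC; exact: (hN m Nm).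
Qed.

Lemma claw_pow4_le : exists2 K : R, 0 <= K &
  forall m, claw m (fun x => (x / m%:R) ^+ 4) <= K.
Proof.
have [K K0 hK] := qcost_le R; exists K => // m.
under eq_fun do rewrite exprMn mulrC.
rewrite clawZ; case: m => [|m].
  by rewrite invr0 expr0n mul0r.
by rewrite exprVn mulrC ler_pdivrMr ?exprn_gt0 ?ltr0n //; exact: (hK m.+1).
Qed.

(** Weak convergence sees bounded functions only, so x^4 is capped and the cap removed by monotone
    convergence. *)
Lemma pow4_expectation_le (K : R) :
  (forall m, claw m (fun x => (x / m%:R) ^+ 4) <= K) ->
  (\int[Q]_w ((Y w) ^+ 4)%:E <= K%:E)%E.
Proof.
move=> hK; pose u (n : nat) (x : R) : R := Num.min (x ^+ 4) n%:R.
have u0 n x : 0 <= u n x by rewrite /u le_min exprn_even_ge0 //=.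
have bu n : exists M, forall x, `|u n x| <= M.
  by exists n%:R => x; rewrite ger0_norm // /u ge_min lexx orbT.
have cu n : continuous (u n).
  move=> x; apply: (@continuous_min R R (fun x : R => x ^+ 4) (cst n%:R)).
    exact: exprn_continuous.
  exact: cst_continuous.
have EK n : ('E_Q[u n \o Y] <= K%:E)%E.
  apply: (cvge_to_le (cvgY (cu n) (bu n))); apply: nearW => m.
  rewrite lee_fin; apply: le_trans (hK m); apply: ler_claw => x.
  by rewrite /u ge_min lexx.
have mu n : measurable_fun setT (fun w => (u n (Y w))%:E).
  apply/measurable_EFinP; apply: (measurableT_comp (f := u n)) => //.
  exact: continuous_measurable_fun.
have nd w : {homo (fun n => (u n (Y w))%:E) : n m / (n <= m)%N >-> (n <= m)%E}.
  by move=> n m nm; rewrite lee_fin /u le_min !ge_min lexx /= ler_nat nm orbT.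
have := @cvg_monotone_convergence _ T R Q setT measurableT
   (fun n w => (u n (Y w))%:E) mu (fun n w _ => u0 n (Y w)) (fun w _ => nd w).
have -> : (fun w => limn (fun n => (u n (Y w))%:E)) = (fun w => (Y w ^+ 4)%:E).
  apply/funext => w; apply/cvg_lim => //; apply: cvg_near_cst.
  exists (Num.truncn (Y w ^+ 4)).+1 => // n /= hn; congr (_%:E).
  apply/min_idPl; apply: ltW; apply: lt_le_trans (truncnS_gt _) _.
  by rewrite ler_nat.
move=> h; apply: (cvge_to_le h); apply: nearW => n.
by have := EK n; rewrite unlock.
Qed.

(** * Convergence for test functions of cubic growth *)

Definition cubic_lip (C : R) h :=
  forall x y, `|h x - h y| <= C * (`|x - y| * (1 + x ^+ 2 + y ^+ 2)).

Lemma cubic_lip_continuous C h : 0 <= C -> cubic_lip C h -> continuous h.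
Proof.
move=> C0 hh x; apply/cvgrPdist_le => e e0.
pose B := C * (1 + x ^+ 2 + (`|x| + 1) ^+ 2) + 1.
have B0 : 0 < B by rewrite /B ltr_wpDl // mulr_ge0 // !addr_ge0 ?sqr_ge0.
have idc : (fun t : R => t) @ x --> x by exact: cvg_id.
have m0 : 0 < Num.min 1 (e / B) by rewrite lt_min ltr01 divr_gt0.
have near1 : \forall y \near nbhs x, `|x - y| <= Num.min 1 (e / B).
  exact: (pseudometric_normed_Zmodule.cvgr_dist_le (fun t : R => t) x idc _ m0).
apply: filterS near1 => y; rewrite le_min => /andP[xy1 xyB].
apply: (le_trans (hh x y)).
have yb : y ^+ 2 <= (`|x| + 1) ^+ 2.
  rewrite -(real_normK (num_real y)) ler_pXn2r ?nnegrE ?addr_ge0 //.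
  have := ler_normB x (x - y); rewrite opprB addrC subrK; lra.
apply: (@le_trans _ _ (`|x - y| * B)).
  rewrite mulrCA ler_wpM2l // /B.
  have : C * (1 + x ^+ 2 + y ^+ 2) <= C * (1 + x ^+ 2 + (`|x| + 1) ^+ 2).
    by rewrite ler_wpM2l // lerD2l.
  lra.
by rewrite -ler_pdivlMr.
Qed.

Definition clip (M x : R) := Num.max (- M) (Num.min x M).

Lemma clip_le M x : 0 <= M -> `|clip M x| <= M.
Proof.
move=> M0; rewrite /clip ler_norml le_max lexx /= ge_max ge_min lexx orbT andbT.
by lra.
Qed.

Lemma clip_id M x : `|x| <= M -> clip M x = x.
Proof.
rewrite ler_norml => /andP[h1 h2]; rewrite /clip.
by rewrite (min_idPl h2) (max_idPr h1).
Qed.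

Lemma continuous_clip M : continuous (clip M).
Proof.
move=> x; apply: (@continuous_max R R (cst (- M)) (fun x => Num.min x M)).
  exact: cst_continuous.
apply: (@continuous_min R R id (cst M)); first exact: cvg_id.
exact: cst_continuous.
Qed.

(** Where |x| > M the difference is at most C times 2 |x| times 3 x^2, and |x|^3 <= x^4 / M. *)
Lemma clip_error C h M x : 0 <= C -> cubic_lip C h -> 1 <= M ->
  `|h x - h (clip M x)| <= 6 * C / M * x ^+ 4.
Proof.
move=> C0 hh M1; have M0 : 0 < M by lra.
have [xM|/ltW Mx] := leP `|x| M.
  rewrite clip_id // subrr normr0 mulr_ge0 ?exprn_even_ge0 // divr_ge0 ?(ltW M0) //.
  by rewrite mulr_ge0.
have cl := clip_le x (ltW M0).
apply: (le_trans (hh _ _)).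
have c2 : clip M x ^+ 2 <= x ^+ 2.
  rewrite -(real_normK (num_real x)) -(real_normK (num_real (clip M x))).
  by rewrite ler_pXn2r ?nnegrE // (le_trans cl).
have x1 : 1 <= `|x| by exact: le_trans Mx.
have x2 : 1 <= x ^+ 2.
  by rewrite -(real_normK (num_real x)) exprn_ege1.
have d1 : `|x - clip M x| <= 2 * `|x|.
  by apply: (le_trans (ler_normB _ _)); lra.
have e1 : `|x - clip M x| * (1 + x ^+ 2 + clip M x ^+ 2) <= (2 * `|x|) * (3 * x ^+ 2).
  by apply: ler_pM => //; [rewrite !addr_ge0 ?sqr_ge0 | lra].
apply: (le_trans (ler_wpM2l C0 e1)).
have e2 : `|x| <= x ^+ 2 / M.
  by rewrite ler_pdivlMr // -(real_normK (num_real x)) expr2 ler_wpM2l.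
have := ler_wpM2l (mulr_ge0 (mulr_ge0 (ler0n R 6) C0) (sqr_ge0 x)) e2.
have -> : 6 * C * x ^+ 2 * (x ^+ 2 / M) = 6 * C / M * x ^+ 4 by field; rewrite gt_eqF.
lra.
Qed.

Lemma pow4_Lfun (K : R) : (\int[Q]_w ((Y w) ^+ 4)%:E <= K%:E)%E ->
  (fun w => Y w ^+ 4) \in Lfun Q 1.
Proof.
move=> hK; apply/Lfun1_integrable; apply/integrableP; split.
  by apply/measurable_EFinP; apply: measurable_funX.
under eq_integral do rewrite /= ger0_norm ?exprn_even_ge0 //.
by apply: (le_lt_trans hK); rewrite ltry.
Qed.

Lemma dominated_Lfun (f g : T -> R) : measurable_fun setT f -> g \in Lfun Q 1 ->
  (forall w, `|f w| <= g w) -> f \in Lfun Q 1.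
Proof.
move=> mf ig fg; apply/Lfun1_integrable.
apply: (@le_integrable _ _ _ Q setT measurableT _ (EFin \o g)).
- exact/measurable_EFinP.
- by move=> w _ /=; rewrite lee_fin (le_trans (fg w)) // ler_norm.
- exact/Lfun1_integrable.
Qed.

Lemma cubic_lip_limit C h : 0 <= C -> cubic_lip C h ->
  (h \o Y) \in Lfun Q 1 /\
  forall e : R, 0 < e -> exists N, forall m, (N <= m)%N ->
  `|claw m (fun x => h (x / m%:R)) - fine 'E_Q[h \o Y]| <= e.
Proof.
move=> C0 hh; have [K K0 hK] := claw_pow4_le.
have hY := pow4_expectation_le hK.
have iY := pow4_Lfun hY.
have ch := cubic_lip_continuous C0 hh.
have mh : measurable_fun setT (h \o Y).
  by apply: measurableT_comp => //; exact: continuous_measurable_fun.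
have hM (M : R) : 1 <= M -> (h \o clip M \o Y) \in Lfun Q 1 /\
  forall e : R, 0 < e -> exists N, forall m, (N <= m)%N ->
  `|claw m (fun x => h (clip M (x / m%:R))) - fine 'E_Q[h \o clip M \o Y]| <= e.
  move=> M1; have chM : continuous (h \o clip M).
    by move=> x; apply: continuous_comp; [exact: continuous_clip | exact: ch].
  have bM : exists B, forall x, `|(h \o clip M) x| <= B.
    exists (`|h 0| + C * (M * (1 + M ^+ 2))) => x /=.
    rewrite -lerBlDl; apply: (le_trans (lerB_dist _ _)); apply: (le_trans (hh _ _)).
    rewrite subr0 ler_wpM2l // expr0n addr0.
    have cl : `|clip M x| <= M by apply: clip_le; lra.
    apply: ler_pM => //; first by rewrite addr_ge0 ?sqr_ge0.
    rewrite lerD2l -(real_normK (num_real (clip M x))).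
    by rewrite ler_pXn2r ?nnegrE //; lra.
  by split; [exact: bounded_Lfun | exact: cvgY_eps].
have dM (M : R) : 1 <= M -> ((h \o Y) \- (h \o clip M \o Y)) \in Lfun Q 1 /\
   (`|'E_Q[(h \o Y) \- (h \o clip M \o Y)]| <= (6 * C / M * K)%:E)%E.
  move=> M1; have M0 : 0 < M by lra.
  have [iM _] := hM M M1.
  have mD : measurable_fun setT ((h \o Y) \- (h \o clip M \o Y)).
    apply: measurable_funB => //.
    by move/Lfun1_integrable: iM => /integrableP[/measurable_EFinP].
  have cM0 : 0 <= 6 * C / M by rewrite divr_ge0 ?(ltW M0) // mulr_ge0.
  have iG : (6 * C / M \o* (fun w => Y w ^+ 4)) \in Lfun Q 1.
    apply/Lfun1_integrable.
    pose Y4 w : R := Y w ^+ 4; pose D : R := 6 * C / M.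
    have -> : EFin \o (6 * C / M \o* (fun w => Y w ^+ 4)) =
        ((EFin \o Y4) \* cst D%:E)%E by apply/funext.
    by apply: integrableZr => //; exact/Lfun1_integrable.
  have le w : `|((h \o Y) \- (h \o clip M \o Y)) w| <= (6 * C / M \o* (fun w => Y w ^+ 4)) w.
    by rewrite /= mulrC; exact: clip_error.
  have iD := dominated_Lfun mD iG le.
  split => //; rewrite unlock.
  apply: (le_trans (le_abse_integral _ _ _)) => //; first exact/measurable_EFinP.
  apply: (@le_trans _ _ (\int[Q]_w ((6 * C / M)%R%:E * (Y w ^+ 4)%R%:E))%E).
    apply: ge0_le_integral => //.
    - by apply/measurable_EFinP; apply: measurableT_comp.
    - apply/measurable_EFinP; apply: measurable_funM => //; exact: measurable_funX.
    - by move=> w _; rewrite -EFinM lee_fin; have := le w; rewrite /= [_ * (6 * C / M)]mulrC.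
  rewrite ge0_integralZl //.
  - by rewrite [leRHS]EFinM lee_wpmul2l // lee_fin.
  - by apply/measurable_EFinP; apply: measurable_funX.
  - by move=> w _; rewrite lee_fin exprn_even_ge0.
have ihY : (h \o Y) \in Lfun Q 1.
  have [i1 _] := dM 1 (lexx _); have [i2 _] := hM 1 (lexx _).
  have -> : h \o Y = ((h \o Y) \- (h \o clip 1 \o Y)) + (h \o clip 1 \o Y).
    by apply/funext => w; rewrite fctE /= subrK.
  exact: rpredD.
split => // e e0.
(* Makes 6 C K / M at most e / 3: two thirds of e go to the truncations, one to weak convergence. *)
pose M := 1 + 18 * C * K / e.
have M1 : 1 <= M by rewrite lerDl divr_ge0 ?(ltW e0) // !mulr_ge0.
have M0 : 0 < M by lra.
have err : 6 * C / M * K <= e / 3.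
  rewrite mulrAC ler_pdivrMr // /M mulrDr mulr1.
  have -> : e / 3 * (18 * C * K / e) = 6 * C * K by field; rewrite gt_eqF.
  by lra.
have [iM cM] := hM M M1; have [iD eD] := dM M M1.
have e3 : 0 < e / 3 by lra.
have [N hN] := cM _ e3; exists N => m Nm; have h1 := hN m Nm.
have h2 : `|fine 'E_Q[h \o Y] - fine 'E_Q[h \o clip M \o Y]| <= e / 3.
  apply: le_trans err; move: eD; rewrite expectationB //.
  have /fineK <- := expectation_fin_num ihY.
  by have /fineK <- := expectation_fin_num iM; rewrite -EFinB abse_EFin lee_fin.
have h3 : `|claw m (fun x => h (x / m%:R)) - claw m (fun x => h (clip M (x / m%:R)))| <= e / 3.
  apply: le_trans err; rewrite -clawB; apply: (le_trans (ler_norm_claw _ _)).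
  apply: (@le_trans _ _ (claw m (fun x => 6 * C / M * (x / m%:R) ^+ 4))).
    by apply: ler_claw => x; exact: clip_error.
  by rewrite clawZ ler_wpM2l // divr_ge0 ?(ltW M0) // mulr_ge0.
move: h1 h2 h3; rewrite !ler_norml => /andP[a1 a2] /andP[b1 b2] /andP[c1 c2].
by apply/andP; split; lra.
Qed.

Lemma quad_lip_cubic f : quad_lip f -> exists2 C : R, 0 <= C & cubic_lip C f.
Proof.
move=> qf; have [b [c hf]] := qf 0.
exists (`|b| + `|c| + 1); first by rewrite !addr_ge0.
move=> x y; have := hf x y; rewrite !add0r => h.
have -> : f x - f y = (f x - f y - b * (x - y) - c * (x ^+ 2 - y ^+ 2)) +
   (x - y) * (b + c * (x + y)) by ring.
apply: (le_trans (ler_normD _ _)).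
rewrite [`|(x - y) * _|]normrM mulrCA -lerBrDl.
have sq : 0 <= x ^+ 2 + y ^+ 2 by rewrite addr_ge0 ?sqr_ge0.
have h2 : `|b + c * (x + y)| <= `|b| + `|c| * (1 + x ^+ 2 + y ^+ 2).
  apply: (le_trans (ler_normD _ _)); rewrite lerD2l normrM ler_wpM2l //.
  rewrite ler_norml; have := sqr_ge0 (x - 1); have := sqr_ge0 (y - 1).
  have := sqr_ge0 (x + 1); have := sqr_ge0 (y + 1).
  by move=> *; apply/andP; split; lra.
apply: (@le_trans _ _ (`|x - y| * (`|b| + `|c| * (1 + x ^+ 2 + y ^+ 2)))).
  by rewrite ler_wpM2l.
rewrite lerBrDl; apply: (le_trans (lerD h (lexx _))).
rewrite -mulrDr ler_wpM2l //.
by have := mulr_ge0 (normr_ge0 b) sq; have := normr_ge0 b; lra.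
Qed.

(** [mul_harm_tail2] at j = 1 reads (harm m - 1)^2 <= 2 m. *)
Lemma harm_div_le m : (0 < m)%N -> harm m / m%:R <= 6 / Num.sqrt (m%:R : R).
Proof.
move=> m0; have x0 : 0 < m%:R :> R by rewrite ltr0n.
have x1 : 1 <= m%:R :> R by rewrite ler1n.
have := @mul_harm_tail2 R 1 m m0; rewrite mul1r (harm1 R) => h.
set s := Num.sqrt _; have s1 : 1 <= s by rewrite -sqrtr1 ler_wsqrtr.
have s0 : 0 < s by lra.
have sE : s ^+ 2 = m%:R by rewrite sqr_sqrtr // ltW.
rewrite -sE in h *.
have h2 : harm m <= 1 + 2 * s.
  rewrite -lerBlDl; have [|h0] := leP (harm m - 1) 0; first by lra.
  rewrite -(ler_pXn2r (ltn0Sn 1)) ?nnegrE ?(ltW h0) ?mulr_ge0 ?(ltW s0) //.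
  by apply: (le_trans h); have := sqr_ge0 s; lra.
rewrite ler_pdivrMr ?exprn_gt0 //.
have -> : 6 / s * s ^+ 2 = 6 * s by field; rewrite gt_eqF.
by lra.
Qed.

(** Two normalisations are reconciled: [Y] is a limit after division by m, the test is made after
    division by [sd m]. Since m / sd m is within O(harm m / m) of 1 / sigma, the fourth moment pays
    for the exchange. *)
Lemma law_limit f : quad_lip f ->
  ((fun w => f (Y w / sigma)) : T -> R) \in Lfun Q 1 /\
  forall e : R, 0 < e -> exists N, forall m, (N <= m)%N ->
  `|claw m (fun x => f (x / sd m)) - fine 'E_Q[fun w => f (Y w / sigma)]| <= e.
Proof.
move=> qf; have [C C0 hf] := quad_lip_cubic qf.
have /andP[t1 t2] := sigma_itv R; have t0 : 0 < sigma by lra.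
pose h x := f (x / sigma).
have C80 : 0 <= 8 * C by rewrite mulr_ge0.
have hh : cubic_lip (8 * C) h.
  move=> x y; apply: (le_trans (hf _ _)); rewrite -mulrBl normrM.
  have i2 : 0 <= sigma^-1 <= 2.
    rewrite invr_ge0 (ltW t0) /= -[2]invrK lef_pV2 ?posrE //; lra.
  case/andP: i2 => i0 i2.
  have q2 : sigma^-1 ^+ 2 <= 4 by have := ler_pM i0 i0 i2 i2; lra.
  rewrite (ger0_norm i0) -[8 * C * _]mulrA [8 * _]mulrC -[C * _ * _]mulrA ler_wpM2l //.
  rewrite !exprMn.
  have n0 := normr_ge0 (x - y).
  have k1 : `|x - y| * sigma^-1 <= `|x - y| * 2 by rewrite ler_wpM2l.
  have k2 : 1 + x ^+ 2 * sigma^-1 ^+ 2 + y ^+ 2 * sigma^-1 ^+ 2 <=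
      4 * (1 + x ^+ 2 + y ^+ 2).
    have := ler_wpM2l (sqr_ge0 x) q2; have := ler_wpM2l (sqr_ge0 y) q2; lra.
  have k0 : 0 <= 1 + x ^+ 2 * sigma^-1 ^+ 2 + y ^+ 2 * sigma^-1 ^+ 2.
    by rewrite -!exprMn !addr_ge0 // sqr_ge0.
  by have := ler_pM (mulr_ge0 n0 i0) k0 k1 k2; lra.
have [iL cL] := cubic_lip_limit C80 hh.
split => // e e0.
have [K K0 hK] := claw_pow4_le.
have e2 : 0 < e / 2 by lra.
have [N1 hN1] := cL _ e2.
(* 80 is the error of m / sd m, 21 exceeds the sum 16 + 4 of the squared scaling factors, and 6
   comes from [harm_div_le]. *)
pose D := C * 80 * 21 * (2 + 2 * K) * 6.
have D0 : 0 <= D by rewrite /D !mulr_ge0 // addr_ge0 // mulr_ge0.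
exists (maxn (maxn N1 2) (Num.truncn ((D / (e / 2)) ^+ 2)).+1) => m.
rewrite !geq_max -andbA => /and3P[N1m m1 Nm].
have := hN1 m N1m; set l := fine _ => hl.
have -> : l = fine 'E_Q[h \o Y] by [].
have x0 : 0 < m%:R :> R by rewrite ltr0n ltnW.
have sm := sd_ge R m1; have s0 : 0 < sd m by apply: lt_le_trans sm; lra.
suff hd : `|claw m (fun x => f (x / sd m)) - claw m (fun x => h (x / m%:R))| <= e / 2.
  move: hl hd; rewrite -/l !ler_norml => /andP[a1 a2] /andP[b1 b2].
  by apply/andP; split; lra.
have hs := sd_asymp R m; have hm := harm_ge0 R m.
apply: (@le_trans _ _ (D * (harm m / m%:R / 6))).
  rewrite -clawB; apply: (le_trans (ler_norm_claw _ _)).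
  apply: (@le_trans _ _ (claw m (fun x => C * 80 * 21 * (harm m / m%:R) *
       (2 + 2 * (x / m%:R) ^+ 4)))).
    apply: ler_claw => x; apply: (le_trans (hf _ _)).
    set u := x / m%:R; set z := harm m / m%:R.
    have -> : x / sd m = u * (m%:R / sd m) by rewrite /u; field; rewrite !gt_eqF.
    have r4 : 0 <= m%:R / sd m <= 4.
      by rewrite divr_ge0 ?(ltW s0) // ler_pdivrMr //; lra.
    case/andP: r4 => r0 r4.
    have i2 : 0 <= sigma^-1 <= 2.
      rewrite invr_ge0 (ltW t0) /= -[2]invrK lef_pV2 ?posrE //; lra.
    case/andP: i2 => i0 i2.
    have rd : `|m%:R / sd m - sigma^-1| <= 80 * z.
      rewrite /z.
      have -> : m%:R / sd m - sigma^-1 =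
        (sigma * m%:R - sd m) * (m%:R / sd m) * sigma^-1 / m%:R.
        by field; rewrite !gt_eqF.
      rewrite normrM [`|m%:R^-1|]gtr0_norm ?invr_gt0 // mulrA ler_wpM2r ?invr_ge0 ?(ltW x0) //.
      rewrite !normrM [`|m%:R|]gtr0_norm // (gtr0_norm (_ : 0 < (sd m)^-1)) ?invr_gt0 //.
      rewrite (ger0_norm i0) distrC.
      have := ler_pM (normr_ge0 _) r0 hs r4 => k1.
      have := ler_pM (mulr_ge0 (normr_ge0 _) r0) i0 k1 i2; rewrite !mulrA; lra.
    rewrite -mulrBr normrM (_ : C * 80 * 21 * z * _ = C * (1680 * z * (2 + 2 * u ^+ 4)));
      last by rewrite -/z; ring.
    rewrite ler_wpM2l //.
    have u2 := sqr_ge0 u.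
    have p2 : (u * (m%:R / sd m)) ^+ 2 <= 16 * u ^+ 2.
      rewrite exprMn mulrC ler_wpM2r // (_ : 16 = 4 ^+ 2); last by ring.
      by rewrite ler_pXn2r ?nnegrE.
    have q2 : (u * sigma^-1) ^+ 2 <= 4 * u ^+ 2.
      rewrite exprMn mulrC ler_wpM2r // (_ : 4 = 2 ^+ 2); last by ring.
      by rewrite ler_pXn2r ?nnegrE.
    have b1 : 1 + (u * (m%:R / sd m)) ^+ 2 + (u * sigma^-1) ^+ 2 <= 21 * (1 + u ^+ 2) by lra.
    have b2 : `|u| * (1 + u ^+ 2) <= 2 + 2 * u ^+ 4.
      have E4 : u ^+ 4 = `|u| ^+ 4 by rewrite -normrX ger0_norm // exprn_even_ge0.
      rewrite E4 -(real_normK (num_real u)); move: `|u| (normr_ge0 u) => v v0.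
      have := sqr_ge0 (v ^+ 2 - 1); have := sqr_ge0 (v - 1).
      have := mulr_ge0 (sqr_ge0 v) (sqr_ge0 (v - 1)); have := sqr_ge0 (v ^+ 2).
      lra.
    have hx0 : 0 <= z by rewrite divr_ge0 ?(ltW x0).
    have c1 := ler_pM (normr_ge0 u) (normr_ge0 _) (lexx _) rd.
    have c0 : 0 <= 1 + (u * (m%:R / sd m)) ^+ 2 + (u * sigma^-1) ^+ 2.
      by rewrite !addr_ge0 // sqr_ge0.
    have c4 := ler_pM (mulr_ge0 (normr_ge0 _) (normr_ge0 _)) c0 c1 b1.
    have c3 := ler_wpM2l (mulr_ge0 (ler0n R 1680) hx0) b2.
    by apply: (le_trans c4); move: c3; clearbody u z; lra.
  rewrite clawZ clawD claw_cst clawZ.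
  have := hK m => k.
  have c0 : 0 <= C * 80 * 21 * (harm m / m%:R).
    by rewrite !mulr_ge0 ?invr_ge0 ?(ltW x0).
  have k2 : 2 + 2 * claw m (fun x => (x / m%:R) ^+ 4) <= 2 + 2 * K by lra.
  apply: (le_trans (ler_wpM2l c0 k2)); rewrite /D; lra.
have hq := harm_div_le (ltnW m1).
have sq0 : 0 < Num.sqrt (m%:R : R) by rewrite sqrtr_gt0.
have hz : harm m / m%:R / 6 <= (Num.sqrt (m%:R : R))^-1.
  by rewrite ler_pdivrMr // [leRHS]mulrC.
apply: (le_trans (ler_wpM2l D0 hz)).
rewrite ler_pdivrMr // mulrC -ler_pdivrMr //.
rewrite -(ler_pXn2r (ltn0Sn 1)) ?nnegrE ?divr_ge0 ?(ltW sq0) ?(ltW e2) ?(ltW e0) //.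
rewrite sqr_sqrtr ?(ltW x0) //; apply: ltW; apply: lt_le_trans (truncnS_gt _) _.
by rewrite ler_nat.
Qed.

End Limit.


(** * Limit of the normalised third moment *)

Section Skewness.
Set Implicit Arguments.
Unset Strict Implicit.
Unset Printing Implicit Defensive.
Variable R : realType.
Local Notation sd := (@sd R).
Local Notation sigma := (@sigma R).
Local Notation harm := (@harm R).
Local Notation kcost := (@kcost R).

Lemma cvg_squeeze (u : nat -> R) (l C : R) : 0 <= C ->
  (forall m, (0 < m)%N -> `|u m - l| <= C / Num.sqrt (m%:R : R)) -> u @ \oo --> l.
Proof.
move=> C0 hu; apply/cvgrPdist_le => e e0.
exists (Num.truncn ((C / e) ^+ 2)).+1 => // m /= hm.
have m0 : (0 < m)%N by exact: leq_trans hm.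
have sq0 : 0 < Num.sqrt (m%:R : R) by rewrite sqrtr_gt0 ltr0n.
rewrite distrC (le_trans (hu m m0)) // ler_pdivrMr // mulrC -ler_pdivrMr //.
rewrite -(ler_pXn2r (ltn0Sn 1)) ?nnegrE ?divr_ge0 ?(ltW sq0) ?(ltW e0) //.
rewrite sqr_sqrtr //; apply: ltW; apply: lt_le_trans (truncnS_gt _) _.
by rewrite ler_nat.
Qed.

Lemma inv_le_invsqrt m : (0 < m)%N -> m%:R^-1 <= (Num.sqrt (m%:R : R))^-1.
Proof.
move=> m0; have x0 : 0 < m%:R :> R by rewrite ltr0n.
have s1 : 1 <= Num.sqrt (m%:R : R) by rewrite -[leLHS]sqrtr1 ler_wsqrtr ?ler1n.
rewrite lef_pV2 ?posrE ?sqrtr_gt0 // -[leRHS]sqr_sqrtr ?(ltW x0) //.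
by rewrite expr2 ler_peMl //; lra.
Qed.

(** By uniqueness of limits this evaluates the limit functional at the cube, without integrating
    against [Y]. *)
Lemma skewness_cvg (kappa C : R) : 0 <= C ->
  (forall n, `|kcost n - kappa * n%:R ^+ 3| <= C * n%:R ^+ 2) ->
  kcost n / sd n ^+ 3 @[n --> \oo] --> kappa / sigma ^+ 3.
Proof.
move=> C0 hk; have /andP[t1 t2] := sigma_itv R; have t0 : 0 < sigma by lra.
have ku : kcost n / n%:R ^+ 3 @[n --> \oo] --> kappa.
  apply: (cvg_squeeze C0) => m m0; have x0 : 0 < m%:R :> R by rewrite ltr0n.
  have -> : kcost m / m%:R ^+ 3 - kappa = (kcost m - kappa * m%:R ^+ 3) / m%:R ^+ 3.
    by field; rewrite gt_eqF.
  apply: (@le_trans _ _ (C / m%:R)); last by rewrite ler_wpM2l // inv_le_invsqrt.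
  rewrite normrM [`|(_ ^+ 3)^-1|]gtr0_norm ?invr_gt0 ?exprn_gt0 //.
  rewrite ler_pdivrMr ?exprn_gt0 // (le_trans (hk m)) //.
  by rewrite le_eqVlt; apply/orP; left; apply/eqP; field; rewrite gt_eqF.
have kw : sd n / n%:R @[n --> \oo] --> sigma.
  apply: (@cvg_squeeze _ _ 60) => // m m0; have x0 : 0 < m%:R :> R by rewrite ltr0n.
  have -> : sd m / m%:R - sigma = (sd m - sigma * m%:R) / m%:R.
    by field; rewrite gt_eqF.
  rewrite normrM [`|_^-1|]gtr0_norm ?invr_gt0 //.
  apply: (@le_trans _ _ (10 * (harm m / m%:R))).
    by rewrite mulrA ler_wpM2r ?invr_ge0 ?(ltW x0) // sd_asymp.
  by have := harm_div_le R m0; move: (harm m / m%:R) => a; move: ((Num.sqrt _)^-1) => b; lra.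
have kr : (kcost n / n%:R ^+ 3) / (sd n / n%:R) ^+ 3 @[n --> \oo] --> kappa / sigma ^+ 3.
  apply: cvgM => //; apply: cvgV; first by rewrite expf_neq0 // gt_eqF.
  have E3 (x : R) : x ^+ 3 = x * (x * x) by ring.
  rewrite E3; under eq_fun do rewrite E3.
  exact: (cvgM kw (cvgM kw kw)).
apply: cvg_trans kr; apply: near_eq_cvg.
exists 2%N => // m /= m1; have x0 : 0 < m%:R :> R by rewrite ltr0n ltnW.
have s0 : 0 < sd m by apply: lt_le_trans (sd_ge R m1) ; lra.
by field; rewrite !gt_eqF.
Qed.

End Skewness.

(** * Both bounds for the Zolotarev distance *)

Theorem theorem1 (R : realType)
  (d : measure_display) (T : measurableType d) (P : probability T R)
  (X Xs : nat -> {RV P >-> R}) (I : nat -> {RV P >-> nat})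
  (X0 : eq_dist P P (X 0%N) (cst (0 : R)))
  (XXs : forall n : nat, eq_dist P P (X n) (Xs n))
  (unifI : forall n : nat, (0 < n)%N -> uniform_below P n (I n))
  (indep : forall n : nat, (0 < n)%N ->
     independent3 P (sigma_family (fun k w => X k w))
                    (sigma_family (fun k w => Xs k w))
                    (sigma_family (fun (_ : unit) w => I n w)))
  (Xrec : forall n : nat, (0 < n)%N ->
     eq_dist P P (X n)
       (fun w : T => X (I n w) w + Xs (n - 1 - I n w)%N w + (I n w)%:R))
  (d' : measure_display) (T' : measurableType d') (Q : probability T' R)
  (Y : {RV Q >-> R})
  (limY : cvg_in_dist P Q
     (fun (n : nat) (w : T) => (X n w - fine 'E_P[X n]%E) / n%:R) Y) :
  let sigma : R := Num.sqrt (2 - pi ^+ 2 / 6) in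
  is_Theta
    (fun n : nat => zeta3 P Q
       (fun w : T => (X n w - fine 'E_P[X n]%E) / Num.sqrt (fine 'V_P[X n]%E))
       (fun w : T' => Y w / sigma))
    (fun n : nat => ln (n%:R : R) / n%:R).

Proof.
move=> s.
have hL n g := @expectation_law R d T P X Xs I X0 XXs unifI indep Xrec n g.
have hE n := @expectation_cost R d T P X Xs I X0 XXs unifI indep Xrec n.
have hV n := @variance_cost R d T P X Xs I X0 XXs unifI indep Xrec n.
have cvgY h : continuous h -> (exists M, forall x, `|h x| <= M) ->
  ((claw n (fun x => h (x / n%:R)))%:E @[n --> \oo] --> 'E_Q[h \o Y])%E.
  move=> ch bh; rewrite (_ : (fun n => _) = (fun n =>
    'E_P[h \o (fun w => ((X n w - fine 'E_P[X n]%E) / n%:R)%R)]%E)); first exact: limY.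
  apply/funext => n; rewrite /claw -hL //.
    by rewrite hE.
  apply: continuous_measurable_fun => x.
  apply: (@continuous_comp _ _ _ (fun x => (x - mcost R n) / n%:R) h); last exact: ch.
  apply: cvgMl; apply: cvgB => //; exact: cvg_cst.
have EP n f : continuous f ->
  'E_P[f \o (fun w => ((X n w - fine 'E_P[X n]%E) / Num.sqrt (fine 'V_P[X n]%E))%R)]%E =
  (claw n (fun x => f (x / sd R n)))%:E.
  move=> cf; rewrite hE hV /= -/(sd R n) /claw -hL //.
  apply: continuous_measurable_fun => x.
  apply: (@continuous_comp _ _ _ (fun x => (x - mcost R n) / sd R n) f); last exact: cf.
  apply: cvgMl; apply: cvgB => //; exact: cvg_cst.
have cF f : F3 f -> continuous f.
  move=> Ff; have [C C0 hC] := quad_lip_cubic (F3_quad_lip Ff).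
  exact: cubic_lip_continuous C0 hC.
have lim f (Ff : F3 f) := law_limit cvgY (F3_quad_lip Ff).
pose l f := fine ('E_Q[fun w => f (Y w / s)%R])%E.
have lE f : F3 f -> 'E_Q[f \o (fun w => (Y w / s)%R)]%E = (l f)%:E.
  by move=> Ff; rewrite fineK //; apply: expectation_fin_num; exact: (lim f Ff).1.
have [C C0 hC] := pair_bound R.
have upper n f : (1 < n)%N -> F3 f ->
    `|claw n (fun x => f (x / sd R n)) - l f| <= C * (harm R n / n%:R).
  move=> n1 Ff; apply/ler_addgt0Pl => e e0.
  have [N hN] := (lim f Ff).2 e e0.
  (* [pair_bound] is uniform in m, so m may be taken as far out as f and e demand. *)
  pose m := maxn n N.
  have h1 := hC n m f; rewrite n1 leq_maxl in h1; have {}h1 := h1 isT (F3_quad_lip Ff).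
  have h2 := hN m (leq_maxr _ _).
  rewrite -(subrKA (claw m (fun x => f (x / sd R m)))).
  by apply: (le_trans (ler_normD _ _)); rewrite addrC lerD.
have [kappa [D [k0 D0 hk]]] := kcost_asymp R.
have /andP[t1 t2] := sigma_itv R; have t0 : 0 < sigma R by lra.
pose f3 (x : R) := x ^+ 3 / 6.
have c3 n : claw n (fun x => f3 (x / sd R n)) = kcost R n / sd R n ^+ 3 / 6.
  rewrite /f3 /kcost (_ : (fun x => _) = (fun x => (sd R n) ^- 3 / 6 * x ^+ 3)).
    by rewrite clawZ; ring.
  by apply/funext => x; rewrite exprMn exprVn; ring.
have l3 : l f3 = kappa / sigma R ^+ 3 / 6.
  have h1 : claw n (fun x => f3 (x / sd R n)) @[n --> \oo] --> l f3.
    apply/cvgrPdist_le => e e0; have [N hN] := (lim _ (F3_cube R)).2 e e0.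
    by exists N => // n /= Nn; rewrite distrC; exact: hN.
  have h2 : claw n (fun x => f3 (x / sd R n)) @[n --> \oo] --> kappa / sigma R ^+ 3 / 6.
    under eq_fun do rewrite c3.
    by apply: cvgMl; exact: skewness_cvg D0 hk.
  exact: (cvg_unique _ h1 h2).
have [B hB] := skewness_ge k0 D0 hk.
(* The coefficient kappa / (4 sigma^5) of [skewness_ge], divided by the 6 of the test function. *)
pose c1 := kappa / (24 * sigma R ^+ 5).
have c10 : 0 < c1 by rewrite divr_gt0 // mulr_gt0 // exprn_gt0.
exists c1, (c1 + 3 * C); split; [exact: c10 | by rewrite lerDl mulr_ge0 |].
(* Beyond e^B one has B <= ln n <= [harm n]; and n >= 2 gives ln n >= 1/2, whence [harm n] <= 1 + ln
   n <= 3 ln n. *)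
exists (maxn 2 (Num.truncn (expR B)).+1) => // n /=; rewrite geq_max => /andP[n1 Bn].
have x0 : 0 < n%:R :> R by rewrite ltr0n ltnW.
have Bh : B <= harm R n.
  apply: le_trans (ln_le_harm R n); rewrite -ler_expR lnK ?posrE ?ltr0n //.
  apply: ltW; apply: lt_le_trans (truncnS_gt _) _; rewrite ler_nat.
  exact: leq_trans Bn _.
have lh : ln n%:R <= harm R n.
  by apply: le_trans (ln_le_harm R n); rewrite ler_ln ?posrE ?ltr0n ?ler_nat ?(ltnW n1).
have l2 : 1 / 2 <= ln n%:R :> R.
  apply: (@le_trans _ _ (ln 2)); last by rewrite ler_ln ?posrE ?ltr0n ?ler_nat ?(ltnW n1).
  have := @ln_leB1 R 2^-1; rewrite invr_gt0 lnV ?posrE // => /(_ (ltr0n R 2)); lra.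
have hl : harm R n <= 3 * ln n%:R by have := harm_le_ln R (ltnW n1); lra.
have i0 : 0 <= n%:R^-1 :> R by rewrite invr_ge0 ltW.
apply/andP; split.
- apply: (@le_trans _ _ `|(claw n (fun x => f3 (x / sd R n)))%:E - (l f3)%:E|%E).
    rewrite -EFinB abse_EFin lee_fin; apply: le_trans (ler_norm _).
    rewrite c3 l3 -mulrBl.
    have h := hB n Bh n1.
    have -> : c1 * (ln n%:R / n%:R) = kappa / (4 * sigma R ^+ 5) * (ln n%:R / n%:R) / 6.
      by rewrite /c1; field; rewrite !gt_eqF.
    rewrite ler_wpM2r ?invr_ge0 // lerBrDl; apply: le_trans h.
    rewrite lerD2l ler_wpM2l ?ler_wpM2r // divr_ge0 ?(ltW k0) // mulr_ge0 //.
    by rewrite exprn_ge0 // ltW.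
  apply: ereal_sup_ubound; exists f3; first exact: F3_cube.
  by rewrite EP ?lE //; [exact: F3_cube | apply: cF; exact: F3_cube].
- apply: ge_ereal_sup => _ [f Ff <-].
  rewrite EP; last exact: cF.
  rewrite lE // -EFinB abse_EFin lee_fin (le_trans (upper n f n1 Ff)) //.
  have h1 : harm R n / n%:R <= 3 * (ln n%:R / n%:R).
    by rewrite mulrA ler_wpM2r.
  apply: (le_trans (ler_wpM2l C0 h1)).
  have h2 : 0 <= c1 * (ln n%:R / n%:R).
    by rewrite mulr_ge0 ?(ltW c10) // mulr_ge0 //; lra.
  by move: h2; move: (ln n%:R / n%:R) => z; lra.
Qed.
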